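(* Let $U$ and $M$ be finite-dimensional smooth manifolds, $\varphi:U\to\mathbb{R}$ a smooth function and $\Phi:U\to M$ a smooth submersion, and suppose that $(\varphi,\Phi)$ is a Morse problem. Let $L=\{(u,\lambda):u\in U,\ \lambda\in T^*_{\Phi(u)}M,\ d_u\varphi=\lambda D_u\Phi\}$ and let $\mathcal{L}\subset T^*M$ be the immersed Lagrangian submanifold given by the immersion $(u,\lambda)\mapsto\lambda$ of $L$. Let $\gamma:[t_0,t_1]\to\mathcal{L}$ be a continuous curve, i.e. $\gamma(t)=\lambda_t$ for a continuous curve $t\mapsto(u_t,\lambda_t)$ in $L$, put $q_t=\Phi(u_t)$, and assume that at $t=t_0$ and $t=t_1$ the tangent space $T_{\gamma(t)}\mathcal{L}$ is transversal to the vertical subspace $T_{\gamma(t)}(T^*_{q_t}M)$. Then $$-2\,\mu(\gamma)=\operatorname{sgn}\operatorname{Hess}_{u_{t_1}}\varphi|_{\Phi^{-1}(q_{t_1})}-\operatorname{sgn}\operatorname{Hess}_{u_{t_0}}\varphi|_{\Phi^{-1}(q_{t_0})},$$ where $\mu(\gamma)$ is the Maslov cocycle of $\gamma$.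
   Context: Local coordinates: $\lambda=(p,q)$ with $q$ the coordinates on $M$ and $p$ the coordinates in the fibre of $T^*M$; symplectic form $\sigma=dp_i\wedge dq^i$, i.e. $\sigma((\delta p_1,\delta q_1),(\delta p_2,\delta q_2))=\delta p_1\delta q_2-\delta p_2\delta q_1$. Morse problem: zero is a regular value of the map $(p,q,u)\mapsto\frac{d\varphi}{du}-p\frac{d\Phi}{du}$, i.e. the differential $(\delta u,\delta p)\mapsto Q\delta u-\delta p\frac{d\Phi}{du}$, where $Q=\frac{d^2\varphi}{du^2}-p\frac{d^2\Phi}{du^2}$, is surjective at every point of $L$. In that case $L$ is a smooth manifold and $(u,\lambda)\mapsto\lambda$ is a Lagrangian immersion, whose tangent space at $(u,\lambda)$ (denoted $T_\lambda\mathcal{L}$) is $\{(\delta p,\delta q):\exists\,\delta u\in T_uU,\ \frac{d\Phi}{du}\delta u=\delta q,\ Q\delta u=\delta p\frac{d\Phi}{du}\}$. Hessian: $\operatorname{Hess}_u\varphi|_{\Phi^{-1}(q)}$ is the quadratic form $v\mapsto\langle Qv,v\rangle$ on $\ker D_u\Phi$ (the second derivative of $\varphi|_{\Phi^{-1}(q)}$ at the critical point $u$). The symbol $\operatorname{sgn}$ denotes the signature (number of positive minus number of negative squares). Maslov index of a curve: let $(W,\sigma)$ be a symplectic space, $L(W)$ its Lagrangian Grassmannian (the manifold of all Lagrangian subspaces), and $\Delta\in L(W)$. The Maslov train $\mathcal{M}_\Delta$ is the set of $\Lambda\in L(W)$ with $\Lambda\cap\Delta\neq0$; it is a singular hypersurface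 whose smooth points are those with $\dim(\Lambda\cap\Delta)=1$. For a smooth curve $\Lambda_t$ in $L(W)$, let $\underline{\dot\Lambda}_t$ be the quadratic form on $\Lambda_t$ given by $\underline{\dot\Lambda}_t(\lambda_t)=\sigma(\lambda_t,\dot\lambda_t)$ for any smooth $\lambda_t\in\Lambda_t$. At a smooth point of $\mathcal{M}_\Delta$, the intersection of the curve with $\mathcal{M}_\Delta$ is transversal if $\underline{\dot\Lambda}_t(\lambda)\ne0$ for $0\neq\lambda\in\Lambda_t\cap\Delta$; it is counted as $+1$ if $\underline{\dot\Lambda}_t(\lambda)>0$ and as $-1$ if $\underline{\dot\Lambda}_t(\lambda)<0$. For a continuous curve $\Lambda_\cdot$ with endpoints not in $\mathcal{M}_\Delta$, the intersection number $\Lambda_\cdot\circ\mathcal{M}_\Delta$ is the sum of these signs for a generic smooth curve homotopic to it with the same endpoints (it is homotopy invariant). Maslov cocycle: along $\gamma$ consider $L_t=T_{\gamma(t)}\mathcal{L}\subset T_{\gamma(t)}(T^*M)$ and the vertical subspaces $T_{\gamma(t)}(T^*_{q_t}M)$. Trivialize the symplectic bundle $T_{\gamma(t)}(T^*M)$, $t\in[t_0,t_1]$, by symplectic maps so that the symplectic space and the vertical subspace become a fixed symplectic space and a fixed Lagrangian subspace $\Pi$; then $\mu(\gamma):=L_\cdot\circ\mathcal{M}_\Pi$, which is independent of the trivialization. *)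

(* Defs.v *)
(* Conventions.  Points and tangent vectors of R^n are row vectors, so that   *)
(* the library Jacobian satisfies  'D_v f a = v *m 'J f a  and                *)
(* 'J (g \o f) a = 'J f a *m 'J g (f a); covectors are column vectors.        *)
(* Objects attached to a point of a manifold are given by their coordinates   *)
(* in all the charts of the atlas around that point.                          *)
From HB Require Import structures.
From mathcomp Require Import all_boot all_order all_algebra.
From mathcomp Require Import all_classical all_reals all_analysis.

Set Implicit Arguments.
Unset Strict Implicit.
Unset Printing Implicit Defensive.

Import Order.TTheory GRing.Theory Num.Theory.
Import numFieldNormedType.Exports.

Local Open Scope classical_set_scope.
Local Open Scope ring_scope.

Section Calculus.
Variable R : realType.

(* C^oo on the open set A: all iterated directional derivatives exist and are
   differentiable on A. *)
Definition smooth_on (V : normedModType R) (A : set V) (f : V -> R) : Prop :=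
  forall (s : seq V) (x : V), A x ->
    differentiable (foldr (fun v (g : V -> R) => fun y => 'D_v g y) f s) x.

Definition smooth_map_on (V : normedModType R) k l (A : set V)
    (f : V -> 'M[R]_(k, l)) : Prop :=
  forall i j, smooth_on A (fun x => f x i j).

Definition grad n (f : 'rV[R]_n -> R) (x : 'rV[R]_n) : 'cV[R]_n :=
  \col_i 'D_(delta_mx 0 i) f x.

Definition hess n (f : 'rV[R]_n -> R) (x : 'rV[R]_n) : 'M[R]_n :=
  \matrix_(i, j) 'D_(delta_mx 0 i) (fun y => 'D_(delta_mx 0 j) f y) x.

End Calculus.

Section Signature.
Variables (R : realType) (n : nat).

(* In some basis of K (the rows of B) f is the sum of the e_i x_i^2, and s is
   the number of positive minus the number of negative e_i. *)
Definition has_signature (K : set 'rV[R]_n) (f : 'rV[R]_n -> R) (s : int) :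
    Prop :=
  exists (k : nat) (B : 'M[R]_(k, n)) (e : 'I_k -> R),
    [/\ row_free B,
        K = range (fun x : 'rV[R]_k => x *m B),
        forall x : 'rV[R]_k, f (x *m B) = \sum_i e i * x 0 i ^+ 2 &
        s = #|[pred i | 0 < e i]|%:Z - #|[pred i | e i < 0]|%:Z].

Definition signature (K : set 'rV[R]_n) (f : 'rV[R]_n -> R) : int :=
  xget 0 (has_signature K f).

End Signature.

(* The values of chart_map outside chart_dom, and of chart_inv outside the
   image of chart_dom, are irrelevant. *)
Record chart (R : realType) (n : nat) (X : topologicalType) := Chart {
  chart_dom : set X;
  chart_map :> X -> 'rV[R]_n;
  chart_inv : 'rV[R]_n -> X }.

Definition is_chart (R : realType) n (X : topologicalType) (c : chart R n X) :
    Prop :=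
  [/\ open (chart_dom c),
      open (c @` chart_dom c),
      forall x, chart_dom c x -> chart_inv c (c x) = x,
      {within chart_dom c, continuous c} &
      {within c @` chart_dom c, continuous (chart_inv c)}].

Record manifold (R : realType) (n : nat) := Manifold {
  mcarrier :> topologicalType;
  atlas : set (chart R n mcarrier);
  manifold_hausdorff : hausdorff_space mcarrier;
  manifold_second_countable : @second_countable mcarrier;
  atlas_chart : forall c, atlas c -> is_chart c;
  atlas_cover : forall x, exists2 c, atlas c & chart_dom c x;
  atlas_compat : forall c d, atlas c -> atlas d ->
    smooth_map_on (c @` (chart_dom c `&` chart_dom d)) (d \o chart_inv c) }.

Definition charts_at (R : realType) n (X : manifold R n) (x : X) :
    set (chart R n X) :=
  [set c | atlas c /\ chart_dom c x].

Section Maps.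
Variables (R : realType) (n m : nat) (U : manifold R n) (M : manifold R m).

Definition smooth_fun (f : U -> R) : Prop :=
  forall c, atlas c -> smooth_on (c @` chart_dom c) (f \o chart_inv c).

Definition smooth_map (F : U -> M) : Prop :=
  continuous F /\
  forall c d, atlas c -> atlas d ->
    smooth_map_on (c @` (chart_dom c `&` F @^-1` chart_dom d))
      (d \o F \o chart_inv c).

(* D_u F in the charts c and d; v *m dmap F c d u is the image of v. *)
Definition dmap (F : U -> M) (c : chart R n U) (d : chart R m M) (u : U) :
    'M[R]_(n, m) :=
  'J (d \o F \o chart_inv c) (c u).

Definition submersion (F : U -> M) : Prop :=
  smooth_map F /\
  forall u c d, charts_at u c -> charts_at (F u) d -> row_full (dmap F c d u).

End Maps.

Section Cotangent.
Variables (R : realType) (m : nat) (M : manifold R m).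

(* A covector at q is the family of its components in the charts around q; the
   components in the other charts are set to 0, so that a covector is
   determined by its actual components. *)
Record cotangent := Cotangent {
  ct_base : M;
  ct_comp : chart R m M -> 'cV[R]_m;
  ct_compat : forall c d, charts_at ct_base c -> charts_at ct_base d ->
    ct_comp c = 'J (d \o chart_inv c) (c ct_base) *m ct_comp d;
  ct_junk : forall c, ~ charts_at ct_base c -> ct_comp c = 0 }.

(* Coordinates (p, q) of a point of T^*M. *)
Definition ct_coord (d : chart R m M) (lam : cotangent) : 'rV[R]_(m + m) :=
  row_mx (ct_comp lam d)^T (d (ct_base lam)).

(* The change of coordinates (p, q) |-> (p', q') of T^*M induced by two charts
   of M. *)
Definition ct_change (d d' : chart R m M) (z : 'rV[R]_(m + m)) :
    'rV[R]_(m + m) :=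
  let q' := d' (chart_inv d (rsubmx z)) in
  row_mx ('J (d \o chart_inv d') q' *m (lsubmx z)^T)^T q'.

(* Continuity of a curve in T^*M: its base point and its components in each
   chart are continuous. *)
Definition ct_continuous (D : set R) (lam : R -> cotangent) : Prop :=
  {within D, continuous (fun t => ct_base (lam t))} /\
  forall d, atlas d ->
    {within D `&` [set t | chart_dom d (ct_base (lam t))],
      continuous (fun t => ct_comp (lam t) d)}.

End Cotangent.

Section LagrangianGrassmannian.
Variables (R : realType) (m : nat).

(* Vectors are pairs row_mx dp dq. *)
Local Notation W := 'rV[R]_(m + m).

Definition sympl (v w : W) : R :=
  (lsubmx v *m (rsubmx w)^T - lsubmx w *m (rsubmx v)^T) 0 0.

(* Being equal to its skew-orthogonal complement, a Lagrangian set is a linear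
   subspace. *)
Definition lagrangian (Lam : set W) : Prop :=
  Lam = [set w | forall v, Lam v -> sympl v w = 0].

Definition vertical : set W := [set z | rsubmx z = 0].

Definition row_span (F : 'M[R]_(m, m + m)) : set W :=
  range (fun x : 'rV[R]_m => x *m F).

(* A map to L(W) is continuous (smooth) when it locally has continuous
   (smooth) frames. *)
Definition lag_continuous (X : topologicalType) (D : set X)
    (Lam : X -> set W) : Prop :=
  forall x, D x -> lagrangian (Lam x) /\
    exists (N : set X) (F : X -> 'M[R]_(m, m + m)),
      [/\ nbhs x N, {within N `&` D, continuous F} &
          forall y, N y -> D y -> Lam y = row_span (F y)].

Definition lag_smooth_curve (D : set R) (Lam : R -> set W) : Prop :=
  forall t, D t -> lagrangian (Lam t) /\
    exists (N : set R) (F : R -> 'M[R]_(m, m + m)),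
      [/\ open_nbhs t N, smooth_map_on N F &
          forall s, N s -> D s -> Lam s = row_span (F s)].

Definition lag_homotopic (t0 t1 : R) (Lam Gam : R -> set W) : Prop :=
  exists H : R * R -> set W,
    [/\ lag_continuous ([set s : R | 0 <= s <= 1] `*` [set t : R | t0 <= t <= t1]) H,
        forall t, t0 <= t <= t1 -> H (0, t) = Lam t,
        forall t, t0 <= t <= t1 -> H (1, t) = Gam t,
        forall s, 0 <= s <= 1 -> H (s, t0) = Lam t0 &
        forall s, 0 <= s <= 1 -> H (s, t1) = Lam t1].

(* The quadratic form v |-> sigma(l t, l' t), l being any smooth curve of
   vectors l s in Lam s with l t = v (t is an interior time). *)
Definition lag_dot (Lam : R -> set W) (t : R) (v : W) : R :=
  xget 0 [set r | exists (N : set R) (l : R -> W),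
    [/\ open_nbhs t N, smooth_map_on N l, forall s, N s -> Lam s (l s),
        l t = v & r = sympl (l t) ('D_1 l t)]].

Definition train (Del : set W) : set (set W) :=
  [set Lam | exists2 v, (Lam `&` Del) v & v != 0].

Definition train_smooth_point (Del Lam : set W) : Prop :=
  exists2 v, v != 0 & Lam `&` Del = range (fun a : R => a *: v).

Definition transversal_crossing (Del : set W) (Lam : R -> set W) (t : R) :
    Prop :=
  train_smooth_point Del (Lam t) /\
  forall v, (Lam t `&` Del) v -> v != 0 -> lag_dot Lam t v != 0.

Definition crossing_sign (Del : set W) (Lam : R -> set W) (t : R) : int :=
  if `[< exists2 v, (Lam t `&` Del) v & 0 < lag_dot Lam t v >] then 1 else -1.

Definition crossings (t0 t1 : R) (Del : set W) (Lam : R -> set W) : set R :=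
  [set t | t0 <= t <= t1 /\ train Del (Lam t)].

Definition intersection_number (t0 t1 : R) (Lam : R -> set W) (Del : set W)
    (k : int) : Prop :=
  [/\ ~ train Del (Lam t0), ~ train Del (Lam t1) &
      exists Gam : R -> set W,
        [/\ lag_smooth_curve `[t0, t1] Gam,
            lag_homotopic t0 t1 Lam Gam,
            forall t, crossings t0 t1 Del Gam t ->
              transversal_crossing Del Gam t,
            finite_set (crossings t0 t1 Del Gam) &
            k = \sum_(t \in crossings t0 t1 Del Gam) crossing_sign Del Gam t]].

End LagrangianGrassmannian.

Section Morse.
Variables (R : realType) (n m : nat) (U : manifold R n) (M : manifold R m).
Variables (phi : U -> R) (Phi : U -> M).

(* The manifold L of pairs (u, lambda) with d_u phi = lambda D_u Phi. *)
Definition lagrange_points : set (U * cotangent M) :=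
  [set x | ct_base x.2 = Phi x.1 /\
    forall c d, charts_at x.1 c -> charts_at (Phi x.1) d ->
      grad (phi \o chart_inv c) (c x.1) = dmap Phi c d x.1 *m ct_comp x.2 d].

(* Q = phi'' - p Phi'' in the charts c and d. *)
Definition Qmx (c : chart R n U) (d : chart R m M) (x : U * cotangent M) :
    'M[R]_n :=
  hess (phi \o chart_inv c) (c x.1) -
  \sum_k ct_comp x.2 d k 0 *:
    hess (fun y => (d \o Phi \o chart_inv c) y 0 k) (c x.1).

Definition morse_problem : Prop :=
  forall x, lagrange_points x ->
  forall c d, charts_at x.1 c -> charts_at (Phi x.1) d ->
  forall w : 'cV[R]_n, exists (du : 'rV[R]_n) (dp : 'cV[R]_m),
    Qmx c d x *m du^T - dmap Phi c d x.1 *m dp = w.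

(* The tangent space to the immersed Lagrangian submanifold at x, in the
   coordinates (p, q) of T^*M given by d.  It does not depend on the chart c
   in which du is written. *)
Definition lag_tangent (d : chart R m M) (x : U * cotangent M) :
    set 'rV[R]_(m + m) :=
  [set z | exists (c : chart R n U) (du : 'rV[R]_n),
    [/\ charts_at x.1 c,
        du *m dmap Phi c d x.1 = rsubmx z &
        Qmx c d x *m du^T = dmap Phi c d x.1 *m (lsubmx z)^T]].

Definition transversal_to_vertical (x : U * cotangent M) : Prop :=
  forall d, charts_at (ct_base x.2) d ->
  forall w, exists z1 z2,
    [/\ lag_tangent d x z1, vertical z2 & w = z1 + z2].

(* Signature of the Hessian at u of the restriction of phi to the fibre of Phi,
   computed in the charts c and d. *)
Definition sgn_hess (c : chart R n U) (d : chart R m M)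
    (x : U * cotangent M) : int :=
  signature [set v : 'rV[R]_n | v *m dmap Phi c d x.1 = 0]
            (fun v => (v *m Qmx c d x *m v^T) 0 0).

(* A symplectic trivialization of T(T^*M) along lam taking the vertical
   subspaces to the fixed subspace Pi: A d t is the trivialization at time t
   written in the coordinates (p, q) given by d. *)
Definition sympl_trivialization (t0 t1 : R) (lam : R -> cotangent M)
    (Pi : set 'rV[R]_(m + m)) (A : chart R m M -> R -> 'M[R]_(m + m)) : Prop :=
  (forall d, atlas d ->
    {within `[t0, t1] `&` [set t | chart_dom d (ct_base (lam t))],
      continuous (A d)}) /\
  forall t d, t0 <= t <= t1 -> charts_at (ct_base (lam t)) d ->
    [/\ forall v w, sympl (v *m A d t) (w *m A d t) = sympl v w,
        (fun z => z *m A d t) @` @vertical R m = Pi &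
        forall d', charts_at (ct_base (lam t)) d' ->
          A d t = 'J (ct_change d d') (ct_coord d (lam t)) *m A d' t].

Definition trivialized_tangent (A : chart R m M -> R -> 'M[R]_(m + m))
    (x : R -> U * cotangent M) (t : R) : set 'rV[R]_(m + m) :=
  [set w | exists (d : chart R m M) z,
    [/\ charts_at (ct_base (x t).2) d, lag_tangent d (x t) z & w = z *m A d t]].

(* k is a value of mu(gamma), for some symplectic trivialization and some
   generic curve; that there is one and only one such k is not built in. *)
Definition maslov_cocycle (t0 t1 : R) (x : R -> U * cotangent M) (k : int) :
    Prop :=
  exists (Pi : set 'rV[R]_(m + m)) (A : chart R m M -> R -> 'M[R]_(m + m)),
    [/\ lagrangian Pi,
        sympl_trivialization t0 t1 (fun t => (x t).2) Pi A &
        intersection_number t0 t1 (trivialized_tangent A x) Pi k].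

End Morse.

(* Main.v *)
(* Lagrangians transversal to a fixed one are graphs of symmetric matrices T, and
   such a graph meets the vertical subspace exactly along the kernel of T.  Call an
   integer function h along a family of Lagrangians an index function when h + sgn T
   is locally constant in each chart; this does not depend on the chart, since
   passing to another one changes sgn T by a locally constant amount.  Index
   functions exist on rectangles, by subdivision, hence homotopic curves with fixed
   end points have the same total variation of h.  At a transversal positive
   (negative) crossing sgn T increases (decreases) by 2, so that the total variation
   of h along a generic curve is -2 times the intersection number.

   The signature of the Hessian is an index function along the trivialized tangent
   spaces.  As D = dPhi/du has full rank, the signature of Q on ker D is that of the
   bordered matrix [[Q, D], [D^T, 0]].  In a chart S the tangent space has coordinate
   T = D^T G^-1 D, with G = Q - D S D^T invertible, and the Schur complement formula
   gives sgn Hess = sgn G - sgn T, where sgn G is locally constant.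

   Trivializations are glued from local ones.  A generic curve is obtained by
   subdividing, moving the division points off the train, and joining consecutive
   points inside a chart through positive definite matrices; flat ends, made with
   exp(-1/x), let the smooth pieces be glued. *)
Require Import Defs.
From HB Require Import structures.
From mathcomp Require Import all_boot all_order all_algebra.
From mathcomp Require Import all_classical all_reals all_analysis.
From mathcomp Require Import zify ring lra.
Set Implicit Arguments.
Unset Strict Implicit.
Unset Printing Implicit Defensive.
Import Order.TTheory GRing.Theory Num.Theory.
Import numFieldNormedType.Exports.
Local Open Scope classical_set_scope.
Local Open Scope ring_scope.

(** * Signature of symmetric matrices *)

(** Neither sgn T nor the signature of the Hessian is continuous along the curve: both jump where
    the Lagrangian meets the vertical subspace, by opposite amounts, and an index function records
    precisely that the jumps cancel. No chart of the Grassmannian covers the whole curve, so all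
    notions are local, and one additive form of compactness of the interval ([cousin]) globalizes
    index functions, trivializations and generic curves alike. An index function need not exist
    along a general family of Lagrangians, since loops can have nonzero Maslov index; it exists on a
    rectangle because adjacent pieces meet along a segment, which is connected, so that two index
    functions differ there by a constant. The cocycle is a relation quantified over trivializations
    and generic curves: the formula is proved for every value, which yields uniqueness, and a value
    is constructed separately. Convergence of matrices is entrywise along arbitrary filters, so that
    products, determinants and inverses reduce to limits of real functions. *)

Section Inertia.
Variable R : realFieldType.

Lemma mxDE m n (A B : 'M[R]_(m, n)) i j : (A + B) i j = A i j + B i j.
Proof. by rewrite mxE. Qed.

Lemma mxTE m n (A : 'M[R]_(m, n)) i j : A^T j i = A i j.
Proof. by rewrite mxE. Qed.

Lemma sym_congr m n (A : 'M[R]_n) (P : 'M[R]_(m, n)) :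
  A^T = A -> (P *m A *m P^T)^T = P *m A *m P^T.
Proof. by move=> As; rewrite !trmx_mul trmxK As mulmxA. Qed.

Definition qform n (A : 'M[R]_n) (x : 'rV[R]_n) : R := (x *m A *m x^T) 0 0.

(* P has full row and column rank, hence k = n; rectangular P avoids casts. *)
Definition inertia n (A : 'M[R]_n) (s : int) : Prop :=
  exists k (P : 'M[R]_(k, n)) (e : 'rV[R]_k),
    [/\ row_free P, row_full P, P *m A *m P^T = diag_mx e
      & s = \sum_i sgz (e 0 i)].

Lemma qform_mul n k (A : 'M[R]_n) (P : 'M[R]_(k, n)) (x : 'rV[R]_k) :
  qform A (x *m P) = qform (P *m A *m P^T) x.
Proof. by rewrite /qform trmx_mul !mulmxA. Qed.

Lemma qform_diag k (e : 'rV[R]_k) (x : 'rV[R]_k) :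
  qform (diag_mx e) x = \sum_i e 0 i * x 0 i ^+ 2.
Proof.
rewrite /qform !mxE; apply: eq_bigr => i _.
by rewrite mul_mx_diag !mxE; ring.
Qed.

Local Notation npos e := #|[pred i | (0 < e (0 : 'I_1) i)%R]|.
Local Notation nneg e := #|[pred i | (e (0 : 'I_1) i < 0)%R]|.

Lemma qformB n (A B : 'M[R]_n) x : qform (A - B) x = qform A x - qform B x.
Proof. by rewrite /qform mulmxBr mulmxBl mxE [X in _ + X]mxE. Qed.

(** The inequality 2|ab| <= a^2 + b^2, summed over all pairs of coordinates. It controls the
    perturbation in [sg_cvg]. *)
Lemma qform_bound n (A : 'M[R]_n) d x : (forall i j, `|A i j| <= d) ->
  `|qform A x| <= d * n%:R * \sum_i x 0 i ^+ 2.
Proof.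
move=> Ad; rewrite /qform mxE.
have h (j i : 'I_n) : `|x 0 i * A i j * x 0 j| <= d * ((x 0 i ^+ 2 + x 0 j ^+ 2) / 2).
  rewrite [_ * A i j]mulrC -mulrA normrM ler_pM //.
  move: (x 0 i) (x 0 j) => a b; rewrite ler_norml.
  have := sqr_ge0 (a - b); have := sqr_ge0 (a + b).
  by rewrite sqrrB sqrrD => ? ?; apply/andP; split; nra.
apply: (@le_trans _ _ (\sum_j \sum_i d * ((x 0 i ^+ 2 + x 0 j ^+ 2) / 2))).
  apply: le_trans (ler_norm_sum _ _ _) _; apply: ler_sum => j _.
  rewrite !mxE mulr_suml; apply: le_trans (ler_norm_sum _ _ _) _.
  by apply: ler_sum => i _.
rewrite le_eqVlt; apply/orP; left; apply/eqP.
under eq_bigr do rewrite -mulr_sumr -mulr_suml big_split /= sumr_const card_ord.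
rewrite -mulr_sumr -mulr_suml big_split /= sumr_const card_ord sumrMnl.
by rewrite -[(\sum_(i < n) _) *+ n]mulr_natr; field.
Qed.

Lemma sum_sgz k (e : 'rV[R]_k) :
  \sum_i sgz (e 0 i) = (npos e)%:Z - (nneg e)%:Z.
Proof.
rewrite -!natz -!sum1_card !natr_sum [X in X - _]big_mkcond [X in _ - X]big_mkcond -sumrB.
apply: eq_bigr => i _; rewrite !inE /sgz; case: ltgtP => //=.
Qed.

(** If V had more rows than e has positive entries, some nonzero combination of its rows would have
    zero coordinates at all positive entries, and the form would be nonpositive on it. *)
Lemma posdef_count n (A : 'M[R]_n) k (P : 'M[R]_(k, n)) e r (V : 'M[R]_(r, n)) :
  row_full P -> P *m A *m P^T = diag_mx e ->
  (forall x : 'rV[R]_r, x != 0 -> 0 < qform A (x *m V)) ->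
  (r <= npos e)%N.
Proof.
move=> Pfull PA Vpos; rewrite leqNgt; apply/negP => lt_pr.
have /submxP[W defV] : (V <= P)%MS by apply: submx_full.
pose W' : 'M[R]_(r, npos e) := colsub enum_val W.
have : ~~ row_free W'.
  by rewrite -row_leq_rank -ltnNge (leq_ltn_trans (rank_leq_col _)).
rewrite -kermx_eq0 => /rowV0Pn[x /sub_kermxP xW' x_n0].
have := Vpos x x_n0; rewrite defV mulmxA qform_mul PA qform_diag ltNge => /negP[].
apply: sumr_le0 => i _; case: (leP (e 0 i) 0) => [ei|ei].
  by rewrite mulr_le0_ge0 ?sqr_ge0.
have ip : i \in [pred i | (0 < e (0 : 'I_1) i)%R] by rewrite inE.
have := congr1 (fun M : 'rV_ _ => M 0 (enum_rank_in ip i)) xW'.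
rewrite /W' mulmx_colsub !mxE enum_rankK_in // => ->.
by rewrite expr0n mulr0.
Qed.

Lemma count_pos_neg k (e : 'rV[R]_k) :
  (npos e + nneg e <= k)%N.
Proof.
rewrite -cardUI [X in (_ + X)%N]eq_card0 ?addn0.
  by rewrite (leq_trans (max_card _)) ?card_ord.
by move=> i; rewrite !inE; apply/negP => /andP[/lt_trans h/h]; rewrite ltxx.
Qed.

Lemma count_pos_neg_nz k (e : 'rV[R]_k) : (forall i, e 0 i != 0) ->
  (npos e + nneg e)%N = k.
Proof.
move=> e0; rewrite -cardUI [X in (_ + X)%N]eq_card0 ?addn0.
  rewrite -[RHS](card_ord k); apply: eq_card => i; rewrite !inE.
  by have := e0 i; rewrite neq_lt orbC.
by move=> i; rewrite !inE; apply/negP => /andP[/lt_trans h/h]; rewrite ltxx.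
Qed.

Lemma diag_mxN k (e : 'rV[R]_k) : diag_mx (- e) = - diag_mx e.
Proof. by apply/matrixP => i j; rewrite !mxE mulNrn. Qed.

Lemma qformN n (A : 'M[R]_n) x : qform (- A) x = - qform A x.
Proof. by rewrite /qform mulmxN mulNmx !mxE. Qed.

Lemma negdef_count n (A : 'M[R]_n) k (P : 'M[R]_(k, n)) e r (V : 'M[R]_(r, n)) :
  row_full P -> P *m A *m P^T = diag_mx e ->
  (forall x : 'rV[R]_r, x != 0 -> qform A (x *m V) < 0) ->
  (r <= nneg e)%N.
Proof.
move=> Pf PA Vn.
have /(posdef_count Pf) : P *m (- A) *m P^T = diag_mx (- e).
  by rewrite mulmxN mulNmx PA diag_mxN.
move=> /(_ r V); rewrite (eq_card (B := [pred i | (e (0 : 'I_1) i < 0)%R])); first apply.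
  by move=> x /Vn; rewrite qformN oppr_gt0.
by move=> i; rewrite !inE mxE oppr_gt0.
Qed.

Lemma rV_neq0P n (x : 'rV[R]_n) : reflect (exists i, x 0 i != 0) (x != 0).
Proof.
apply: (iffP idP) => [x0|[i]]; last by apply: contraNneq => ->; rewrite mxE.
apply/existsP; apply: contraNT x0; rewrite negb_exists => /forallP h.
by apply/eqP/rowP => i; rewrite mxE; apply/eqP; have := h i; rewrite negbK.
Qed.
Lemma diag_posdef_sub k (e : 'rV[R]_k) r (f : 'I_r -> 'I_k) :
  injective f -> (forall l, 0 < e 0 (f l)) ->
  forall x, x != 0 -> 0 < qform (diag_mx e) (x *m rowsub f 1%:M).
Proof.
move=> f_inj ef x /rV_neq0P[j xj]; set V := rowsub _ _.
have xVE i : (x *m V) 0 (f i) = x 0 i.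
  rewrite mxE (bigD1 i) //= !mxE eqxx mulr1 big1 ?addr0 // => l li.
  by rewrite !mxE (inj_eq f_inj) (negbTE li) mulr0.
have xV0 i : ~~ (0 < e 0 i) -> (x *m V) 0 i = 0.
  move=> ei; rewrite mxE big1 // => l _; rewrite !mxE.
  case: eqP => [il|]; rewrite ?mulr0 //.
  by have := ef l; rewrite il (negbTE ei).
rewrite qform_diag (bigD1 (f j)) //= ltr_pwDl //.
  by rewrite xVE mulr_gt0 // lt_def sqr_ge0 sqrf_eq0 xj.
apply: sumr_ge0 => i _; case: (boolP (0 < e 0 i)) => [/ltW ei|/xV0 ->].
  by rewrite mulr_ge0 ?sqr_ge0.
by rewrite expr0n mulr0.
Qed.

(** Quantitative positivity on a coordinate subspace: c is the margin that a perturbation has to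
    stay below in [sg_cvg]. *)
Lemma diag_posdef_le k (e : 'rV[R]_k) r (f : 'I_r -> 'I_k) c (x : 'rV[R]_r) :
  (forall l, c <= e 0 (f l)) ->
  c * \sum_i (x *m rowsub f 1%:M) 0 i ^+ 2 <= qform (diag_mx e) (x *m rowsub f 1%:M).
Proof.
move=> ef; set z := x *m _; rewrite qform_diag mulr_sumr; apply: ler_sum => i _.
have [ci|ci] := leP c (e 0 i); first by rewrite ler_wpM2r ?sqr_ge0.
have -> : z 0 i = 0; last by rewrite expr0n !mulr0.
rewrite mxE big1 // => l _; rewrite !mxE; case: eqP => [il|]; rewrite ?mulr0 //.
by have := ef l; rewrite il leNgt ci.
Qed.

Lemma rowsub_free k r (f : 'I_r -> 'I_k) : injective f ->
  row_free (rowsub f (1%:M : 'M[R]_k)).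
Proof.
move=> f_inj; apply/row_freeP; exists (rowsub f 1%:M)^T.
rewrite trmx_mxsub trmx1 mulmx_colsub mulmx1.
by apply/matrixP => i j; rewrite !mxE (inj_eq f_inj).
Qed.

Lemma diag_posdef k (e : 'rV[R]_k) :
  let V := rowsub (enum_val : 'I_(npos e) -> _) 1%:M in
  forall x, x != 0 -> 0 < qform (diag_mx e) (x *m V).
Proof.
apply: diag_posdef_sub; first exact: enum_val_inj.
by move=> l; have := enum_valP l; rewrite inE.
Qed.

Lemma diag_negdef k (e : 'rV[R]_k) :
  let V := rowsub (enum_val : 'I_(nneg e) -> _) 1%:M in
  forall x, x != 0 -> qform (diag_mx e) (x *m V) < 0.
Proof.
move=> V x x0; rewrite -[diag_mx e]opprK qformN oppr_lt0 -diag_mxN.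
apply: diag_posdef_sub => //; first exact: enum_val_inj.
by move=> l; have := enum_valP l; rewrite inE mxE oppr_gt0.
Qed.

(** The numbers of positive and negative entries dominate r and r' while their sum is at most n = r
    + r'; hence both bounds are equalities. *)
Lemma definite_inertia n (A : 'M[R]_n) s r (V : 'M[R]_(r, n)) r' (W : 'M[R]_(r', n)) :
  inertia A s ->
  (forall x : 'rV[R]_r, x != 0 -> 0 < qform A (x *m V)) ->
  (forall x : 'rV[R]_r', x != 0 -> qform A (x *m W) < 0) ->
  (r + r' = n)%N -> s = r%:Z - r'%:Z.
Proof.
move=> [k [P [e [Pfree Pfull PA ->]]]] Vpos Wneg rn.
have kn : k = n by rewrite -(eqP Pfree) (eqP Pfull).
have r1 := posdef_count Pfull PA Vpos; have r2 := negdef_count Pfull PA Wneg.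
have r3 := count_pos_neg e; rewrite sum_sgz.
rewrite -{}rn in kn; move: r1 r2 r3.
move: #|_| #|_| => a b; clear -kn; move: kn => ->; lia.
Qed.

(** Sylvester's law of inertia: the rows of P at the positive (negative) entries span a definite
    subspace, whose dimension is bounded by the corresponding count of any other diagonalization. *)
Lemma inertia_unique n (A : 'M[R]_n) s s' : inertia A s -> inertia A s' -> s = s'.
Proof.
move=> [k [P [e [Pfree Pfull PA ->]]]] [k' [P' [e' [Pfree' Pfull' PA' ->]]]].
have h1 : (npos e <= npos e')%N.
  apply: (posdef_count Pfull' PA' (V := rowsub (enum_val : 'I_(npos e) -> _) 1%:M *m P)).
  by move=> x x0; rewrite mulmxA qform_mul PA; apply: diag_posdef.
have h2 : (npos e' <= npos e)%N.
  apply: (posdef_count Pfull PA (V := rowsub (enum_val : 'I_(npos e') -> _) 1%:M *m P')).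
  by move=> x x0; rewrite mulmxA qform_mul PA'; apply: diag_posdef.
have h3 : (nneg e <= nneg e')%N.
  apply: (negdef_count Pfull' PA' (V := rowsub (enum_val : 'I_(nneg e) -> _) 1%:M *m P)).
  by move=> x x0; rewrite mulmxA qform_mul PA; apply: diag_negdef.
have h4 : (nneg e' <= nneg e)%N.
  apply: (negdef_count Pfull PA (V := rowsub (enum_val : 'I_(nneg e') -> _) 1%:M *m P')).
  by move=> x x0; rewrite mulmxA qform_mul PA'; apply: diag_negdef.
by rewrite !sum_sgz; congr (_%:Z - _%:Z); apply/eqP; rewrite eqn_leq ?h1 ?h2 ?h3 ?h4.
Qed.

(** Polarization. *)
Lemma qform0_eq0 n (A : 'M[R]_n) : A^T = A -> (forall x, qform A x = 0) -> A = 0.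
Proof.
move=> As h; apply/matrixP => i j; rewrite mxE.
have E (x y : 'rV[R]_n) : (x *m A *m y^T) 0 0 = 0.
  have := h (x + y); rewrite /qform [(x + y)^T]linearD /= !mulmxDl !mulmxDr.
  rewrite !mxDE.
  have := h x; have := h y; rewrite /qform => -> ->.
  have -> : (y *m A *m x^T) 0 0 = (x *m A *m y^T) 0 0.
    by rewrite -[LHS]mxTE !trmx_mul trmxK As mulmxA.
  by move=> H; lra.
have := E (delta_mx 0 i) (delta_mx 0 j).
by rewrite -rowE trmx_delta -colE !mxE.
Qed.

(** Lagrange's reduction: a vector v on which the form does not vanish is split off, and the
    induction hypothesis is applied to a basis W of its orthogonal complement, the kernel of A
    v^T. *)
Lemma inertia_ex n (A : 'M[R]_n) : A^T = A -> exists s, inertia A s.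
Proof.
elim/ltn_ind: n A => n IH A As.
have [A0|/eqP A0] := eqVneq A 0.
  exists 0, n, 1%:M, 0; split; rewrite ?row_free_unit ?row_full_unit ?unitmx1 //.
    by rewrite A0 mulmx0 mul0mx linear0.
  by rewrite big1 // => i _; rewrite mxE sgz0.
have [v vA] : exists v, qform A v != 0.
  apply: contra_notP A0 => h; apply: qform0_eq0 => // x.
  by apply: contra_notP h => /eqP ?; exists x.
have [w wE] : exists w, w = A *m v^T by eexists.
have w0 : w != 0.
  by apply: contraNneq vA => w0; rewrite /qform -mulmxA -wE w0 mulmx0 mxE.
have rw : \rank w = 1%N.
  apply/eqP; rewrite eqn_leq rank_leq_col lt0n mxrank_eq0 //.
have [W [Wfree Ww]] : exists W : 'M[R]_(\rank (kermx w), n), row_free W /\ W *m w = 0.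
  exists (row_base (kermx w)); split; first exact: row_base_free.
  by apply/sub_kermxP; rewrite eq_row_base.
have kn : (\rank (kermx w) + 1 = n)%N.
  by rewrite mxrank_ker rw subnK // -rw rank_leq_row.
have ltk : (\rank (kermx w) < n)%N by lia.
have symW : (W *m A *m W^T)^T = W *m A *m W^T by apply: sym_congr.
have [s] := IH _ ltk _ symW.
move=> [k [P [e [Pfree Pfull PA Hs]]]].
pose P' := col_mx v (P *m W).
have free' : row_free P'.
  rewrite -kermx_eq0 -submx0; apply/rV_subP => x /sub_kermxP.
  rewrite -[x]hsubmxK mul_row_col => E.
  have : (lsubmx x *m v + rsubmx x *m (P *m W)) *m w = 0 by rewrite E mul0mx.
  rewrite mulmxDl -!mulmxA Ww !mulmx0 addr0 wE [v *m _]mulmxA [v *m A *m _]mx11_scalar mul_mx_scalar.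
  move/eqP; rewrite scaler_eq0 (negbTE vA) /= => /eqP x1.
  move: E; rewrite x1 mul0mx add0r mulmxA => E.
  have x2 : rsubmx x *m P = 0.
    by apply: (row_free_inj Wfree); rewrite mul0mx.
  have x3 : rsubmx x = 0 by apply: (row_free_inj Pfree); rewrite mul0mx.
  by rewrite x3 row_mx0 sub0mx.
have kk : k = \rank (kermx w) by rewrite -(eqP Pfree) (eqP Pfull).
exists (sgz (qform A v) + s), (1 + k)%N, P', (row_mx (const_mx (qform A v)) e); split=> //.
- by rewrite /row_full (eqP free') kk addnC kn.
- have vW : v *m A *m W^T = 0.
    by apply: trmx_inj; rewrite !trmx_mul trmxK As -wE Ww linear0.
  have Wv : W *m A *m v^T = 0 by rewrite -mulmxA -wE.
  rewrite tr_col_mx mul_col_mx mul_col_row diag_mx_row; congr block_mx.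
  + by apply/matrixP => i j; rewrite !ord1 /qform [RHS]mxE eqxx [const_mx _ _ _]mxE.
  + by rewrite trmx_mul mulmxA vW mul0mx.
  + by rewrite -!mulmxA -wE Ww mulmx0.
  + by rewrite -PA trmx_mul !mulmxA.
rewrite big_split_ord /= big_ord1 row_mxEl mxE Hs; congr (_ + _).
by apply: eq_bigr => i _; rewrite row_mxEr.
Qed.

Definition sg n (A : 'M[R]_n) : int := xget 0 (inertia A).

Lemma sgE n (A : 'M[R]_n) s : inertia A s -> sg A = s.
Proof.
move=> As; rewrite /sg; case: xgetP => [s' _ As'|/(_ s)//].
exact: inertia_unique As' As.
Qed.

Lemma sgP n (A : 'M[R]_n) : A^T = A -> inertia A (sg A).
Proof. by move=> /inertia_ex[s As]; rewrite (sgE As). Qed.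

Lemma sg_congr n k (A : 'M[R]_n) (P : 'M[R]_(k, n)) :
  A^T = A -> row_free P -> row_full P -> sg (P *m A *m P^T) = sg A.
Proof.
move=> As Pfree Pfull.
have [l [L [e [Lfree Lfull LA Hs]]]] := sgP (sym_congr P As).
apply: esym; apply: sgE; exists l, (L *m P), e; split=> //.
- by rewrite /row_free mxrankMfree.
- by rewrite /row_full mxrankMfree // (eqP Lfull) -(eqP Pfree) (eqP Pfull).
by rewrite trmx_mul -LA !mulmxA.
Qed.

Lemma sg_unit_congr n (A P : 'M[R]_n) :
  A^T = A -> P \in unitmx -> sg (P *m A *m P^T) = sg A.
Proof. by move=> As Pu; rewrite sg_congr ?row_free_unit ?row_full_unit. Qed.

Lemma sg_diag n (e : 'rV[R]_n) : sg (diag_mx e) = \sum_i sgz (e 0 i).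
Proof.
apply: sgE; exists n, 1%:M, e.
by rewrite row_free_unit row_full_unit unitmx1 trmx1 mulmx1 mul1mx.
Qed.

Lemma sgN n (A : 'M[R]_n) : A^T = A -> sg (- A) = - sg A.
Proof.
move=> As; have [l [L [e [Lfree Lfull LA ->]]]] := sgP As.
apply: sgE; exists l, L, (- e); split=> //.
  by rewrite mulmxN mulNmx LA diag_mxN.
by rewrite -sumrN; apply: eq_bigr => i _; rewrite mxE sgzN.
Qed.

Lemma sg_block_diag n k (A : 'M[R]_n) (B : 'M[R]_k) :
  A^T = A -> B^T = B -> sg (block_mx A 0 0 B) = sg A + sg B.
Proof.
move=> As Bs.
have [l [L [e [Lfree Lfull LA ->]]]] := sgP As.
have [l' [L' [e' [Lfree' Lfull' LB ->]]]] := sgP Bs.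
have free : row_free (block_mx L 0 0 L').
  rewrite -kermx_eq0 -submx0; apply/rV_subP => x /sub_kermxP.
  rewrite -[x]hsubmxK mul_row_block !mulmx0 addr0 add0r -row_mx0 => /eq_row_mx[].
  rewrite -[X in _ = X](mul0mx _ L) => /(row_free_inj Lfree) ->.
  by rewrite -[X in _ = X](mul0mx _ L') => /(row_free_inj Lfree') ->; rewrite row_mx0 sub0mx.
apply: sgE; exists (l + l')%N, (block_mx L 0 0 L'), (row_mx e e'); split=> //.
- rewrite /row_full (eqP free) -(eqP Lfree) (eqP Lfull) -(eqP Lfree') (eqP Lfull').
  exact: eqxx.
- rewrite tr_block_mx !mulmx_block !trmx0 !(mulmx0, mul0mx, addr0, add0r) LA LB.
  by rewrite diag_mx_row.
by rewrite big_split_ord /=; congr (_ + _); apply: eq_bigr => i _;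
  rewrite ?row_mxEl ?row_mxEr.
Qed.

Lemma sym_block n m (A : 'M[R]_n) (D : 'M[R]_(n, m)) (C : 'M[R]_m) :
  A^T = A -> C^T = C -> (block_mx A D D^T C)^T = block_mx A D D^T C.
Proof. by move=> As Cs; rewrite tr_block_mx trmxK As Cs. Qed.

Lemma unit_ublock n m (B : 'M[R]_(n, m)) : block_mx 1%:M B 0 1%:M \in unitmx.
Proof. by rewrite unitmxE det_ublock !det1 mulr1 unitr1. Qed.

Lemma unit_lblock n m (B : 'M[R]_(m, n)) : block_mx 1%:M 0 B 1%:M \in unitmx.
Proof. by rewrite unitmxE det_lblock !det1 mulr1 unitr1. Qed.

(** Block elimination below A, carried out as a congruence, leaves the Schur complement in the other
    diagonal block. *)
Lemma sg_schur n m (A : 'M[R]_n) (D : 'M[R]_(n, m)) (C : 'M[R]_m) :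
  A^T = A -> C^T = C -> A \in unitmx ->
  sg (block_mx A D D^T C) = sg A + sg (C - D^T *m invmx A *m D).
Proof.
move=> As Cs Au.
have iAs : (invmx A)^T = invmx A by rewrite trmx_inv As.
rewrite -(sg_unit_congr (sym_block D As Cs) (unit_lblock (- (D^T *m invmx A)))).
rewrite tr_block_mx !mulmx_block !trmx0 !trmx1.
rewrite !(mulmx0, mul0mx, addr0, add0r, mulmx1, mul1mx, mulNmx).
rewrite mulmxKV // addNr mul0mx add0r.
rewrite linearN /= trmx_mul iAs trmxK mulmxN mulmxA mulmxV // mul1mx addNr.
rewrite [- _ + C]addrC sg_block_diag //.
by rewrite linearB /= Cs -{2 4}[D]trmxK sym_congr.
Qed.

(** A congruence removes A; what remains is congruent to its own opposite, by a change of sign on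
    half of the coordinates, so that its signature is its own negative. *)
Lemma sg_hyperbolic m (A B : 'M[R]_m) :
  A^T = A -> B \in unitmx -> sg (block_mx A B B^T 0) = 0.
Proof.
move=> As Bu.
have z : (0 : 'M[R]_m)^T = 0 by rewrite trmx0.
have E : sg (block_mx A B B^T 0) = sg (block_mx 0 B B^T 0).
  (* Solves A + X B^T + B X^T = 0: each of the last two terms contributes -A/2. *)
  pose X := - 2^-1 *: (A *m invmx B^T).
  rewrite -(sg_unit_congr (sym_block B As z) (unit_ublock X)).
  rewrite tr_block_mx !mulmx_block !trmx0 !trmx1.
  rewrite !(mulmx0, mul0mx, addr0, add0r, mulmx1, mul1mx); congr (sg (block_mx _ _ _ _)).
  rewrite /X -scalemxAl -mulmxA mulVmx ?unitmx_tr // mulmx1.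
  rewrite linearZ /= -scalemxAr trmx_mul trmx_inv trmxK As mulmxA mulmxV // mul1mx.
  by apply/matrixP => i j; rewrite !mxE; lra.
have H : sg (block_mx 0 B B^T 0) = - sg (block_mx 0 B B^T 0).
  have U : block_mx 1%:M 0 0 (- 1%:M) \in @unitmx R (m + m).
    by rewrite unitmxE det_ublock det1 mul1r -scaleN1r detZ det1 mulr1 unitrX ?unitrN ?unitr1.
  rewrite -[in LHS](sg_unit_congr (sym_block B z z) U) -sgN; last exact: sym_block.
  rewrite tr_block_mx !mulmx_block linearN /= !trmx0 !trmx1.
  by rewrite !(mulmx0, mul0mx, addr0, add0r, mulmx1, mul1mx, mulNmx, mulmxN) opp_block_mx !oppr0.
by rewrite E; lia.
Qed.

(* The left-hand side does not involve S, so that the right-hand side does not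
   depend on the choice of S. *)
Lemma sg_border n m (Q : 'M[R]_n) (D : 'M[R]_(n, m)) (S : 'M[R]_m) :
  Q^T = Q -> S^T = S -> Q - D *m S *m D^T \in unitmx ->
  sg (block_mx Q D D^T 0) =
  sg (Q - D *m S *m D^T) - sg (D^T *m invmx (Q - D *m S *m D^T) *m D).
Proof.
move=> Qs Ss Gu; set G := Q - _.
have Gs : G^T = G by rewrite /G linearB /= Qs sym_congr.
have z : (0 : 'M[R]_m)^T = 0 by rewrite trmx0.
have iGs : (invmx G)^T = invmx G by rewrite trmx_inv Gs.
(* Each of the two off-diagonal blocks removes one half of D S D^T from Q. *)
pose X := - 2^-1 *: (D *m S).
rewrite -(sg_unit_congr (sym_block D Qs z) (unit_ublock X)).
rewrite tr_block_mx !mulmx_block !trmx0 !trmx1.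
rewrite !(mulmx0, mul0mx, addr0, add0r, mulmx1, mul1mx).
have -> : Q + X *m D^T + D *m X^T = G.
  rewrite /X /G -scalemxAl linearZ /= -scalemxAr trmx_mul Ss mulmxA.
  by apply/matrixP => i j; rewrite !mxE; lra.
rewrite sg_schur // sub0r sgN //.
by rewrite -{2 4}[D]trmxK sym_congr.
Qed.

(** Let C be a left inverse of D. The rows of B and C form a basis; the component Y in the border
    coordinates makes the vectors of B orthogonal to all the others, and these others form a
    hyperbolic block. *)
Lemma sg_restrict n m k (Q : 'M[R]_n) (D : 'M[R]_(n, m)) (B : 'M[R]_(k, n)) :
  Q^T = Q -> row_full D -> row_free B -> B *m D = 0 -> (k + m = n)%N ->
  sg (block_mx Q D D^T 0) = sg (B *m Q *m B^T).
Proof.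
move=> Qs /row_fullP[C CD] Bfree BD kmn.
have z : (0 : 'M[R]_m)^T = 0 by rewrite trmx0.
pose Y := - (B *m Q *m C^T).
pose P := col_mx (row_mx B Y) (block_mx C 0 0 1%:M).
have Pfree : row_free P.
  rewrite -kermx_eq0 -submx0; apply/rV_subP => x /sub_kermxP.
  rewrite -[x]hsubmxK -[rsubmx x]hsubmxK mul_row_col mul_mx_row mul_row_block.
  rewrite add_row_mx !mulmx0 !addr0 add0r mulmx1 -row_mx0 => /eq_row_mx[E1 E2].
  have x2 : lsubmx (rsubmx x) = 0.
    have := congr1 (mulmx^~ D) E1; rewrite mulmxDl -!mulmxA BD CD mulmx0 add0r mulmx1.
    by rewrite mul0mx.
  move: E1; rewrite x2 mul0mx addr0 -[X in _ = X](mul0mx _ B) => /(row_free_inj Bfree) x1.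
  by move: E2; rewrite x1 mul0mx add0r => ->; rewrite !row_mx0 sub0mx.
have Pfull : row_full P by rewrite /row_full (eqP Pfree) addnA kmn.
rewrite -(sg_congr (sym_block D Qs z) Pfree Pfull).
rewrite tr_col_mx mul_col_mx mul_col_row tr_row_mx tr_block_mx !trmx0 trmx1.
rewrite mul_row_block !mulmx_block mul_row_col !mul_row_block mul_block_col.
have DB : D^T *m B^T = 0 by rewrite -trmx_mul BD trmx0.
have DC : D^T *m C^T = 1%:M by rewrite -trmx_mul CD trmx1.
rewrite !(mulmx0, mul0mx, addr0, add0r, mulmx1, mul1mx) BD mul0mx addr0.
rewrite !mulmxDl -!(mulmxA Y) DB DC CD !(mulmx0, mulmx1, mul1mx, addr0).
have -> : B *m Q *m C^T + Y = 0 by rewrite /Y addrN.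
have -> : C *m Q *m B^T + Y^T = 0.
  by rewrite /Y linearN /= !trmx_mul Qs !trmxK mulmxA addrN.
rewrite row_mx0 col_mx0 sg_block_diag ?sym_congr //; last first.
  by rewrite tr_block_mx sym_congr // trmx1 trmx0.
by rewrite -{2}[1%:M]trmx1 sg_hyperbolic ?addr0 ?unitmx1 // sym_congr.
Qed.

(** T and the new coordinate (1 - T E)^-1 T are both of the form D^T (Q - D S D^T)^-1 D for one pair
    (Q, D), with S = 0 and S = E respectively, so [sg_border] compares their signatures. The gain is
    that G is invertible even where T is singular. *)
Lemma sg_chart_change m (T E : 'M[R]_m) :
  T^T = T -> E^T = E -> 1%:M - T *m E \in unitmx ->
  let G := block_mx (- E) 1%:M 1%:M (- T) in
  G \in unitmx /\ sg (invmx (1%:M - T *m E) *m T) = sg T + sg G.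
Proof.
move=> Ts Es U G.
pose D : 'M[R]_(m + m, m) := col_mx 1%:M 0.
pose Q : 'M[R]_(m + m) := block_mx 0 1%:M 1%:M (- T).
have Qs : Q^T = Q by rewrite /Q tr_block_mx linearN /= Ts trmx0 trmx1.
have DSD S : D *m S *m D^T = block_mx S 0 0 0.
  by rewrite /D tr_col_mx trmx0 trmx1 mul_col_mx mul1mx mul0mx mul_col_row !(mulmx0, mul0mx) mulmx1.
have Q0 : Q - D *m 0 *m D^T = Q by rewrite mulmx0 mul0mx subr0.
have QG : Q - D *m E *m D^T = G.
  by rewrite DSD /Q /G opp_block_mx add_block_mx !oppr0 !addr0 add0r.
have QiQ : Q *m block_mx T 1%:M 1%:M 0 = 1%:M.
  rewrite /Q mulmx_block !(mul1mx, mulmx1, mul0mx, mulmx0) !add0r !addr0 addrN.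
  by rewrite -scalar_mx_block.
have [Qu iQ] := mulmx1_unit QiQ.
have iQE : invmx Q = block_mx T 1%:M 1%:M 0.
  by rewrite -[LHS]mulmx1 -QiQ mulmxA mulVmx // mul1mx.
pose V : 'M[R]_m := invmx (1%:M - T *m E).
have U' : 1%:M - E *m T \in unitmx.
  by rewrite -unitmx_tr linearB /= trmx1 trmx_mul Ts Es.
have VT : V *m T *m (1%:M - E *m T) = T.
  rewrite mulmxBr mulmx1 -!mulmxA -mulmxBr; apply: (can_inj (mulKmx U)).
  rewrite /V mulKVmx // mulmxBl mul1mx !mulmxA //.
pose V' : 'M[R]_m := invmx (1%:M - E *m T).
(* The explicit inverse shows that G is invertible and that the new coordinate [V *m T] is the upper
   left block of its inverse. *)
have GH : G *m block_mx (V *m T) (V) V' (V' *m E) = 1%:M.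
  have TV' : T *m V' = V *m T.
    by rewrite -[in LHS]VT mulmxK.
  have V'E : V' *m E = E *m V.
    apply: (can_inj (mulKmx U')); rewrite /V' mulKVmx // mulmxA mulmxBl mul1mx.
    by rewrite -(mulmxA E T E) -{2}[E]mulmx1 -mulmxBr /V mulmxK.
  rewrite /G mulmx_block !mul1mx !mulNmx [T *m (V' *m E)]mulmxA TV' addrN V'E [E *m (V *m T)]mulmxA.
  have -> : - (E *m V *m T) + V' = 1%:M.
    rewrite -V'E -mulmxA -[in X in _ + X](mulmx1 V') addrC -mulmxBr.
    by rewrite mulVmx.
  rewrite addNr.
  have -> : V - V *m T *m E = 1%:M.
    by rewrite -{1}[V]mulmx1 -mulmxA -mulmxBr mulVmx.
  by rewrite -scalar_mx_block.
have [Gu _] := mulmx1_unit GH.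
have iGE : invmx G = block_mx (V *m T) V V' (V' *m E).
  by rewrite -[LHS]mulmx1 -GH mulmxA mulVmx // mul1mx.
split=> //.
have z : (0 : 'M[R]_m)^T = 0 by rewrite trmx0.
have := sg_border Qs z (D := D); rewrite Q0 => /(_ Qu).
have := sg_border Qs Es (D := D); rewrite QG => /(_ Gu) ->.
rewrite iQE iGE.
have DHD (a b c d : 'M[R]_m) : D^T *m block_mx a b c d *m D = a.
  rewrite /D tr_col_mx trmx0 trmx1 mul_row_block mul_row_col.
  by rewrite !(mul1mx, mulmx1, mul0mx, mulmx0, addr0).
(* Exchanging the two blocks of coordinates turns Q into a hyperbolic matrix. *)
have -> : sg Q = 0.
  have Q' : sg (block_mx (- T) 1%:M 1%:M 0) = 0.
    by rewrite -{2}[1%:M]trmx1 sg_hyperbolic ?unitmx1 // linearN /= Ts.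
  pose W : 'M[R]_(m + m) := block_mx 0 1%:M 1%:M 0.
  have Wu : W \in unitmx.
    have : W *m W = 1%:M.
      by rewrite /W mulmx_block !(mul1mx, mulmx1, mul0mx, mulmx0) !add0r !addr0 -scalar_mx_block.
    by case/mulmx1_unit.
  rewrite -(sg_unit_congr Qs Wu) -[RHS]Q' /W /Q tr_block_mx !mulmx_block trmx0 trmx1.
  by rewrite !(mul1mx, mulmx1, mul0mx, mulmx0) !add0r !addr0.
rewrite !DHD -/V; move: (sg _) (sg T) (sg G) => a b c; lia.
Qed.

(* Vectors in the kernels of [A - c_i B] for distinct [c_i] have orthogonal
   images under D. *)
Lemma exists_unit_pencil n m (A B C : 'M[R]_n) (D : 'M[R]_(n, m)) (c : 'I_m.+1 -> R) :
  (A *m C^T)^T = A *m C^T -> B *m C^T = D *m D^T -> injective c ->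
  (forall v : 'rV[R]_n, v *m D = 0 -> v *m B = 0) ->
  (forall v : 'rV[R]_n, v *m A = 0 -> v *m D = 0 -> v = 0) ->
  exists i, A - c i *: B \in unitmx.
Proof.
move=> ACs BC c_inj DB AD; apply: contrapT => /forallNP h.
have /choice[v hv] i : exists v : 'rV[R]_n, v != 0 /\ v *m A = c i *: (v *m B).
  have /negP := h i; rewrite -row_free_unit -kermx_eq0 => /rowV0Pn[v /sub_kermxP vk v0].
  by exists v; split=> //; apply/eqP; rewrite -subr_eq0 scalemxAr -mulmxBr vk.
pose W : 'M[R]_(m.+1, m) := \matrix_i (v i *m D).
have WW : W *m W^T = diag_mx (\row_i (v i *m D *m (v i *m D)^T) 0 0).
  apply/matrixP => i j; rewrite [LHS]mxE [RHS]mxE [X in _ = X *+ _]mxE.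
  have -> : \sum_k W i k * W^T k j = (v i *m D *m (v j *m D)^T) 0 0.
    by rewrite mxE; apply: eq_bigr => k _; rewrite !mxE; congr (_ * _); rewrite !mxE.
  case: eqP => [->|/eqP ij]; first by rewrite mulr1n.
  rewrite mulr0n; set a := _ 0 0.
  have aE : a = (v i *m (D *m D^T) *m (v j)^T) 0 0 by rewrite /a trmx_mul !mulmxA.
  have E1 : (v i *m (A *m C^T) *m (v j)^T) 0 0 = c i * a.
    by rewrite mulmxA (hv i).2 -!scalemxAl mxE -[_ *m B *m _]mulmxA BC -aE.
  have E2 : (v i *m (A *m C^T) *m (v j)^T) 0 0 = c j * a.
    rewrite -mxTE trmx_mul trmxK trmx_mul ACs 2!mulmxA (hv j).2 -!scalemxAl mxE.
    rewrite -[_ *m B *m _]mulmxA BC aE -[in RHS]mxTE; congr (_ * _).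
    by rewrite trmx_mul trmxK [in RHS]trmx_mul [in RHS]trmx_mul trmxK [in RHS]mulmxA.
  have : (c i - c j) * a = 0 by rewrite mulrBl -E1 -E2 subrr.
  by move/eqP; rewrite mulf_eq0 subr_eq0 (inj_eq c_inj) (negbTE ij) /= => /eqP.
have d0 i : (v i *m D *m (v i *m D)^T) 0 0 != 0.
  rewrite mxE; apply: contraT; rewrite negbK psumr_eq0 => [/allP vB0|k _]; last first.
    by rewrite [X in _ * X]mxE -expr2 sqr_ge0.
  have vD : v i *m D = 0.
    apply/rowP => k; rewrite [RHS]mxE; apply/eqP.
    by have := vB0 k (mem_index_enum _); rewrite /= [X in _ * X]mxE mulf_eq0 orbb.
  have := (hv i).1; by rewrite (AD (v i)) ?eqxx // (hv i).2 (DB _ vD) scaler0.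
(* The rows of W are m + 1 nonzero, pairwise orthogonal vectors of an m-dimensional space. *)
have : W *m W^T \in unitmx.
  rewrite WW unitmxE det_diag unitfE; apply/prodf_neq0 => i _; rewrite mxE //.
rewrite -row_free_unit /row_free => /eqP rk.
have := mxrankM_maxl W W^T; rewrite rk => h1.
by have := leq_trans h1 (rank_leq_col W); rewrite ltnn.
Qed.
End Inertia.

(** * Entrywise convergence of matrices *)

Section EntrywiseConvergence.
Variable R : realType.

Definition mcvg T (F : set_system T) k l (f : T -> 'M[R]_(k, l)) (a : 'M[R]_(k, l)) :=
  forall i j, f t i j @[t --> F] --> (a i j : R^o).

Section Operations.
Variables (T : Type) (F : set_system T).
Context {FF : Filter F}.

Lemma mcvg_near_eq k l (f g : T -> 'M[R]_(k, l)) a :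
  (\forall t \near F, f t = g t) -> mcvg F f a -> mcvg F g a.
Proof.
move=> fg fa i j; apply: cvg_trans (fa i j); apply: near_eq_cvg.
by apply: filterS fg => t ->.
Qed.

Lemma mcvg_cst k l (a : 'M[R]_(k, l)) : mcvg F (fun=> a) a.
Proof. by move=> i j; apply: cvg_cst. Qed.

Lemma mcvgD k l (f g : T -> 'M[R]_(k, l)) a b :
  mcvg F f a -> mcvg F g b -> mcvg F (fun t => f t + g t) (a + b).
Proof.
move=> fa gb i j; rewrite mxE; under eq_fun do rewrite mxE.
exact: cvgD.
Qed.

Lemma mcvgN k l (f : T -> 'M[R]_(k, l)) a :
  mcvg F f a -> mcvg F (fun t => - f t) (- a).
Proof.
move=> fa i j; rewrite mxE; under eq_fun do rewrite mxE.
exact: cvgN.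
Qed.

Lemma mcvgB k l (f g : T -> 'M[R]_(k, l)) a b :
  mcvg F f a -> mcvg F g b -> mcvg F (fun t => f t - g t) (a - b).
Proof. by move=> fa gb; apply: mcvgD => //; apply: mcvgN. Qed.

Lemma mcvgZ k l (s : T -> R) (f : T -> 'M[R]_(k, l)) c a :
  s t @[t --> F] --> (c : R^o) -> mcvg F f a -> mcvg F (fun t => s t *: f t) (c *: a).
Proof.
move=> sc fa i j; rewrite mxE; under eq_fun do rewrite mxE.
exact: cvgM.
Qed.

Lemma cvg_sum I (r : seq I) (P : pred I) (f : I -> T -> R) (a : I -> R) :
  (forall i, P i -> f i t @[t --> F] --> (a i : R^o)) ->
  \sum_(i <- r | P i) f i t @[t --> F] --> (\sum_(i <- r | P i) a i : R^o).
Proof.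
move=> fa; apply: (@cvg_big R^o _ +%R 0 P _ _ _ r f a) => //.
exact: add_continuous.
Qed.

Lemma cvg_prod_big I (r : seq I) (P : pred I) (f : I -> T -> R) (a : I -> R) :
  (forall i, P i -> f i t @[t --> F] --> (a i : R^o)) ->
  \prod_(i <- r | P i) f i t @[t --> F] --> (\prod_(i <- r | P i) a i : R^o).
Proof.
move=> fa; apply: (@cvg_big R^o _ *%R 1 P _ _ _ r f a) => //.
exact: mul_continuous.
Qed.

Lemma mcvgM k l p (f : T -> 'M[R]_(k, l)) (g : T -> 'M[R]_(l, p)) a b :
  mcvg F f a -> mcvg F g b -> mcvg F (fun t => f t *m g t) (a *m b).
Proof.
move=> fa gb i j; rewrite mxE; under eq_fun do rewrite mxE.
by apply: cvg_sum => h _; apply: cvgM; [exact: fa|exact: gb].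
Qed.

Lemma mcvgT k l (f : T -> 'M[R]_(k, l)) a :
  mcvg F f a -> mcvg F (fun t => (f t)^T) a^T.
Proof. by move=> fa i j; rewrite mxE; under eq_fun do rewrite mxE; exact: fa. Qed.

Lemma mcvg_lsub k l l' (f : T -> 'M[R]_(k, l + l')) a :
  mcvg F f a -> mcvg F (fun t => lsubmx (f t)) (lsubmx a).
Proof. by move=> fa i j; rewrite mxE; under eq_fun do rewrite mxE; exact: fa. Qed.

Lemma mcvg_rsub k l l' (f : T -> 'M[R]_(k, l + l')) a :
  mcvg F f a -> mcvg F (fun t => rsubmx (f t)) (rsubmx a).
Proof. by move=> fa i j; rewrite mxE; under eq_fun do rewrite mxE; exact: fa. Qed.

Lemma mcvg_row k l l' (f : T -> 'M[R]_(k, l)) (g : T -> 'M[R]_(k, l')) a b :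
  mcvg F f a -> mcvg F g b -> mcvg F (fun t => row_mx (f t) (g t)) (row_mx a b).
Proof.
move=> fa gb i j; rewrite mxE; under eq_fun do rewrite mxE.
by case: (fintype.split j) => h; [exact: fa|exact: gb].
Qed.

Lemma mcvg_col k l l' (f : T -> 'M[R]_(l, k)) (g : T -> 'M[R]_(l', k)) a b :
  mcvg F f a -> mcvg F g b -> mcvg F (fun t => col_mx (f t) (g t)) (col_mx a b).
Proof.
move=> fa gb i j; rewrite mxE; under eq_fun do rewrite mxE.
by case: (fintype.split i) => h; [exact: fa|exact: gb].
Qed.

Lemma mcvg_block k l k' l' (f : T -> 'M[R]_(k, l)) (g : T -> 'M[R]_(k, l'))
   (f' : T -> 'M[R]_(k', l)) (g' : T -> 'M[R]_(k', l')) a b a' b' :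
  mcvg F f a -> mcvg F g b -> mcvg F f' a' -> mcvg F g' b' ->
  mcvg F (fun t => block_mx (f t) (g t) (f' t) (g' t)) (block_mx a b a' b').
Proof. by move=> *; apply: mcvg_col; apply: mcvg_row. Qed.

Lemma mcvg_det k (f : T -> 'M[R]_k) a :
  mcvg F f a -> \det (f t) @[t --> F] --> (\det a : R^o).
Proof.
move=> fa; rewrite /determinant; apply: cvg_sum => s _.
by apply: cvgM; [exact: cvg_cst|apply: cvg_prod_big => i _; exact: fa].
Qed.

Lemma mcvg_unit k (f : T -> 'M[R]_k) a :
  mcvg F f a -> a \in unitmx -> \forall t \near F, f t \in unitmx.
Proof.
move=> /mcvg_det fa; rewrite unitmxE unitfE => a0.
have := @cvgr_neq0 _ _ _ _ FF _ _ fa a0.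
by apply: filterS => t ft; rewrite unitmxE unitfE.
Qed.

Lemma mcvg_inv k (f : T -> 'M[R]_k) a :
  mcvg F f a -> a \in unitmx -> mcvg F (fun t => invmx (f t)) (invmx a).
Proof.
move=> fa au; have a0 : \det a != 0 by rewrite -unitfE -unitmxE.
apply: (@mcvg_near_eq _ _ (fun t => (\det (f t))^-1 *: \adj (f t))).
  by have := mcvg_unit fa au; apply: filterS => t ft; rewrite /invmx ft.
rewrite [invmx a]/invmx au; apply: mcvgZ; first by apply: cvgV => //; exact: mcvg_det.
move=> i j; rewrite mxE; under eq_fun do rewrite mxE.
rewrite /cofactor; apply: cvgM; first exact: cvg_cst.
by apply: mcvg_det => i' j'; rewrite !mxE; under eq_fun do rewrite !mxE; exact: fa.
Qed.

Lemma mcvg_entries k l (f : T -> 'M[R]_(k, l)) a :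
  f @ F --> a <-> mcvg F f a.
Proof.
split=> [fa i j|fa].
  exact: (cvg_comp _ _ fa (@coord_continuous R k l i j a)).
move=> A [P aP sPA]; rewrite nbhs_filterE /=.
have : \forall t \near F, forall ij : 'I_k * 'I_l, P ij.1 ij.2 (f t ij.1 ij.2).
  by apply: filter_forall => ij; apply: fa; apply: aP.
by apply: filterS => t Pt; apply: sPA => i j; apply: (Pt (i, j)).
Qed.

(** In coordinates diagonalizing a, the positive and negative coordinate subspaces are definite with
    margin [eta] and fill the space, as no entry is zero. A form closer than this margin is definite
    on the same two subspaces, and [definite_inertia] applies. *)
Lemma sg_cvg n (f : T -> 'M[R]_n) a :
  mcvg F f a -> a^T = a -> a \in unitmx -> (\forall t \near F, (f t)^T = f t) ->
  \forall t \near F, sg (f t) = sg a.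
Proof.
move=> fa as_ au fs; have [k [P [e [Pfree Pfull Pa sa]]]] := sgP as_.
have kn : k = n by rewrite -(eqP Pfree) (eqP Pfull).
have e0 i : e 0 i != 0.
  have /row_freeP[C PC] : row_free (P *m a *m P^T).
    subst k; rewrite row_free_unit unitmx_mul unitmx_tr unitmx_mul au.
    by rewrite -row_free_unit Pfree.
  apply: contraPneq PC => ei0; rewrite Pa => /matrixP/(_ i i).
  by rewrite mul_diag_mx !mxE ei0 mul0r eqxx => /esym/eqP; rewrite oner_eq0.
(* A positive lower bound of all |e_i|, with a sum in place of a minimum; the summand 1 keeps it
   positive when k = 0. *)
pose eta := (1 + \sum_i `|e 0 i|^-1)^-1.
have sum0 : 0 <= \sum_i `|e 0 i|^-1 by apply: sumr_ge0 => i _; rewrite invr_ge0.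
have eta0 : 0 < eta by rewrite invr_gt0 ltr_pwDl.
have eta_le i : eta <= `|e 0 i|.
  have h : `|e 0 i|^-1 <= 1 + \sum_i `|e 0 i|^-1.
    rewrite (bigD1 i) //= addrCA lerDl addr_ge0 //; apply: sumr_ge0 => j _.
    by rewrite invr_ge0.
  by rewrite -[leRHS]invrK lef_pV2 // posrE ?invr_gt0 ?normr_gt0 ?ltr_pwDl.
have fP : mcvg F (fun t => P *m f t *m P^T) (diag_mx e).
  by rewrite -Pa; apply: mcvgM; [apply: mcvgM|]=> //; apply: mcvg_cst.
(* Entries within d change the form by at most d k |x|^2; dividing by k + 1 makes this strictly less
   than eta |x|^2. *)
pose d := eta / (k.+1)%:R.
have d0 : 0 < d by rewrite divr_gt0.
have close : \forall t \near F, forall ij : 'I_k * 'I_k,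
    `|diag_mx e ij.1 ij.2 - (P *m f t *m P^T) ij.1 ij.2| < d.
  by apply: filter_forall => ij; exact: (@cvgr_dist_lt _ _ _ F FF _ _ (fP ij.1 ij.2) d d0).
apply: filter_app fs; apply: filterS close => t ct fts; apply: sgE.
have key (x : 'rV_k) : x != 0 ->
    `|qform (diag_mx e) x - qform (P *m f t *m P^T) x| < eta * \sum_i x 0 i ^+ 2.
  move=> x0; have X0 : 0 < \sum_i x 0 i ^+ 2.
    have /rV_neq0P[i xi] := x0; rewrite (bigD1 i) //= ltr_pwDl ?exprn_even_gt0 //.
    by apply: sumr_ge0 => j _; exact: sqr_ge0.
  rewrite -qformB; apply: le_lt_trans (qform_bound x (d := d) _) _.
    by move=> i j; have /ltW := ct (i, j); rewrite !mxE.
  by rewrite ltr_pM2r // /d mulrAC ltr_pdivrMr // ltr_pM2l // ltr_nat.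
have sgt := sgP fts.
pose fp : 'I_#|[pred i | (0 < e (0 : 'I_1) i)%R]| -> 'I_k := enum_val.
pose fn : 'I_#|[pred i | (e (0 : 'I_1) i < 0)%R]| -> 'I_k := enum_val.
have fp_le l : eta <= e 0 (fp l).
  by have := enum_valP l; rewrite inE => /gtr0_norm <-; apply: eta_le.
have fn_le l : eta <= (- e) 0 (fn l).
  by have := enum_valP l; rewrite inE mxE => /ltr0_norm <-; apply: eta_le.
have fp_inj : injective fp by apply: enum_val_inj.
have fn_inj : injective fn by apply: enum_val_inj.
have nz r (g : 'I_r -> 'I_k) : injective g -> forall x, x != 0 -> x *m rowsub g 1%:M != 0 :> 'rV[R]_k.
  move=> g_inj x; apply: contraNneq => z0; apply/eqP.
  by apply: (row_free_inj (rowsub_free R g_inj)); rewrite mul0mx.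
rewrite sa sum_sgz -(definite_inertia (V := rowsub fp 1%:M *m P)
  (W := rowsub fn 1%:M *m P) sgt) //.
- move=> x x0; rewrite mulmxA qform_mul.
  have := key _ (nz _ _ fp_inj _ x0); have := diag_posdef_le x fp_le.
  by rewrite /= ltr_norml => ? /andP[_ ?]; lra.
- move=> x x0; rewrite mulmxA qform_mul.
  have := key _ (nz _ _ fn_inj _ x0); have := diag_posdef_le x fn_le.
  by rewrite /= diag_mxN qformN ltr_norml => ? /andP[? _]; lra.
by rewrite count_pos_neg_nz.
Qed.
End Operations.
End EntrywiseConvergence.

(** * Charts of the Lagrangian Grassmannian *)

Section LagrangianCharts.
Variables (R : realType) (m : nat).
Local Notation W := 'rV[R]_(m + m).

Definition Jmx : 'M[R]_(m + m) := block_mx 0 1%:M (- 1%:M) 0.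

Lemma dotC k (x y : 'rV[R]_k) : (x *m y^T) 0 0 = (y *m x^T) 0 0.
Proof. by rewrite -mxTE trmx_mul trmxK. Qed.

Lemma symplE (v w : W) : sympl v w = (v *m Jmx *m w^T) 0 0.
Proof.
rewrite /sympl mxDE [X in _ + X]mxE [X in _ - X]dotC -{3}[v]hsubmxK -{3}[w]hsubmxK.
rewrite /Jmx mul_row_block !mulmx0 mulmxN !mulmx1 add0r addr0.
by rewrite tr_row_mx mul_row_col mulNmx [RHS]mxDE [X in _ = X + _]mxE addrC.
Qed.

Lemma Jmx_unit : Jmx \in unitmx.
Proof.
have : Jmx *m (block_mx 0 (- 1%:M) 1%:M 0) = 1%:M.
  rewrite /Jmx mulmx_block !(mulmx0, mul0mx, add0r, addr0, mulNmx, mulmxN, mul1mx, mulmx1) opprK.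
  by rewrite -scalar_mx_block.
by case/mulmx1_unit.
Qed.

Lemma row_spanP (F : 'M[R]_(m, m + m)) z : row_span F z <-> (z <= F)%MS.
Proof.
split; first by move=> [x _ <-]; apply: submxMl.
by case/submxP => D ->; exists D.
Qed.

Definition lagframe (F : 'M[R]_(m, m + m)) := row_free F /\ F *m Jmx *m F^T = 0.

Lemma mx_eq0_form k l (A : 'M[R]_(k, l)) :
  (forall (x : 'rV_k) (y : 'rV_l), (x *m A *m y^T) 0 0 = 0) -> A = 0.
Proof.
move=> h; apply/matrixP => i j; have := h (delta_mx 0 i) (delta_mx 0 j).
by rewrite -rowE trmx_delta -colE !mxE.
Qed.

(** The skew-orthogonal complement of the row span has dimension 2m - rank F, so it coincides with
    the span exactly when the span is isotropic and F has full rank. *)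
Lemma lagframeP F : lagrangian (row_span F) <-> lagframe F.
Proof.
have annE w : (forall v, row_span F v -> sympl v w = 0) <-> (w <= kermx (F *m Jmx)^T)%MS.
  split=> h.
    apply/sub_kermxP; apply: trmx_inj; rewrite trmx_mul trmxK trmx0.
    apply: mx_eq0_form => x y.
    have E : x *m F *m Jmx *m w^T = 0.
      by rewrite [LHS]mx11_scalar -symplE h ?raddf0 //; exists x.
    by rewrite !mulmxA E mul0mx mxE.
  move=> v [x _ <-]; rewrite symplE; have /sub_kermxP/(congr1 trmx) := h.
  rewrite trmx_mul trmxK trmx0 -!mulmxA => ->; by rewrite mulmx0 mxE.
have rk : \rank (kermx (F *m Jmx)^T) = (m + m - \rank F)%N.
  by rewrite mxrank_ker mxrank_tr mxrankMfree // row_free_unit Jmx_unit.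
split=> [lagF|[Ffree FJF]].
  have FJF : F *m Jmx *m F^T = 0.
    apply: mx_eq0_form => x y.
    have : row_span F (y *m F) by exists y.
    rewrite lagF => /(_ (x *m F) (imageT _ x)).
    by rewrite symplE trmx_mul !mulmxA.
  split=> //; rewrite /row_free eqn_leq rank_leq_row /=.
  have : (kermx (F *m Jmx)^T <= F)%MS.
    apply/rV_subP => w /annE; rewrite -row_spanP => h.
    by rewrite lagF.
  by move/mxrankS; rewrite rk leq_subLR; lia.
apply/seteqP; split=> w.
  move=> [x _ <-] v [y _ <-].
  by rewrite symplE trmx_mul !mulmxA -(mulmxA y) -(mulmxA y) FJF mulmx0 mul0mx mxE.
move/annE; apply: contraPP => h /= .
have FK : (F <= kermx (F *m Jmx)^T)%MS.
  by apply/sub_kermxP; apply: trmx_inj; rewrite trmx_mul trmxK trmx0.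
have : (kermx (F *m Jmx)^T <= F)%MS.
  by rewrite -(geq_leqif (mxrank_leqif_sup FK)) rk (eqP Ffree) addnK.
by move=> /(fun a b => submx_trans b a) hh /hh /row_spanP.
Qed.

(* The rows span the Lagrangian q = (p - q S) T, which is transversal to
   p = q S and meets the vertical subspace q = 0 along the kernel of T. *)
Definition shear_frame (S T : 'M[R]_m) : 'M[R]_(m, m + m) := row_mx (1%:M + T *m S) T.

Lemma row_frameJ (P X P' X' : 'M[R]_m) :
  row_mx P X *m Jmx *m (row_mx P' X')^T = P *m X'^T - X *m P'^T.
Proof.
rewrite /Jmx mul_row_block !mulmx0 mulmxN !mulmx1 add0r addr0 tr_row_mx mul_row_col.
by rewrite mulNmx addrC.
Qed.

Lemma frameJ (F F' : 'M[R]_(m, m + m)) :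
  F *m Jmx *m F'^T = lsubmx F *m (rsubmx F')^T - rsubmx F *m (lsubmx F')^T.
Proof. by rewrite -row_frameJ !hsubmxK. Qed.

Lemma shear_frame_lag S T : S^T = S -> T^T = T -> lagframe (shear_frame S T).
Proof.
move=> Ss Ts; split.
  apply/row_freeP; exists (col_mx 1%:M (- S)).
  by rewrite mul_row_col mulmx1 mulmxN addrK.
rewrite row_frameJ linearD /= trmx1 trmx_mul Ss Ts mulmxDl mulmxDr mul1mx mulmx1 mulmxA.
by rewrite subrr.
Qed.

Lemma row_span_mul (M : 'M[R]_m) (F : 'M[R]_(m, m + m)) : M \in unitmx -> row_span (M *m F) = row_span F.
Proof.
move=> Mu; apply/seteqP; split=> z [x _ <-].
  by exists (x *m M); rewrite ?mulmxA.
by exists (x *m invmx M) => //; rewrite mulmxA mulmxKV.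
Qed.

Lemma row_span_eq (F F' : 'M[R]_(m, m + m)) : row_free F -> row_free F' -> row_span F = row_span F' ->
  exists2 M, M \in unitmx & F = M *m F'.
Proof.
move=> Ff Ff' E.
have /submxP[M FM] : (F <= F')%MS.
  by apply/rV_subP => z /row_spanP; rewrite E => /row_spanP.
exists M => //; rewrite -row_free_unit /row_free eqn_leq rank_leq_row /=.
by rewrite -{1}(eqP Ff) FM mxrankM_maxl.
Qed.

Lemma shear_frame_inj S T T' : S^T = S -> T^T = T -> T'^T = T' ->
  row_span (shear_frame S T) = row_span (shear_frame S T') -> T = T'.
Proof.
move=> Ss Ts Ts' /row_span_eq[||M Mu].
- exact: (shear_frame_lag _ _).1.
- exact: (shear_frame_lag _ _).1.
rewrite mul_mx_row mulmxDr mulmx1 => /eq_row_mx[E1 E2].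
move: E1; rewrite mulmxA -E2 => /addIr M1.
by rewrite E2 -M1 mul1mx.
Qed.

Definition in_chart (S : 'M[R]_m) (L : set W) :=
  exists2 T : 'M[R]_m, T^T = T & L = row_span (shear_frame S T).

Definition lcoord (S : 'M[R]_m) (L : set W) : 'M[R]_m :=
  xget 0 [set T | T^T = T /\ L = row_span (shear_frame S T)].

Definition tau S L : int := sg (lcoord S L).

Lemma lcoordE S T : S^T = S -> T^T = T -> lcoord S (row_span (shear_frame S T)) = T.
Proof.
move=> Ss Ts; rewrite /lcoord; case: xgetP => [T' _ [Ts' E]|/(_ T)]; last by case.
by apply: (shear_frame_inj Ss Ts' Ts).
Qed.

Lemma lcoordP S L : S^T = S -> in_chart S L ->
  (lcoord S L)^T = lcoord S L /\ L = row_span (shear_frame S (lcoord S L)).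
Proof. by move=> Ss [T Ts ->]; rewrite lcoordE. Qed.

(** For a Lagrangian frame (P, X) this is P - X S: its invertibility means that the span lies in the
    chart S, and the coordinate is then (P - X S)^-1 X. *)
Definition chart_pivot (S : 'M[R]_m) (F : 'M[R]_(m, m + m)) := lsubmx F - rsubmx F *m S.

Lemma chart_pivot_sym S F : S^T = S -> lagframe F ->
  (rsubmx F *m (chart_pivot S F)^T)^T = rsubmx F *m (chart_pivot S F)^T.
Proof.
move=> Ss [_]; rewrite frameJ => /eqP; rewrite subr_eq0 => /eqP PX.
rewrite /chart_pivot [in RHS]linearB /= !trmx_mul trmxK Ss mulmxBl mulmxBr PX.
by rewrite !mulmxA.
Qed.

Lemma frame_chart S F : S^T = S -> lagframe F -> chart_pivot S F \in unitmx ->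
  let T := invmx (chart_pivot S F) *m rsubmx F in
  T^T = T /\ row_span F = row_span (shear_frame S T).
Proof.
move=> Ss Fl Uu; have := chart_pivot_sym Ss Fl; set U := chart_pivot _ _ in Uu *.
move=> sym T; split.
  rewrite /T; apply: (can_inj (mulKmx Uu)); rewrite mulKVmx //.
  apply: (can_inj (mulmxK (_ : U^T \in unitmx))); first by rewrite unitmx_tr.
  by rewrite trmx_mul -mulmxA -mulmxA -trmx_mul mulmxV // trmx1 mulmx1 -sym trmx_mul trmxK.
rewrite -[RHS](row_span_mul _ Uu) /shear_frame mul_mx_row mulmxDr mulmx1 mulmxA mulKVmx //.
by rewrite /U /chart_pivot subrK hsubmxK.
Qed.

Lemma frame_in_chart S F : S^T = S -> lagframe F ->
  in_chart S (row_span F) <-> chart_pivot S F \in unitmx.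
Proof.
move=> Ss Fl; split=> [[T Ts E]|Uu]; last first.
  by have [] := frame_chart Ss Fl Uu; eexists; [|eassumption].
have [M Mu ->] := row_span_eq Fl.1 (shear_frame_lag Ss Ts).1 E.
rewrite /chart_pivot mul_mx_row row_mxKl row_mxKr mulmxDr mulmx1 mulmxA addrK //.
Qed.

Lemma lcoord_frame S F : S^T = S -> lagframe F -> chart_pivot S F \in unitmx ->
  lcoord S (row_span F) = invmx (chart_pivot S F) *m rsubmx F.
Proof. by move=> Ss Fl /(frame_chart Ss Fl)[Ts ->]; rewrite lcoordE. Qed.

(** Congruence by the pivot removes the inverse from the coordinate; the resulting matrix is
    polynomial in the frame and can be differentiated directly. *)
Lemma tau_frame S F : S^T = S -> lagframe F -> chart_pivot S F \in unitmx ->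
  tau S (row_span F) = sg (rsubmx F *m (chart_pivot S F)^T).
Proof.
move=> Ss Fl Uu; rewrite /tau lcoord_frame //.
have [Ts _] := frame_chart Ss Fl Uu.
by rewrite -(sg_unit_congr Ts Uu) mulKVmx.
Qed.

Lemma in_chart_change S S' T : S^T = S -> S'^T = S' -> T^T = T ->
  (in_chart S' (row_span (shear_frame S T)) <-> 1%:M - T *m (S' - S) \in unitmx) /\
  (1%:M - T *m (S' - S) \in unitmx ->
   lcoord S' (row_span (shear_frame S T)) = invmx (1%:M - T *m (S' - S)) *m T).
Proof.
move=> Ss Ss' Ts.
have E : chart_pivot S' (shear_frame S T) = 1%:M - T *m (S' - S).
  by rewrite /chart_pivot row_mxKl row_mxKr mulmxBr opprB addrA.
have Fl := shear_frame_lag Ss Ts.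
rewrite -E; split; first exact: frame_in_chart.
by move=> /(lcoord_frame Ss' Fl) ->; rewrite row_mxKr.
Qed.

(** Among m + 1 scalar chart centres one always works: P - c X is a pencil to which
    [exists_unit_pencil] applies, because P X^T is symmetric and no nonzero vector is killed by both
    P and X. *)
Lemma lagframe_chart F (c : 'I_m.+1 -> R) : lagframe F -> injective c ->
  exists i, in_chart (c i)%:M (row_span F).
Proof.
move=> Fl c_inj; have [Ff] := Fl; rewrite frameJ => /eqP; rewrite subr_eq0 => /eqP PX.
have [||v ->|v vP vX|i Hi] := @exists_unit_pencil R m m (lsubmx F) (rsubmx F) (rsubmx F)
  (rsubmx F) c _ _ c_inj; rewrite ?mul0mx //.
- by rewrite trmx_mul trmxK -PX.
- apply: (row_free_inj Ff); rewrite mul0mx -[F]hsubmxK mul_mx_row vP vX row_mx0 //.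
exists i; apply/frame_in_chart => //; first by rewrite tr_scalar_mx.
by rewrite /chart_pivot mul_mx_scalar.
Qed.

Lemma natr_inj_ord k : injective (fun i : 'I_k => (i%:R : R)).
Proof. by move=> i j /eqP; rewrite eqr_nat => /eqP /ord_inj. Qed.

Lemma lagframe_in_chart F : lagframe F -> exists2 S, S^T = S & in_chart S (row_span F).
Proof.
move=> /lagframe_chart/(_ (@natr_inj_ord _))[i Hi].
by exists (i%:R)%:M => //; rewrite tr_scalar_mx.
Qed.

Section Filters.
Variables (T : Type) (F : set_system T).
Context {FF : Filter F}.

(** Convergence in the Grassmannian, tested in every chart that contains the limit; an arbitrary
    filter allows neighbourhoods within a subset. *)
Definition lcvg (Lam : T -> set W) (L : set W) :=
  forall S, S^T = S -> in_chart S L ->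
  (\forall t \near F, in_chart S (Lam t)) /\
  mcvg F (fun t => lcoord S (Lam t)) (lcoord S L).

Lemma lcvg_frames (Fr : T -> 'M[R]_(m, m + m)) F0 :
  mcvg F Fr F0 -> lagframe F0 -> (\forall t \near F, lagframe (Fr t)) ->
  lcvg (fun t => row_span (Fr t)) (row_span F0).
Proof.
move=> FrF F0l Frl S Ss inS; have Uu := (frame_in_chart Ss F0l).1 inS.
have pc : mcvg F (fun t => chart_pivot S (Fr t)) (chart_pivot S F0).
  apply: mcvgB; first exact: mcvg_lsub.
  by apply: mcvgM; [exact: mcvg_rsub|exact: mcvg_cst].
have pu := @mcvg_unit _ _ _ FF _ _ _ pc Uu; split.
  apply: filter_app Frl; apply: filterS pu => t ? ?.
  exact/frame_in_chart.
apply: (@mcvg_near_eq _ _ _ _ _ _ (fun t => invmx (chart_pivot S (Fr t)) *m rsubmx (Fr t))).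
  apply: filter_app Frl; apply: filterS pu => t ? ?.
  by rewrite lcoord_frame.
by rewrite lcoord_frame //; apply: mcvgM; [exact: mcvg_inv|exact: mcvg_rsub].
Qed.

Lemma lcvg_near_eq (Lam Lam' : T -> set W) L :
  (\forall t \near F, Lam t = Lam' t) -> lcvg Lam L -> lcvg Lam' L.
Proof.
move=> e h S Ss inS; have [h1 h2] := h S Ss inS; split.
  by apply: filter_app e; apply: filterS h1 => t ? <-.
apply: mcvg_near_eq h2; by apply: filterS e => t ->.
Qed.

(** By [sg_chart_change] the difference of the two signatures is, up to sign, that of an invertible
    matrix depending continuously on the coordinate, and such a signature is locally constant. *)
Lemma tau_diff (Lam : T -> set W) L S S' : lcvg Lam L ->
  S^T = S -> S'^T = S' -> in_chart S L -> in_chart S' L ->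
  \forall t \near F, tau S (Lam t) - tau S' (Lam t) = tau S L - tau S' L.
Proof.
move=> Lc Ss Ss' inS inS'.
have [near_in cv] := Lc _ Ss inS; have [near_in' _] := Lc _ Ss' inS'.
pose E := S' - S; have Es : E^T = E by rewrite /E linearB /= Ss Ss'.
pose G T : 'M[R]_(m + m) := block_mx (- E) 1%:M 1%:M (- T).
have key L' : in_chart S L' -> in_chart S' L' ->
    G (lcoord S L') \in unitmx /\ tau S' L' = tau S L' + sg (G (lcoord S L')).
  move=> i1 i2; have [Ts LE] := lcoordP Ss i1.
  have [c1 c2] := in_chart_change Ss Ss' Ts.
  have u : 1%:M - lcoord S L' *m (S' - S) \in unitmx by apply/c1; rewrite -LE.
  rewrite /tau {2}LE c2 //.
  exact: (sg_chart_change Ts Es u).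
have Gs T0 : T0^T = T0 -> (G T0)^T = G T0.
  by move=> Ts; rewrite /G tr_block_mx !linearN /= Es Ts trmx1.
have Gc : mcvg F (fun t => G (lcoord S (Lam t))) (G (lcoord S L)).
  by apply: mcvg_block; do 1?exact: mcvg_cst; apply: mcvgN.
have [Gu ->] := key _ inS inS'.
have := @sg_cvg _ _ _ FF _ _ _ Gc (Gs _ (lcoordP Ss inS).1) Gu.
move=> /(_ (filterS (fun t h => Gs _ (lcoordP Ss h).1) near_in)) ns.
apply: filter_app near_in; apply: filter_app near_in'; apply: filterS ns => t st i1 i2.
by have [_ ->] := key _ i2 i1; rewrite st; lia.
Qed.
End Filters.
End LagrangianCharts.

(** * Index functions and their homotopy invariance *)

Lemma near_withinP (X : topologicalType) (D : set X) (x : X) (P : X -> Prop) :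
  (\forall y \near within D (nbhs x), P y) <-> (\forall y \near nbhs x, D y -> P y).
Proof. by []. Qed.

Lemma near_within_sub (X : topologicalType) (D D' : set X) (x : X) (P : X -> Prop) :
  D' `<=` D -> (\forall y \near within D (nbhs x), P y) ->
  \forall y \near within D' (nbhs x), P y.
Proof. by move=> DD /near_withinP h; apply/near_withinP; apply: filterS h => y hy /DD. Qed.

Lemma near_withinU (X : topologicalType) (D D' : set X) (x : X) (P : X -> Prop) :
  (\forall y \near within D (nbhs x), P y) -> (\forall y \near within D' (nbhs x), P y) ->
  \forall y \near within (D `|` D') (nbhs x), P y.
Proof.
move=> /near_withinP h /near_withinP h'; apply/near_withinP.
by apply: filterS2 h h' => y hy hy' [/hy|/hy'].
Qed.

Lemma near_within_out (X : topologicalType) (D : set X) (x : X) (P : X -> Prop) :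
  closed D -> ~ D x -> \forall y \near within D (nbhs x), P y.
Proof.
move=> cD nDx; apply/near_withinP.
have : nbhs x (~` D) by apply: open_nbhs_nbhs; split=> //; rewrite openC.
by apply: filterS => y.
Qed.

(** * Compactness of an interval in additive form *)

Section Cousin.
Variable R : realType.

(** The supremum s of the ends x for which P a x holds can be reached, and passed if it is below b,
    by one short interval around s. Only short intervals that contain the point x have to be treated
    locally. *)
Lemma cousin (a b : R) (P : R -> R -> Prop) : a < b ->
  (forall x, a <= x <= b -> exists2 e, 0 < e &
     forall c d, a <= c -> c < d -> d <= b -> x - e < c -> c <= x -> x <= d -> d < x + e -> P c d) ->
  (forall c d e, a <= c -> c < d -> d < e -> e <= b -> P c d -> P d e -> P c e) ->
  P a b.
Proof.
move=> ab loc add.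
pose E : set R := [set x | x = a \/ (a < x <= b /\ P a x)].
have Ea : E a by left.
have Eb : ubound E b by move=> x [->|[/andP[]]//]; exact: ltW.
have supE : has_sup E by split; [exists a|exists b].
set s := sup E.
have as_ : a <= s by apply: ub_le_sup => //; exists b.
have sb : s <= b by apply: ge_sup => //; exists a.
have [|e e0 he] := loc s; first by rewrite as_ sb.
have [x Ex sx] := sup_adherent e0 supE.
have xs : x <= s by apply: ub_le_sup => //; exists b.
have ax : a <= x by case: Ex => [->//|[/andP[/ltW]]].
pose y := Num.min b (s + e / 2).
have yb : y <= b by rewrite /y ge_min lexx.
have sy : s <= y by rewrite /y le_min sb lerDl divr_ge0 // ltW.
have ye : y < s + e by rewrite /y gt_min ltrD2l ltr_pdivrMr // mulr_natr mulr2n ltrDl e0 orbT.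
have yE : y = b \/ y = s + e / 2 by rewrite /y; case: leP; [left|right].
have [xy|xy] : x = y \/ x < y.
- by have := le_trans xs sy; rewrite le_eqVlt => /orP[/eqP|]; [left|right].
- have sE : s = y by apply/eqP; rewrite eq_le sy -xy xs.
  have yb' : y = b by case: yE => // E1; move: e0 E1; rewrite sE => ? ?; lra.
  move: Ex; rewrite xy yb' => -[ba|[]//]; by move: ab; rewrite ba ltxx.
have Pay : P a y.
  have Pxy : P x y by apply: he => //.
  case: Ex => [<-//|[/andP[a_x _] Pax]]; exact: add Pax Pxy.
have Ey : E y by right; rewrite (le_lt_trans ax xy) yb.
have ys : y <= s by apply: ub_le_sup => //; exists b.
have [<-//|yE'] := yE; move: e0 ys; rewrite yE' => ? ?; lra.
Qed.

Lemma locally_constant_itv (Z : Type) (a b : R) (f : R -> Z) :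
  (forall x, a <= x <= b -> \forall y \near within [set t | a <= t <= b] (nbhs x), f y = f x) ->
  forall x, a <= x <= b -> f x = f a.
Proof.
move=> loc x /andP[]; rewrite le_eqVlt => /orP[/eqP <-//|ax xb].
apply: esym; apply: (@cousin a x (fun c d => f c = f d) ax); last by move=> c d e _ _ _ _ -> .
move=> y /andP[ay yx].
have /loc : a <= y <= b by rewrite ay (le_trans yx).
rewrite /within /= => /nbhs_ballP[e /= e0 he]; exists e => // c d ac cd dx xc cx xd de.
have fy z : y - e < z -> z < y + e -> a <= z <= b -> f z = f y.
  by move=> h1 h2 h3; apply: he => //; rewrite /ball /= ltr_distlC h1.
rewrite (fy c) ?(fy d) //; first lra.
- by apply/andP; split; lra.
- lra.
- by apply/andP; split; lra.
Qed.
End Cousin.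

(** * Continuous families of Lagrangians and index functions *)

Section LagContinuity.
Variables (R : realType) (m : nat) (X : topologicalType).
Local Notation W := 'rV[R]_(m + m).
Implicit Types (D : set X) (Lam : X -> set W).

Definition is_lag (L : set W) := exists2 F, lagframe F & L = row_span F.

Lemma is_lag_chart L : is_lag L -> exists2 S, S^T = S & in_chart S L.
Proof. by move=> [F Fl ->]; apply: lagframe_in_chart. Qed.

(** Frames are traded for convergence of chart coordinates; conversely, the coordinate in a chart
    provides the continuous frame [shear_frame]. *)
Lemma lag_continuousP D Lam : lag_continuous D Lam <->
  forall x, D x -> is_lag (Lam x) /\ lcvg (within D (nbhs x)) Lam (Lam x).
Proof.
split=> [h x Dx|h x Dx].
  have [Lx [N [F [Nx Fc LF]]]] := h x Dx.
  have LamE : Lam x = row_span (F x) by apply: LF => //; exact: nbhs_singleton.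
  have Fl : lagframe (F x) by apply/lagframeP; rewrite -LamE.
  have near_eq : \forall y \near within D (nbhs x), Lam y = row_span (F y) /\ lagframe (F y).
    rewrite /within /=; apply: filterS Nx => y Ny Dy.
    have E := LF y Ny Dy; split=> //; apply/lagframeP; rewrite -E.
    by have [] := h y Dy.
  split; first by exists (F x).
  rewrite LamE; apply: (@lcvg_near_eq _ _ _ _ _ (fun y => row_span (F y))).
    by apply: filterS near_eq => y [->].
  apply: lcvg_frames => //; last by apply: filterS near_eq => y [].
  apply/mcvg_entries; move/subspace_continuousP : Fc => /(_ x).
  move=> /(_ (conj (nbhs_singleton Nx) Dx)); apply: cvg_trans.
  move=> A /= FA; rewrite /nbhs /= in FA *; rewrite /within /= in FA *.
  by apply: filterS2 Nx FA => y Ny hy Dy; apply: hy.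
have [[F Fl LF] Lc] := h x Dx; split; first by rewrite LF; apply/lagframeP.
have [S Ss inS] := is_lag_chart (h x Dx).1.
have [near_in _] := Lc S Ss inS.
exists [set y | D y -> in_chart S (Lam y)], (fun y => shear_frame S (lcoord S (Lam y))).
split=> //; last by move=> y Ny Dy; have [] := lcoordP Ss (Ny Dy).
apply/subspace_continuousP => y [Ny Dy].
have [_ cv] := (h y Dy).2 S Ss (Ny Dy).
apply: (@cvg_trans _ ((fun y => shear_frame S (lcoord S (Lam y))) @ within D (nbhs y))).
  apply: cvg_app; move=> A; rewrite /nbhs /= /within /=.
  by apply: filterS => z hz [_ Dz]; apply: hz.
apply/mcvg_entries; apply: mcvg_row => //; apply: mcvgD; first exact: mcvg_cst.
by apply: mcvgM => //; exact: mcvg_cst.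
Qed.

Lemma lag_continuous_ext D Lam Lam' : (forall x, D x -> Lam x = Lam' x) ->
  lag_continuous D Lam -> lag_continuous D Lam'.
Proof.
move=> E Lc x Dx; have [? [N [F [Nx Fc LF]]]] := Lc x Dx; rewrite -E //; split=> //.
by exists N, F; split=> // y Ny Dy; rewrite -E //; apply: LF.
Qed.

(* h plus the signature of the coordinate of Lam in a chart S is locally
   constant; by tau_diff this does not depend on S. *)
Definition lag_index D Lam (h : X -> int) := forall x, D x -> exists S,
  [/\ S^T = S, in_chart S (Lam x) &
      \forall y \near within D (nbhs x), h y + tau S (Lam y) = h x + tau S (Lam x)].

Lemma index_any D Lam h x S : lag_continuous D Lam -> lag_index D Lam h -> D x ->
  S^T = S -> in_chart S (Lam x) ->
  \forall y \near within D (nbhs x), h y + tau S (Lam y) = h x + tau S (Lam x).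
Proof.
move=> /lag_continuousP Lc ih Dx Ss inS; have [S' [Ss' inS' h']] := ih x Dx.
have : \forall y \near within D (nbhs x),
    tau S (Lam y) - tau S' (Lam y) = tau S (Lam x) - tau S' (Lam x).
  by apply: tau_diff => //; exact: (Lc x Dx).2.
by apply: filterS2 h' => y; lia.
Qed.

Lemma lag_continuous_sub D D' Lam : D' `<=` D -> lag_continuous D Lam -> lag_continuous D' Lam.
Proof.
move=> DD Lc x Dx; have [? [N [F [Nx Fc LF]]]] := Lc x (DD _ Dx); split=> //.
exists N, F; split=> //; last by move=> y Ny /DD; apply: LF.
by apply: continuous_subspaceW Fc => y [? /DD].
Qed.

Lemma index_diff D Lam h h' x : lag_continuous D Lam -> lag_index D Lam h -> lag_index D Lam h' ->
  D x -> \forall y \near within D (nbhs x), h y - h' y = h x - h' x.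
Proof.
move=> Lc ih ih' Dx; have [S [Ss inS E]] := ih x Dx.
have := index_any Lc ih' Dx Ss inS; apply: filterS2 E => y; lia.
Qed.

(** After the shift by c the two functions agree on the intersection. Since the pieces are closed, a
    point outside one of them has a neighbourhood that avoids it. *)
Lemma index_glue D1 D2 Lam h1 h2 c : closed D1 -> closed D2 ->
  lag_continuous (D1 `|` D2) Lam -> lag_index D1 Lam h1 -> lag_index D2 Lam h2 ->
  (forall x, D1 x -> D2 x -> h1 x - h2 x = c) ->
  lag_index (D1 `|` D2) Lam (fun x => if `[< D1 x >] then h1 x else h2 x + c).
Proof.
move=> cl1 cl2 Lc i1 i2 hc x Dx.
have [S Ss inS] : exists2 S, S^T = S & in_chart S (Lam x).
  by apply: is_lag_chart; have /lag_continuousP/(_ x Dx)[] := Lc.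
exists S; split=> //.
have E1 y : D1 y -> (if `[< D1 y >] then h1 y else h2 y + c) = h1 y by move=> ?; rewrite asboolT.
have E2 y : D2 y -> (if `[< D1 y >] then h1 y else h2 y + c) = h2 y + c.
  by move=> D2y; case: asboolP => // D1y; rewrite -(hc y D1y D2y); lia.
have near1 : \forall y \near within D1 (nbhs x),
   (if `[< D1 y >] then h1 y else h2 y + c) + tau S (Lam y) =
   (if `[< D1 x >] then h1 x else h2 x + c) + tau S (Lam x).
  have [D1x|nD1x] := pselect (D1 x).
    have := index_any (lag_continuous_sub (@subsetUl _ _ _) Lc) i1 D1x Ss inS.
    move=> /near_withinP h; apply/near_withinP; apply: filterS h => y hy D1y.
    by rewrite !E1 //; exact: hy.
  exact: near_within_out.
have near2 : \forall y \near within D2 (nbhs x),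
   (if `[< D1 y >] then h1 y else h2 y + c) + tau S (Lam y) =
   (if `[< D1 x >] then h1 x else h2 x + c) + tau S (Lam x).
  have [D2x|nD2x] := pselect (D2 x).
    have := index_any (lag_continuous_sub (@subsetUr _ _ _) Lc) i2 D2x Ss inS.
    move=> /near_withinP h; apply/near_withinP; apply: filterS h => y hy D2y.
    by rewrite !E2 //; have := hy D2y; lia.
  exact: near_within_out.
exact: near_withinU.
Qed.
End LagContinuity.

Lemma lcvg_comp (R : realType) m (X Y : Type) (F : set_system X) (G : set_system Y)
    (f : Y -> X) (Lam : X -> set 'rV[R]_(m + m)) L :
  f @ G --> F -> lcvg F Lam L -> lcvg G (Lam \o f) L.
Proof.
move=> fG h S Ss inS; have [h1 h2] := h S Ss inS; split; first exact: (fG _ h1).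
by move=> i j; exact: (cvg_comp _ _ fG (h2 i j)).
Qed.

Lemma cvg_within_comp (X Y : topologicalType) (f : Y -> X) (D : set X) (D' : set Y) y :
  {for y, continuous f} -> (forall z, D' z -> D (f z)) ->
  f @ within D' (nbhs y) --> within D (nbhs (f y)).
Proof.
move=> fc fD A hA; have {hA}/fc : \forall x \near f y, D x -> A x := hA.
by change ((\forall z \near y, D (f z) -> A (f z)) -> \forall z \near y, D' z -> A (f z));
  apply: filterS => z hz /fD.
Qed.

Lemma lag_continuous_comp (R : realType) m (X Y : topologicalType) (f : Y -> X)
    (D : set X) (D' : set Y) (Lam : X -> set 'rV[R]_(m + m)) :
  (forall y, D' y -> {for y, continuous f}) -> (forall y, D' y -> D (f y)) ->
  lag_continuous D Lam -> lag_continuous D' (Lam \o f).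
Proof.
move=> fc fD /lag_continuousP Lc; apply/lag_continuousP => y D'y.
have [? Lcy] := Lc _ (fD y D'y); split=> //.
by apply: lcvg_comp Lcy; apply: cvg_within_comp => //; exact: fc.
Qed.

(** * Index functions on rectangles and homotopies *)

Section HomotopyInvariance.
Variables (R : realType) (m : nat).
Local Notation W := 'rV[R]_(m + m).

Definition rect (a b c d : R) : set (R * R) :=
  [set s : R | a <= s <= b] `*` [set t : R | c <= t <= d].

Lemma closed_seg (a b : R) : closed [set s : R | a <= s <= b].
Proof.
have -> : [set s : R | a <= s <= b] = `[a, b]%classic by apply/seteqP; split=> x; rewrite /= in_itv.
exact: interval_closed.
Qed.

Lemma closed_rect a b c d : closed (rect a b c d).
Proof.
have -> : rect a b c d =
    (fst @^-1` [set s : R | a <= s <= b]) `&` (snd @^-1` [set t : R | c <= t <= d]) by [].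
by apply: closedI; apply: closed_comp (@closed_seg _ _) => x _; [exact: cvg_fst|exact: cvg_snd].
Qed.

Lemma index_comp (X Y : topologicalType) (f : Y -> X) (D : set X) (D' : set Y)
    (Lam : X -> set W) (Lam' : Y -> set W) h :
  (forall y, D' y -> {for y, continuous f}) -> (forall y, D' y -> D (f y)) ->
  (forall y, D' y -> Lam (f y) = Lam' y) ->
  lag_index D Lam h -> lag_index D' Lam' (h \o f).
Proof.
move=> fc fD LL ih y D'y; have [S [Ss inS /near_withinP E]] := ih _ (fD y D'y).
exists S; split=> //; first by rewrite -LL.
apply/near_withinP; have := fc y D'y _ E; rewrite nbhs_filterE /=.
by apply: filterS => z hz D'z; rewrite -!LL //=; apply: hz; apply: fD.
Qed.

Lemma index_seg_unique (a b : R) (Lam : R -> set W) h h' :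
  lag_continuous [set t | a <= t <= b] Lam ->
  lag_index [set t | a <= t <= b] Lam h -> lag_index [set t | a <= t <= b] Lam h' ->
  forall t, a <= t <= b -> h t - h' t = h a - h' a.
Proof.
move=> Lc ih ih'; apply: (locally_constant_itv (f := fun t => h t - h' t)).
by move=> x xab; apply: index_diff Lc ih ih' xab.
Qed.

Lemma rect_sub a b c d a' b' c' d' : a <= a' -> b' <= b -> c <= c' -> d' <= d ->
  rect a' b' c' d' `<=` rect a b c d.
Proof.
move=> h1 h2 h3 h4 [x y] [/= /andP[x1 x2] /andP[y1 y2]]; split=> /=.
  by rewrite (le_trans h1) // (le_trans x2).
by rewrite (le_trans h3) // (le_trans y2).
Qed.

Lemma cvg_pairl (s t : R) : {for t, continuous (fun t : R => (s, t))}.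
Proof. by apply: (@cvg_pair _ _ _ (nbhs t) (nbhs s) (nbhs t)); [exact: cvg_cst|exact: cvg_id]. Qed.

Lemma cvg_pairr (s t : R) : {for s, continuous (fun s : R => (s, t))}.
Proof. by apply: (@cvg_pair _ _ _ (nbhs s) (nbhs s) (nbhs t)); [exact: cvg_id|exact: cvg_cst]. Qed.

(** Two nested subdivisions: into strips in the first variable, and inside a narrow strip into cells
    in the second. Along a common edge two index functions differ by a constant
    ([index_seg_unique]), which is the compatibility that gluing requires. *)
Lemma index_rect (a b c d : R) (H : R * R -> set W) : a < b -> c < d ->
  lag_continuous (rect a b c d) H -> exists h, lag_index (rect a b c d) H h.
Proof.
move=> ab cd Hc.
apply: (@cousin _ a b (fun s s' => exists h, lag_index (rect s s' c d) H h)) => //; last first.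
  move=> x y z ax xy yz zb [h1 ih1] [h2 ih2].
  have Dxz : rect x y c d `|` rect y z c d = rect x z c d.
    apply/seteqP; split=> [[s t] [[/= /andP[s1 s2] t1]|[/= /andP[s1 s2] t1]]|
      [s t] [/= /andP[s1 s2] t1]].
    - by split=> //=; apply/andP; split; lra.
    - by split=> //=; apply/andP; split; lra.
    - by have [sy|sy] := leP s y; [left|right]; split=> //=; apply/andP; split; lra.
  have Hxz : lag_continuous (rect x z c d) H.
    by apply: lag_continuous_sub Hc; apply: rect_sub.
  have seg (k : R * R -> int) x' y' : a <= x' -> y' <= b -> x' <= y <= y' ->
      lag_index (rect x' y' c d) H k ->
      lag_index [set t | c <= t <= d] (fun t => H (y, t)) (k \o (fun t => (y, t))).
    move=> h1' h2' h3' ik; apply: index_comp ik => // t; first by move=> _; exact: cvg_pairl.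
  have Hy : lag_continuous [set t | c <= t <= d] (fun t => H (y, t)).
    apply: (lag_continuous_comp (f := fun t => (y, t)) _ _ Hc) => t; first by move=> _; exact: cvg_pairl.
    by move=> tcd; split=> //=; apply/andP; split; lra.
  exists (fun p => if `[< rect x y c d p >] then h1 p else h2 p + (h1 (y, c) - h2 (y, c))).
  rewrite -Dxz; apply: index_glue => //.
  - exact: closed_rect.
  - exact: closed_rect.
  - by rewrite Dxz.
  move=> [s t] [/= /andP[s1 s2] t1] [/= /andP[s3 s4] t2].
  have -> : s = y by lra.
  have xyy : x <= y <= y by rewrite lexx ltW.
  have yyz : y <= y <= z by rewrite lexx ltW.
  have s1' := seg h1 x y ax (ltW (lt_le_trans yz zb)) xyy ih1.
  have s2' := seg h2 y z (ltW (le_lt_trans ax xy)) zb yyz ih2.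
  exact: (index_seg_unique Hy s1' s2' t1).
move=> s sab.
(* One width e has to serve the whole column over [c, d]; it is therefore part of the property
   subdivided in the second variable, and a gluing takes the minimum of two widths. *)
suff [e e0 he] : exists2 e, 0 < e & forall a' b', a <= a' -> a' < b' -> b' <= b ->
    s - e < a' -> b' < s + e -> exists h, lag_index (rect a' b' c d) H h.
  by exists e => // a' b' *; apply: he.
apply: (@cousin _ c d (fun t t' => exists2 e, 0 < e & forall a' b', a <= a' -> a' < b' -> b' <= b ->
    s - e < a' -> b' < s + e -> exists h, lag_index (rect a' b' t t') H h)) => //; last first.
  move=> x y z cx xy yz zd [e1 e10 he1] [e2 e20 he2].
  exists (Num.min e1 e2); first by rewrite lt_min e10.
  move=> a' b' aa' ab' bb'; rewrite ltrBlDr -ltrBlDl lt_min => /andP[h1' h1''].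
  rewrite -ltrBlDl lt_min => /andP[h2' h2''].
  have [||h1 ih1] := he1 a' b' aa' ab' bb'; [lra|lra|].
  have [||h2 ih2] := he2 a' b' aa' ab' bb'; [lra|lra|].
  have Dxz : rect a' b' x y `|` rect a' b' y z = rect a' b' x z.
    apply/seteqP; split=> [[u t] [[/= u1 /andP[t1 t2]]|[/= u1 /andP[t1 t2]]]|
      [u t] [/= u1 /andP[t1 t2]]].
    - by split=> //=; apply/andP; split; lra.
    - by split=> //=; apply/andP; split; lra.
    - by have [ty|ty] := leP t y; [left|right]; split=> //=; apply/andP; split; lra.
  have Hxz : lag_continuous (rect a' b' x z) H.
    by apply: lag_continuous_sub Hc; apply: rect_sub.
  have seg (k : R * R -> int) x' y' : x' <= y <= y' ->
      lag_index (rect a' b' x' y') H k ->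
      lag_index [set s | a' <= s <= b'] (fun s => H (s, y)) (k \o (fun s => (s, y))).
    by move=> h3' ik; apply: index_comp ik => // t; move=> _; exact: cvg_pairr.
  have Hy : lag_continuous [set s | a' <= s <= b'] (fun s => H (s, y)).
    apply: (lag_continuous_comp (f := fun t => (t, y)) _ _ Hc) => t; first by move=> _; exact: cvg_pairr.
    by move=> /= /andP[? ?]; split=> //=; apply/andP; split; lra.
  exists (fun p => if `[< rect a' b' x y p >] then h1 p else h2 p + (h1 (a', y) - h2 (a', y))).
  rewrite -Dxz; apply: index_glue => //.
  - exact: closed_rect.
  - exact: closed_rect.
  - by rewrite Dxz.
  move=> [u t] [/= u1 /andP[t1 t2]] [/= u2 /andP[t3 t4]].
  have -> : t = y by lra.
  have xyy : x <= y <= y by rewrite lexx ltW.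
  have yyz : y <= y <= z by rewrite lexx ltW.
  have s1' := seg h1 x y xyy ih1; have s2' := seg h2 y z yyz ih2.
  exact: (index_seg_unique Hy s1' s2' u1).
move=> t tcd.
have Dst : rect a b c d (s, t) by [].
have [/is_lag_chart[S Ss inS] Lc] := (lag_continuousP _ _).1 Hc _ Dst.
have [/near_withinP] := Lc S Ss inS.
move=> [[A B] /= [/nbhs_ballP[e1 /= e10 he1] /nbhs_ballP[e2 /= e20 he2]] AB] _.
exists e2 => // c' d' cc' cd' dd' *; exists e1 => // a' b' *.
(* On a cell whose image lies in one chart, minus the signature of the coordinate is an index
   function. *)
exists (fun p => - tau S (H p)) => -[u v] [/= uab vcd].
have near_in u' v' : a' <= u' <= b' -> c' <= v' <= d' -> in_chart S (H (u', v')).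
  move=> /andP[? ?] /andP[? ?]; apply: (AB (u', v')) => /=.
    split; first by apply: he1; rewrite /ball /= ltr_distlC; apply/andP; split; lra.
    by apply: he2; rewrite /ball /= ltr_distlC; apply/andP; split; lra.
  by split=> /=; apply/andP; split; lra.
exists S; split=> //; first exact: near_in.
by apply: nearW => p; rewrite !addNr.
Qed.

(** An index function k on the square is followed around its boundary: it is constant along the two
    sides where the end points are fixed, and on the side of [Lam] it differs from h by a
    constant. *)
Lemma index_homotopy (a b : R) (Lam Gam : R -> set W) h : a < b ->
  lag_homotopic a b Lam Gam -> lag_index [set t | a <= t <= b] Lam h ->
  exists2 g, lag_index [set t | a <= t <= b] Gam g & g b - g a = h b - h a.
Proof.
move=> ab [H [Hc H0 H1 Ha Hb]] ih.
have [k ik] := index_rect (@ltr01 R) ab Hc.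
have in01 (s t : R) : 0 <= s <= 1 -> a <= t <= b -> rect 0 1 a b (s, t) by [].
have le01 : 0 <= (0:R) <= 1 by rewrite lexx ler01.
have le11 : 0 <= (1:R) <= 1 by rewrite lexx ler01.
have aab : a <= a <= b by rewrite lexx ltW.
have bab : a <= b <= b by rewrite lexx ltW.
(* For a constant family the zero function is an index function, so k is constant on a side where H
   is constant. *)
have const_index (L : set W) : is_lag L -> lag_index [set s : R | 0 <= s <= 1] (fun=> L) (fun=> 0%Z).
  by move=> /is_lag_chart[S Ss inS] x _; exists S; split=> //; apply: nearW.
have edge t : a <= t <= b -> (forall s, 0 <= s <= 1 -> H (s, t) = Lam t) -> k (1, t) = k (0, t).
  move=> tab HL.
  have Lt : is_lag (Lam t).
    have [+ _] := (lag_continuousP _ _).1 Hc _ (in01 _ _ le01 tab).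
    by rewrite HL.
  have c01 : lag_continuous [set s : R | 0 <= s <= 1] (fun=> Lam t).
    apply/lag_continuousP => s s01; split=> // S Ss inS.
    by split; [exact: nearW|exact: mcvg_cst].
  have ik' : lag_index [set s : R | 0 <= s <= 1] (fun=> Lam t) (k \o (fun s => (s, t))).
    by apply: index_comp ik => [s _|s s01|s s01]; [exact: cvg_pairr|exact: in01|exact: HL].
  have := index_seg_unique c01 ik' (const_index _ Lt) le11.
  by rewrite /= !subr0.
have ik0 : lag_index [set t | a <= t <= b] Lam (k \o (fun t => (0, t))).
  by apply: index_comp ik => [t _|t tab|t tab]; [exact: cvg_pairl|exact: in01|exact: H0].
have Lc : lag_continuous [set t | a <= t <= b] Lam.
  have := lag_continuous_comp (f := fun t => (0, t)) (D' := [set t | a <= t <= b]) _ _ Hc.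
  move=> /(_ (fun t _ => @cvg_pairl 0 t) (fun t => in01 0 t le01)).
  by apply: lag_continuous_ext => t tab; rewrite /= H0.
exists (k \o (fun t => (1, t))).
  by apply: index_comp ik => [t _|t tab|t tab]; [exact: cvg_pairl|exact: in01|exact: H1].
have := index_seg_unique Lc ik0 ih bab; rewrite /= => E.
rewrite /= (edge a aab Ha) (edge b bab Hb).
by move: (k (0, b)) (k (0, a)) (h a) (h b) E => x y z w E; lia.
Qed.
End HomotopyInvariance.

(** * The jump of an index function at a crossing *)

Section EntrywiseDerivative.
Variable R : realType.

Definition mderiv (V : normedModType R) k l (F : V -> 'M[R]_(k, l)) (t v : V) (F' : 'M[R]_(k, l)) :=
  forall i j, is_derive t v (fun s => F s i j : R^o) (F' i j).

Section Rules.
Variables (V : normedModType R) (t v : V).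

Lemma mderiv_cst k l (A : 'M[R]_(k, l)) : mderiv (fun=> A) t v 0.
Proof. by move=> i j; rewrite mxE; apply: is_derive_cst. Qed.

Lemma mderivD k l (F G : V -> 'M[R]_(k, l)) F' G' :
  mderiv F t v F' -> mderiv G t v G' -> mderiv (fun s => F s + G s) t v (F' + G').
Proof.
move=> hF hG i j; rewrite mxE; under eq_fun do rewrite mxE.
exact: is_deriveD.
Qed.

Lemma mderivN k l (F : V -> 'M[R]_(k, l)) F' :
  mderiv F t v F' -> mderiv (fun s => - F s) t v (- F').
Proof.
move=> hF i j; rewrite mxE; under eq_fun do rewrite mxE.
exact: is_deriveN.
Qed.

Lemma mderivM k l p (F : V -> 'M[R]_(k, l)) (G : V -> 'M[R]_(l, p)) F' G' :
  mderiv F t v F' -> mderiv G t v G' ->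
  mderiv (fun s => F s *m G s) t v (F' *m G t + F t *m G').
Proof.
move=> hF hG i j; under eq_fun do rewrite mxE.
have -> : (F' *m G t + F t *m G') i j = \sum_h (F t i h *: G' h j + G t h j *: F' i h).
  rewrite !mxE -big_split /=; apply: eq_bigr => h _.
  by rewrite addrC; congr (_ + _); rewrite mulrC.
rewrite (_ : (fun s => _) = \sum_h ((fun s => F s i h) * (fun s => G s h j))); last first.
  by apply/funext => s; rewrite fct_sumE.
by apply: is_derive_sum => h; apply: is_deriveM; [exact: hF|exact: hG].
Qed.

Lemma mderivT k l (F : V -> 'M[R]_(k, l)) F' :
  mderiv F t v F' -> mderiv (fun s => (F s)^T) t v F'^T.
Proof. by move=> hF i j; rewrite mxE; under eq_fun do rewrite mxE; exact: hF. Qed.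

Lemma mderiv_lsub k l l' (F : V -> 'M[R]_(k, l + l')) F' :
  mderiv F t v F' -> mderiv (fun s => lsubmx (F s)) t v (lsubmx F').
Proof. by move=> hF i j; rewrite mxE; under eq_fun do rewrite mxE; exact: hF. Qed.

Lemma mderiv_rsub k l l' (F : V -> 'M[R]_(k, l + l')) F' :
  mderiv F t v F' -> mderiv (fun s => rsubmx (F s)) t v (rsubmx F').
Proof. by move=> hF i j; rewrite mxE; under eq_fun do rewrite mxE; exact: hF. Qed.

Lemma mderiv_unique k l (F : V -> 'M[R]_(k, l)) F' F'' :
  mderiv F t v F' -> mderiv F t v F'' -> F' = F''.
Proof.
move=> h1 h2; apply/matrixP => i j.
by rewrite -(@derive_val _ _ _ _ _ _ _ (h1 i j)) (@derive_val _ _ _ _ _ _ _ (h2 i j)).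
Qed.

Lemma mderiv_near_eq k l (F G : V -> 'M[R]_(k, l)) F' :
  (\forall s \near t, F s = G s) -> mderiv F t v F' -> mderiv G t v F'.
Proof.
move=> FG hF i j; apply: near_eq_is_derive (hF i j).
by apply: filterS FG => s ->.
Qed.

Lemma mderivP k l (F : V -> 'M[R]_(k, l)) :
  (forall i j, differentiable (fun s => F s i j : R^o) t) -> mderiv F t v ('D_v F t).
Proof.
move=> dF i j.
have dd i' j' : derivable (fun s => F s i' j' : R^o) t v by apply: diff_derivable.
by rewrite derive_mx ?mxE; [apply/derivableP|apply/derivable_mxP].
Qed.
End Rules.

Lemma mderiv_cvg (V : normedModType R) k l (F : V -> 'M[R]_(k, l)) t v F' :
  mderiv F t v F' -> forall i j,
  h^-1 * (F (h *: v + t) i j - F t i j) @[h --> 0^'] --> (F' i j : R^o).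
Proof.
move=> hF i j; have [d <-] := hF i j.
exact: d.
Qed.
End EntrywiseDerivative.

(** * The jump of the signature at a one-dimensional kernel *)

Section SignatureJump.
Variable R : realType.

(** Rows of the invertible P at zero entries of e are independent kernel vectors, so a
    one-dimensional kernel leaves room for exactly one of them. *)
Lemma diag_kernel_index n (A : 'M[R]_n) k (P : 'M[R]_(k, n)) (e : 'rV_k) (x0 : 'rV_n) :
  A^T = A -> row_free P -> row_full P -> P *m A *m P^T = diag_mx e ->
  x0 != 0 -> (forall x : 'rV_n, x *m A = 0 <-> exists a, x = a *: x0) ->
  exists i0, (forall i, (e 0 i == 0) = (i == i0)) /\
    (exists2 a, a != 0 & row i0 P = a *: x0).
Proof.
move=> As Pfree Pfull PA x00 ker.
have kn : k = n by rewrite -(eqP Pfree) (eqP Pfull).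
have PTfree : row_free P^T by rewrite /row_free mxrank_tr (eqP Pfree) kn.
have kerP i : e 0 i = 0 -> exists2 a, a != 0 & row i P = a *: x0.
  move=> ei; have : row i P *m A = 0.
    apply: (row_free_inj PTfree); rewrite mul0mx -!row_mul PA.
    by apply/rowP => j; rewrite !mxE ei mul0rn.
  move=> /ker[a Ha]; exists a => //; apply: contraTneq Pfree => a0.
  rewrite -kermx_eq0; apply/eqP => K0.
  have : (delta_mx (0 : 'I_1) i <= kermx P)%MS.
    by apply/sub_kermxP; rewrite -rowE Ha a0 scale0r.
  by rewrite K0 submx0 => /eqP/matrixP/(_ 0 i)/eqP; rewrite !mxE !eqxx oner_eq0.
have [i0 ei0] : exists i, e 0 i = 0.
  apply: contrapT => /forallNP h.
  have [y yP] : exists y, x0 = y *m P by apply/submxP; apply: submx_full.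
  have : x0 *m A *m P^T = 0 by rewrite (ker x0).2 ?mul0mx //; exists 1; rewrite scale1r.
  rewrite yP -[y *m P *m A]mulmxA -mulmxA PA => yd.
  have y0 : y = 0.
    apply/rowP => j; rewrite mxE; have := congr1 (fun M : 'rV_k => M 0 j) yd.
    by rewrite mul_mx_diag !mxE => /eqP; rewrite mulf_eq0 => /orP[/eqP|/eqP /h].
  by move: x00; rewrite yP y0 mul0mx eqxx.
exists i0; split; last exact: kerP.
move=> i; apply/eqP/eqP => [ei|->//].
have [a a0 Ha] := kerP i ei; have [b b0 Hb] := kerP i0 ei0.
apply: contraTeq Pfree => ii0; rewrite -kermx_eq0; apply/eqP => K0.
have : (b *: delta_mx (0 : 'I_1) i - a *: delta_mx (0 : 'I_1) i0 <= kermx P)%MS.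
  apply/sub_kermxP; rewrite mulmxBl -!scalemxAl -!rowE Ha Hb !scalerA mulrC subrr //.
rewrite K0 submx0 => /eqP/matrixP/(_ 0 i)/eqP.
by rewrite !mxE !eqxx (negbTE ii0) mulr1 mulr0 subr0 (negbTE b0).
Qed.

Lemma at_right_gt0 : \forall r \near (0 : R)^'+, 0 < r.
Proof. exact: nbhs_right_gt. Qed.

Lemma sqrt_cvg0 : Num.sqrt r @[r --> (0 : R)^'+] --> (0 : R^o).
Proof.
by apply: cvg_at_right_filter; have := @sqrt_continuous R 0; rewrite /continuous_at sqrtr0.
Qed.

(* Rescaling the kernel direction by 1/sqrt r turns the jump into a
   nondegenerate limit. *)
Lemma sg_jump n (y : R -> 'M[R]_n) (y0 y' : 'M[R]_n) (x0 : 'rV_n) :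
  y0^T = y0 -> (\forall r \near 0^'+, (y r)^T = y r) ->
  (forall i j, r^-1 * (y r i j - y0 i j) @[r --> 0^'+] --> (y' i j : R^o)) ->
  x0 != 0 -> (forall x : 'rV_n, x *m y0 = 0 <-> exists a, x = a *: x0) ->
  qform y' x0 != 0 ->
  \forall r \near 0^'+, sg (y r) = sg y0 + sgz (qform y' x0).
Proof.
move=> y0s ys dy x00 ker d0.
have [k [P [e [Pfree Pfull PA sg0]]]] := sgP y0s.
have [i0 [ei0 [a a0 Pa]]] := diag_kernel_index y0s Pfree Pfull PA x00 ker.
have kn : k = n by rewrite -(eqP Pfree) (eqP Pfull).
have y'lim : mcvg 0^'+ (fun r => r^-1 *: (y r - y0)) y'.
  by move=> i j; under eq_fun do rewrite 3!mxE; exact: dy.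
pose z r := P *m y r *m P^T; pose z' := P *m y' *m P^T.
have zlim : mcvg 0^'+ (fun r => r^-1 *: (z r - diag_mx e)) z'.
  apply: (@mcvg_near_eq _ _ _ _ _ _ (fun r => P *m (r^-1 *: (y r - y0)) *m P^T)).
    by apply: nearW => r; rewrite -scalemxAr -scalemxAl mulmxBr mulmxBl PA.
  by apply: mcvgM; [apply: mcvgM => //|]; exact: mcvg_cst.
have idc : r @[r --> (0 : R)^'+] --> (0 : R^o) by apply: cvg_at_right_filter; exact: cvg_id.
have zcont : mcvg 0^'+ z (diag_mx e).
  apply: (@mcvg_near_eq _ _ _ _ _ _ (fun r => diag_mx e + r *: (r^-1 *: (z r - diag_mx e)))).
    have := at_right_gt0; apply: filterS => r r0.
    by rewrite scalerA mulfV ?gt_eqF // scale1r addrC subrK.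
  rewrite -[X in mcvg _ _ X]addr0 -(scale0r z').
  by apply: mcvgD; [exact: mcvg_cst|apply: mcvgZ].
(* After this scaling the entry (i0, i0) is a difference quotient and tends to that of z'; the other
   entries in row or column i0 are sqrt r times a bounded quotient and tend to 0; the remaining
   entries keep their limits. The limit is the invertible diagonal matrix with entries e'. *)
pose w r : 'rV[R]_k := \row_i if i == i0 then (Num.sqrt r)^-1 else 1.
pose e' : 'rV[R]_k := \row_i if i == i0 then z' i0 i0 else e 0 i.
have key : mcvg 0^'+ (fun r => diag_mx (w r) *m z r *m diag_mx (w r)) (diag_mx e').
  move=> i j.
  have E r : 0 < r -> (diag_mx (w r) *m z r *m diag_mx (w r)) i j =
      (w r 0 i) * (z r i j) * (w r 0 j).
    by move=> _; rewrite mul_mx_diag mxE mul_diag_mx mxE.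
  have limE (g : R -> R) l : (forall r, 0 < r -> (w r 0 i) * (z r i j) * (w r 0 j) = g r) ->
      g r @[r --> 0^'+] --> (l : R^o) ->
      (diag_mx (w r) *m z r *m diag_mx (w r)) i j @[r --> 0^'+] --> (l : R^o).
    move=> h; apply: cvg_trans; apply: near_eq_cvg.
    have := at_right_gt0; apply: filterS => r r0; rewrite E // h //.
  have zij : i != j \/ i = i0 -> (diag_mx e) i j = 0.
    rewrite !mxE; case: eqP => // -> [//|ii0]; rewrite mulr1n; apply/eqP; by rewrite ei0 ii0.
  rewrite mxE mxE; case: (eqVneq i j) => [ij|ij].
    rewrite mulr1n; case: (eqVneq i i0) => [ii|ii].
      apply: (limE (fun r => (r^-1 *: (z r - diag_mx e)) i j)).
        move=> r r0; rewrite !mxE -ij ii eqxx (eqP (_ : e 0 i0 == 0)) ?ei0 // mul0rn subr0.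
        rewrite -[X in _ = X^-1 * _](sqr_sqrtr (ltW r0)) expr2 invfM.
        by rewrite [RHS]mulrC mulrA [X in X * _ = _]mulrC.
      by rewrite -ij {1}ii ii; have := zlim i0 i0; rewrite -?ij.
    apply: (limE (fun r => z r i j)).
      by move=> r r0; rewrite !mxE -ij (negbTE ii) mul1r mulr1.
    by have := zcont i j; rewrite !mxE ij eqxx mulr1n.
  rewrite mulr0n.
  have off (b : R -> R) : (b r @[r --> 0^'+] --> (0 : R^o)) ->
      b r * (r^-1 *: (z r - diag_mx e)) i j @[r --> 0^'+] --> (0 : R^o).
    by move=> b0; rewrite -[X in _ --> X](mul0r (z' i j)); apply: cvgM => //; exact: zlim.
  have zE r : (r^-1 *: (z r - diag_mx e)) i j = r^-1 * z r i j.
    by rewrite [LHS]mxE [X in _ * X]mxE [X in _ * (_ + X)]mxE zij ?subr0; [|left].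
  have sq r : 0 < r -> (Num.sqrt r)^-1 = Num.sqrt r * r^-1.
    move=> r0; rewrite -{3}(sqr_sqrtr (ltW r0)) expr2 invfM mulrA mulfV ?mul1r //.
    by rewrite gt_eqF // sqrtr_gt0.
  case: (eqVneq i i0) => [ii|ii].
    apply: (limE (fun r => Num.sqrt r * (r^-1 *: (z r - diag_mx e)) i j)); last exact/off/sqrt_cvg0.
    move=> r r0; rewrite zE [w r 0 i]mxE [w r 0 j]mxE ii eqxx -ii eq_sym (negbTE ij) mulr1 sq //.
    by rewrite mulrA.
  case: (eqVneq j i0) => [ji|ji].
    apply: (limE (fun r => Num.sqrt r * (r^-1 *: (z r - diag_mx e)) i j)); last exact/off/sqrt_cvg0.
    move=> r r0; rewrite zE [w r 0 i]mxE [w r 0 j]mxE ji eqxx (negbTE ii) mul1r sq //.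
    by rewrite mulrC -mulrA.
  apply: (limE (fun r => z r i j)).
    by move=> r r0; rewrite [w r 0 i]mxE [w r 0 j]mxE (negbTE ii) (negbTE ji) mul1r mulr1.
  by have := zcont i j; rewrite zij //; left.
have z'E : z' i0 i0 = a ^+ 2 * qform y' x0.
  rewrite /z' /qform; have -> : (P *m y' *m P^T) i0 i0 = (row i0 P *m y' *m (row i0 P)^T) 0 0.
    rewrite -row_mul [LHS]mxE [RHS]mxE; apply: eq_bigr => j _.
    by rewrite [row _ _ _ _]mxE [P^T _ _]mxE [(row _ _)^T _ _]mxE [row _ _ _ _]mxE.
  rewrite Pa linearZ /= -scalemxAr -!scalemxAl scalerA mxE expr2 //.
have e'u : diag_mx e' \in unitmx.
  rewrite unitmxE det_diag unitfE; apply/prodf_neq0 => i _; rewrite mxE.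
  case: (eqVneq i i0) => [_|ii]; last by rewrite ei0.
  by rewrite z'E mulf_neq0 // expf_neq0.
have wu r : 0 < r -> diag_mx (w r) \in unitmx.
  move=> r0; rewrite unitmxE det_diag unitfE; apply/prodf_neq0 => i _; rewrite mxE.
  by case: ifP => _; rewrite ?oner_neq0 // invr_eq0 gt_eqF // sqrtr_gt0.
have zs r : (y r)^T = y r -> (z r)^T = z r by move=> ysr; apply: sym_congr.
have trw r : (diag_mx (w r))^T = diag_mx (w r) by rewrite tr_diag_mx.
have sgk := @sg_cvg _ _ _ _ _ _ _ key (tr_diag_mx _) e'u.
have {sgk} : \forall r \near 0^'+, sg (diag_mx (w r) *m z r *m diag_mx (w r)) = sg (diag_mx e').
  apply: sgk; apply: filterS ys => r ysr.
  by rewrite -{2 4}trw sym_congr // zs.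
apply: filterS3 at_right_gt0 ys => r r0 ysr.
rewrite -{2}trw sg_unit_congr ?wu ?zs // /z sg_congr // => ->.
rewrite sg_diag sg0 (bigD1 i0) //= [in RHS](bigD1 i0) //= mxE eqxx z'E.
rewrite (eqP (_ : e 0 i0 == 0)) ?ei0 // sgz0 add0r addrC; congr (_ + _).
  by apply: eq_bigr => i ii; rewrite mxE (negbTE ii).
by rewrite sgzM sgzX; congr (_); rewrite -sgzX (gtr0_sgz (_ : 0 < a ^+ 2)) ?mul1r // exprn_even_gt0.
Qed.
End SignatureJump.

(** * Smooth curves and the crossing form *)

Section SmoothCurves.
Variable R : realType.

Lemma smooth_on_comb n (A : set R) (c : 'I_n -> R) (f : 'I_n -> R -> R) : open A ->
  (forall i, smooth_on A (f i : R -> R^o)) ->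
  smooth_on A (fun y => \sum_i c i * f i y : R^o).
Proof.
move=> oA fs.
pose D s (g : R -> R^o) := foldr (fun v (g : R -> R^o) => fun y => 'D_v g y) g s.
have key s y : A y -> D s (fun y => \sum_i c i * f i y) y = \sum_i c i * D s (f i) y.
  elim: s y => [//|v s IH] y Ay /=.
  have dd i : derivable (D s (f i)) y v by apply: diff_derivable; exact: fs.
  rewrite (@near_eq_derive _ _ _ _ (fun y => \sum_i c i * D s (f i) y)); last first.
    have : nbhs y A by apply: open_nbhs_nbhs.
    by apply: filterS => z /IH.
  rewrite (_ : (fun y => _) = \sum_i (c i *: D s (f i))); last first.
    by apply/funext => z; rewrite fct_sumE.
  rewrite derive_sum; last by move=> i; apply: derivableZ.
  by apply: eq_bigr => i _; rewrite deriveZ.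
move=> s x Ax; apply/derivable1_diffP.
apply: (@near_eq_derivable _ _ _ (fun y => \sum_i c i * D s (f i) y)).
  have : nbhs x A by apply: open_nbhs_nbhs.
  by apply: filterS => z Az; apply: esym; exact: (key s z Az).
rewrite (_ : (fun y => _) = \sum_i (c i *: D s (f i))); last first.
  by apply/funext => z; rewrite fct_sumE.
apply: derivable_sum => i; apply: derivableZ; apply/derivable1_diffP; exact: fs.
Qed.

Lemma smooth_map_on_mul k l p (A : set R) (C : 'M[R]_(k, l)) (F : R -> 'M[R]_(l, p)) :
  open A -> smooth_map_on A F -> smooth_map_on A (fun s => C *m F s).
Proof.
move=> oA Fs i j; under [X in smooth_on _ X]eq_fun do rewrite mxE.
by apply: smooth_on_comb => // h; apply: Fs.
Qed.

Lemma smooth_mderiv k l (A : set R) (F : R -> 'M[R]_(k, l)) t :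
  smooth_map_on A F -> A t -> mderiv F t 1 ('D_1 F t).
Proof. by move=> Fs At; apply: mderivP => i j; exact: (Fs i j [::] t At). Qed.

Lemma mderiv_mcvg k l (F : R -> 'M[R]_(k, l)) t F' : mderiv F t 1 F' -> mcvg (nbhs t) F (F t).
Proof.
move=> hF i j; apply: differentiable_continuous; apply/derivable1_diffP.
exact: (@ex_derive _ _ _ _ _ _ _ (hF i j)).
Qed.

(** Independence of the crossing form from the chosen curve l: the vectors l s and x F s lie in the
    same Lagrangian, so sigma(x F, l - x F) vanishes identically near t. As l - x F vanishes at t,
    differentiating there leaves sigma(x F, l' - x F') = 0. *)
Lemma lag_dotE m (Gam : R -> set 'rV[R]_(m + m)) t (N : set R) F x :
  open_nbhs t N -> smooth_map_on N F ->
  (forall s, N s -> Gam s = row_span (F s)) -> (forall s, N s -> lagframe (F s)) ->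
  lag_dot Gam t (x *m F t) = sympl (x *m F t) (x *m 'D_1 F t).
Proof.
move=> [oN Nt] Fs GF Fl; have hF := smooth_mderiv Fs Nt.
have hxF : mderiv (fun s => x *m F s) t 1 (x *m 'D_1 F t).
  have := mderivM (mderiv_cst t 1 x) hF; by rewrite mul0mx add0r.
rewrite /lag_dot; case: xgetP => [r _ [N' [l [[oN' N't] ls lG lt ->]]]|/(_ (sympl (x *m F t) (x *m 'D_1 F t)))[]]; last first.
  exists N, (fun s => x *m F s); split=> //; first exact: smooth_map_on_mul.
    by move=> s Ns; rewrite GF //; exists x.
  congr sympl; apply: (mderiv_unique hxF).
  exact: (smooth_mderiv (smooth_map_on_mul x oN Fs) Nt).
have hl := smooth_mderiv ls N't; rewrite lt.
have hw := mderivD hl (mderivN hxF).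
have hg := mderivM (mderivM hxF (mderiv_cst t 1 (Jmx R m))) (mderivT hw).
have g0 : \forall s \near t, x *m F s *m Jmx R m *m (l s - x *m F s)^T = 0.
  have nN : nbhs t (N `&` N') by apply: filterI; apply: open_nbhs_nbhs.
  apply: filterS nN => s [Ns N's]; have [_ FJF] := Fl s Ns.
  have := lG s N's; rewrite GF // => -[y _ <-].
  by rewrite -mulmxBl trmx_mul !mulmxA -(mulmxA x) -(mulmxA x) FJF mulmx0 mul0mx.
have := mderiv_near_eq g0 hg.
move=> /mderiv_unique/(_ (mderiv_cst _ _ _)).
rewrite lt subrr trmx0 mulmx0 add0r => E.
have := congr1 (fun M : 'M[R]_1 => M 0 0) E.
rewrite linearB /= mulmxBr [RHS]mxE mxDE [X in _ + X]mxE -!symplE => /eqP.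
by rewrite subr_eq0 => /eqP.
Qed.
End SmoothCurves.

(** * Crossings with the train *)

Section Crossings.
Variables (R : realType) (m : nat).
Local Notation W := 'rV[R]_(m + m).

Lemma near_of_sides (t : R) (P : R -> Prop) :
  P t -> (\forall r \near 0^'+, P (t + r)) -> (\forall r \near 0^'+, P (t - r)) ->
  \forall s \near t, P s.
Proof.
move=> Pt [e1 /= e10 h1] [e2 /= e20 h2]; apply/nbhs_ballP.
exists (Num.min e1 e2) => /=; first by rewrite lt_min e10.
move=> s; rewrite /ball /= lt_min ltr_distlC => /andP[].
have [ts|st|<-] := ltgtP t s; last by [].
- move=> /andP[] ? ? _; have -> : s = t + (s - t) by rewrite addrC subrK.
  by apply: h1; rewrite /ball /= ?sub0r ?normrN ?gtr0_norm ?subr_gt0 //; lra.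
- move=> _; rewrite ltr_distlC => /andP[] ? ?; have -> : s = t - (t - s) by rewrite opprB addrC subrK.
  by apply: h2; rewrite /ball /= ?sub0r ?normrN ?gtr0_norm ?subr_gt0 //; lra.
Qed.

Lemma cvg_addr0 (t : R) : t + r @[r --> (0 : R)^'+] --> t.
Proof.
apply: cvg_at_right_filter; rewrite -{2}[t]addr0; apply: cvgD; [exact: cvg_cst|exact: cvg_id].
Qed.

Lemma cvg_subr0 (t : R) : t - r @[r --> (0 : R)^'+] --> t.
Proof.
apply: cvg_at_right_filter; rewrite -{2}[t]subr0; apply: cvgB; [exact: cvg_cst|exact: cvg_id].
Qed.

(** [sg_jump] on each side of t; on the left it is applied to r |-> Y (t - r), whose derivative is
    -Y', hence the opposite sign. *)
Lemma sg_cross n (Y : R -> 'M[R]_n) (Y' : 'M[R]_n) (x0 : 'rV_n) t :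
  (\forall s \near t, (Y s)^T = Y s) -> mderiv Y t 1 Y' ->
  x0 != 0 -> (forall x : 'rV_n, x *m Y t = 0 <-> exists a, x = a *: x0) ->
  qform Y' x0 != 0 ->
  \forall s \near t, sg (Y s) = sg (Y t) + sgz (qform Y' x0) * sgz (s - t).
Proof.
move=> Ys hY x00 ker d0; have Yts := nbhs_singleton Ys.
have lim := mderiv_cvg hY.
apply: near_of_sides; first by rewrite subrr sgz0 mulr0 addr0.
  have J : \forall r \near 0^'+, sg (Y (t + r)) = sg (Y t) + sgz (qform Y' x0); last first.
    apply: filterS2 (@at_right_gt0 R) J => r r0 ->.
    by rewrite addrAC subrr add0r (gtr0_sgz r0) mulr1.
  apply: (sg_jump Yts _ _ x00 ker d0); first exact: (cvg_addr0 Ys).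
  move=> i j; have {}lim := lim i j.
  have := cvg_dnbhs_at_right lim; apply: cvg_trans.
  apply: near_eq_cvg; apply: nearW => r /=.
  by rewrite [r *: 1]mulr1 [r + t]addrC.
have J : \forall r \near 0^'+, sg (Y (t - r)) = sg (Y t) + sgz (qform (- Y') x0); last first.
  apply: filterS2 (@at_right_gt0 R) J => r r0 ->.
  by rewrite addrAC subrr add0r sgzN (gtr0_sgz r0) qformN sgzN mulrN1.
apply: (sg_jump Yts _ _ x00 ker); first exact: (cvg_subr0 Ys); last by rewrite qformN oppr_eq0.
move=> i j; have {}lim := lim i j; rewrite mxE.
have /cvg_at_leftNP := cvg_dnbhs_at_left lim; rewrite oppr0 => /cvgN; apply: cvg_trans.
apply: near_eq_cvg; apply: nearW => r /=.
have -> : t - r = (- r) *: 1 + t by rewrite [(- r) *: 1]mulr1 addrC.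
by rewrite [LHS](_ : _ = - ((- r)^-1 * (Y ((- r) *: 1 + t) i j - Y t i j))) // invrN mulNr opprK.
Qed.

(** A kernel vector of the coordinate yields a vertical vector of L. *)
Lemma lcoord_unit S (L : set W) : S^T = S -> in_chart S L ->
  ~ train (@vertical R m) L -> lcoord S L \in unitmx.
Proof.
move=> Ss inS nt; have [Ts LE] := lcoordP Ss inS; apply: contra_notT nt.
rewrite -row_free_unit -kermx_eq0 => /rowV0Pn[x /sub_kermxP xT x0].
exists (x *m shear_frame S (lcoord S L)).
  split; first by rewrite [X in X _]LE; exists x.
  by rewrite /vertical /= /shear_frame mul_mx_row row_mxKr.
have [/row_freeP[C FC] _] := shear_frame_lag Ss Ts.
by apply: contraNneq x0 => E; rewrite -[x]mulmx1 -FC mulmxA E mul0mx.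
Qed.

Lemma tau_locally_constant T (F : set_system T) (FF : Filter F) (Lam : T -> set W) L S :
  lcvg F Lam L -> S^T = S -> in_chart S L -> ~ train (@vertical R m) L ->
  \forall t \near F, tau S (Lam t) = tau S L.
Proof.
move=> Lc Ss inS nt; have [near_in cv] := Lc S Ss inS.
apply: sg_cvg cv _ (lcoord_unit Ss inS nt) _; first by have [] := lcoordP Ss inS.
by apply: filterS near_in => t /(lcoordP Ss)[].
Qed.

(** With G = (P, X) and pivot U, [sg_cross] is applied to Y = X U^T, whose signature is [tau] by
    [tau_frame]. Since x0 X = 0, only X' contributes to the derivative on x0, and x0 U = x0 P; this
    is exactly the symplectic pairing of x0 G with x0 G'. *)
Lemma frame_cross (G : R -> 'M[R]_(m, m + m)) G' t S (x0 : 'rV[R]_m) :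
  (\forall s \near t, lagframe (G s)) -> mderiv G t 1 G' ->
  S^T = S -> in_chart S (row_span (G t)) -> x0 != 0 ->
  (forall x : 'rV_m, x *m rsubmx (G t) = 0 <-> exists a, x = a *: x0) ->
  sympl (x0 *m G t) (x0 *m G') != 0 ->
  \forall s \near t, tau S (row_span (G s)) =
    tau S (row_span (G t)) + sgz (sympl (x0 *m G t) (x0 *m G')) * sgz (s - t).
Proof.
move=> Gl hG Ss inS x00 ker d0; have Glt := nbhs_singleton Gl.
have Uu := (frame_in_chart Ss Glt).1 inS.
pose U s := chart_pivot S (G s); pose Y s := rsubmx (G s) *m (U s)^T.
have hU : mderiv U t 1 (lsubmx G' - rsubmx G' *m S).
  apply: mderivD (mderiv_lsub hG) _; apply: mderivN.
  by have := mderivM (mderiv_rsub hG) (mderiv_cst t 1 S); rewrite mulmx0 addr0.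
have hY := mderivM (mderiv_rsub hG) (mderivT hU).
set Y' := (X in mderiv _ _ _ X) in hY.
have kerY x : x *m Y t = 0 <-> exists a, x = a *: x0.
  rewrite -ker /Y mulmxA; split=> [|->]; last by rewrite mul0mx.
  have Ut : (U t)^T \in unitmx by rewrite unitmx_tr.
  by move=> /(canRL (mulmxK Ut)); rewrite mul0mx.
have dE : qform Y' x0 = sympl (x0 *m G t) (x0 *m G').
  have x0X : x0 *m rsubmx (G t) = 0 by apply/ker; exists 1; rewrite scale1r.
  have hL : x0 *m Y' = x0 *m rsubmx G' *m (U t)^T.
    by rewrite /Y' mulmxDr 2!mulmxA x0X mul0mx addr0.
  have hR : x0 *m (G t *m Jmx R m *m G'^T) = x0 *m lsubmx (G t) *m (rsubmx G')^T.
    by rewrite frameJ mulmxBr 2!mulmxA x0X mul0mx subr0.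
  have hU0 : x0 *m U t = x0 *m lsubmx (G t).
    by rewrite /U /chart_pivot mulmxBr mulmxA x0X mul0mx subr0.
  rewrite symplE trmx_mul !mulmxA -(mulmxA x0) -(mulmxA x0) hR /qform hL.
  rewrite -[LHS]mxTE !trmx_mul !trmxK -hU0.
  by rewrite !mulmxA.
have near_pivot : \forall s \near t, U s \in unitmx.
  by apply: (mcvg_unit (mderiv_mcvg hU)).
have Ys : \forall s \near t, (Y s)^T = Y s.
  by apply: filterS Gl => s Gls; apply: chart_pivot_sym.
have := @sg_cross _ Y Y' x0 t Ys hY x00 kerY; rewrite dE => /(_ d0).
apply: filterS3 Gl near_pivot => s Gls Us.
by rewrite !tau_frame.
Qed.

Lemma sgz_near (t c : R) : c != t -> \forall s \near t, sgz (s - c) = sgz (t - c).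
Proof.
move=> ct; have tc : 0 < `|t - c| by rewrite normr_gt0 subr_eq0 eq_sym.
apply/nbhs_ballP; exists `|t - c| => // s; rewrite /ball /= => ts.
have [h|h|h] := ltgtP c t.
- rewrite !gtr0_sgz ?subr_gt0 //; move: ts; rewrite (gtr0_norm (_ : 0 < t - c)) ?subr_gt0 //.
  by rewrite ltr_distlC; lra.
- rewrite !ltr0_sgz ?subr_lt0 //; move: ts; rewrite (ltr0_norm (_ : t - c < 0)) ?subr_lt0 //.
  by rewrite ltr_distlC; lra.
by move: ct; rewrite h eqxx.
Qed.

Lemma sgz_near_seq (t : R) (r : seq R) :
  \forall s \near t, forall c, c \in r -> c != t -> sgz (s - c) = sgz (t - c).
Proof.
suff : nbhs t [set s | forall c, c \in r -> c != t -> sgz (s - c) = sgz (t - c)] by [].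
elim: r => [|c r IH]; first by apply: filterS filterT => s _ c; rewrite in_nil.
have [ct|ct] := eqVneq c t.
  apply: filterS IH => s h d; rewrite in_cons => /orP[/eqP ->|/h //].
  by rewrite ct eqxx.
have := sgz_near ct; apply: filterS2 IH => s h hc d.
by rewrite in_cons => /orP[/eqP -> //|/h].
Qed.

(** B carries the reference subspace Pi to the vertical one. Crossings and their signs refer to the
    original curve, the index function to its image under B; symplecticity of B makes the crossing
    forms agree. *)
Lemma crossing_total (a b : R) (Gam : R -> set W) (Pi : set W) (B : 'M[R]_(m + m)) h :
  a < b -> B *m Jmx R m *m B^T = Jmx R m -> (forall v, Pi v <-> vertical (v *m B)) ->
  lag_smooth_curve `[a, b] Gam -> ~ train Pi (Gam a) -> ~ train Pi (Gam b) ->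
  (forall t, crossings a b Pi Gam t -> transversal_crossing Pi Gam t) ->
  finite_set (crossings a b Pi Gam) ->
  lag_continuous [set t | a <= t <= b] (fun t => (fun v => v *m B) @` Gam t) ->
  lag_index [set t | a <= t <= b] (fun t => (fun v => v *m B) @` Gam t) h ->
  h b - h a = - 2 * \sum_(t \in crossings a b Pi Gam) crossing_sign Pi Gam t.
Proof.
move=> ab BJ PiE Gs nta ntb tr fin Lc ih.
have Bu : B \in unitmx.
  have : B *m Jmx R m *m B^T \in unitmx by rewrite BJ Jmx_unit.
  by rewrite !unitmx_mul => /andP[/andP[]].
have Bfree : row_free B by rewrite row_free_unit.
set C := crossings _ _ _ _; rewrite fsbig_finite //=.
set r : seq R := finmap.enum_fset (fset_set C); set sg_ := crossing_sign Pi Gam.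
(* Each crossing c contributes a step equal to 0 before c, the sign at c, and twice the sign after
   c. This compensates the jump of h, so k will be locally constant. *)
pose k t := h t + \sum_(c <- r) sg_ c * (sgz (t - c) + 1).
have inr c : (c \in r) = (c \in C) by rewrite /r in_fset_set.
(* The end points are off the train, so every crossing is an interior time, as the crossing form
   requires. *)
have Cab c : C c -> a < c < b.
  move=> [/andP[ac cb] ct]; rewrite !lt_neqAle ac cb !andbT; apply/andP; split.
    by apply/eqP => E; apply: nta; rewrite E.
  by apply/eqP => E; apply: ntb; rewrite -E.
have ka : k a = h a.
  rewrite /k big_seq big1 ?addr0 // => c; rewrite inr inE => /Cab/andP[ac _].
  by rewrite ltr0_sgz ?subr_lt0 // addNr mulr0.
have kb : k b = h b + 2 * \sum_(c <- r) sg_ c.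
  rewrite /k mulr_sumr; congr (_ + _); apply: eq_big_seq => c; rewrite inr inE => /Cab/andP[_ cb].
  by rewrite gtr0_sgz ?subr_gt0 // mulrC.
suff : k b = k a by rewrite ka kb => <-; rewrite opprD addrA subrr add0r mulNr.
apply: (@locally_constant_itv _ _ a b k); last by rewrite lexx ltW.
move=> t tab; have [S [Ss inS hS]] := ih t tab.
have [Ct|nCt] := pselect (C t); last first.
  have nt : ~ train (@vertical R m) ((fun v => v *m B) @` Gam t).
    move=> [v [[w Gw <-]] vert v0]; apply: nCt; split=> //; exists w.
      by split=> //; apply/PiE.
    by apply: contraNneq v0 => ->; rewrite mul0mx.
  have Lct := (((lag_continuousP _ _).1 Lc) t tab).2.
  have tc : \forall s \near within [set t | a <= t <= b] (nbhs t),
      tau S ((fun v => v *m B) @` Gam s) = tau S ((fun v => v *m B) @` Gam t).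
    exact: tau_locally_constant Lct Ss inS nt.
  have sr : \forall s \near within [set t | a <= t <= b] (nbhs t),
     forall c, c \in r -> c != t -> sgz (s - c) = sgz (t - c).
    by apply: cvg_within; apply: sgz_near_seq.
  apply/near_withinP; move: tc hS sr => /near_withinP tc /near_withinP hS /near_withinP sr.
  apply: filterS3 tc hS sr => s E1 E2 E3 sab; have {}E1 := E1 sab.
  have {}E2 := E2 sab; have {}E3 := E3 sab; rewrite /k.
  have -> : h s = h t by move: E2; rewrite E1 => /addIr.
  congr (_ + _); apply: eq_big_seq => c cr; rewrite E3 //.
  by apply: contra_notN nCt => /eqP <-; move: cr; rewrite inr inE.
have /andP[a_t t_b] := Cab t Ct.
have tin : `[a, b]%classic t by rewrite /= in_itv /= tab.
have [_ [N [F [[oN Nt] Fs GF]]]] := Gs t tin.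
(* The smooth frame represents the curve only at times of [a, b]; the open interval gives a
   two-sided neighbourhood where it does. *)
pose N' := N `&` `]a, b[%classic.
have oN' : open N' by apply: openI => //; exact: interval_open.
have N't : N' t by split=> //; rewrite /= in_itv /= a_t.
have nN' : nbhs t N' by apply: open_nbhs_nbhs.
have N'ab s : N' s -> `[a, b]%classic s.
  by move=> [_]; rewrite /= !in_itv /= => /andP[/ltW -> /ltW ->].
have GF' s : N' s -> Gam s = row_span (F s) by move=> N's; apply: GF (N'ab _ N's); case: N's.
have Fl s : N' s -> lagframe (F s).
  by move=> N's; apply/lagframeP; rewrite -GF' //; have [] := Gs s (N'ab _ N's).
have Fs' : smooth_map_on N' F by move=> i j l s [Ns _]; apply: Fs.
have hF := smooth_mderiv Fs' N't.
have dotE x := lag_dotE x (conj oN' N't) Fs' GF' Fl.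
have [[v v0 vE] dot0] := tr t Ct.
have Gv c : (Gam t `&` Pi) (c *: v) by rewrite vE; exists c.
have [x0 x0E] : exists x0, v = x0 *m F t.
  have [+ _] := Gv 1; rewrite scale1r GF' // => -[x0 _ <-]; by exists x0.
have x00 : x0 != 0 by apply: contraNneq v0 => x00; rewrite x0E x00 mul0mx.
have ker (x : 'rV_m) : x *m rsubmx (F t *m B) = 0 <-> exists c, x = c *: x0.
  have -> : x *m rsubmx (F t *m B) = rsubmx (x *m F t *m B).
    by rewrite -mulmxA -[in RHS](hsubmxK (F t *m B)) mul_mx_row row_mxKr.
  split=> [E|[c ->]].
    have : (Gam t `&` Pi) (x *m F t) by split; [rewrite GF' //; exists x|apply/PiE].
    rewrite vE => -[c _ E']; exists c; apply: (row_free_inj (Fl t N't).1).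
    by rewrite -E' x0E scalemxAl.
  by rewrite -scalemxAl -x0E; have [_ /PiE] := Gv c.
have symB (y z : W) : sympl (y *m B) (z *m B) = sympl y z.
  by rewrite !symplE trmx_mul !mulmxA -(mulmxA y) -(mulmxA y) BJ.
pose d := sympl v (x0 *m 'D_1 F t).
have dE : d = sympl (x0 *m (F t *m B)) (x0 *m ('D_1 F t *m B)).
  by rewrite !mulmxA symB -x0E.
have d0 : d != 0.
  by rewrite /d x0E -dotE -x0E; apply: dot0 => //; have := Gv 1; rewrite scale1r.
have signE : sg_ t = sgz d.
  have dotc c : lag_dot Gam t (c *: v) = c ^+ 2 * d.
    rewrite x0E scalemxAl dotE !symplE -!scalemxAl linearZ /= -scalemxAr scalerA.
    by rewrite mxE expr2 /d symplE x0E.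
  rewrite /sg_ /crossing_sign; case: asboolP => [[w]|nw].
    rewrite vE => -[c _ <-]; rewrite dotc => cd.
    rewrite gtr0_sgz //; apply: contraTT cd; rewrite -!leNgt => d_le.
    by rewrite mulr_ge0_le0 ?sqr_ge0.
  rewrite ltr0_sgz // lt_neqAle d0 leNgt; apply/negP => dp; apply: nw.
  by exists (1 *: v); [exact: Gv|rewrite dotc expr1n mul1r].
have GBE s : N' s -> (fun v => v *m B) @` Gam s = row_span (F s *m B).
  move=> N's; rewrite GF' //; apply/seteqP; split=> w.
    by move=> [_ [x _ <-] <-]; exists x; rewrite ?mulmxA.
  by move=> [x _ <-]; exists (x *m F s); [exists x|rewrite mulmxA].
have FBl : \forall s \near t, lagframe (F s *m B).
  apply: filterS nN' => s N's; have [fr FJ] := Fl s N's; split.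
    by rewrite /row_free mxrankMfree.
  by rewrite trmx_mul !mulmxA -(mulmxA (F s)) -(mulmxA (F s)) BJ.
have hFB : mderiv (fun s => F s *m B) t 1 ('D_1 F t *m B).
  by have := mderivM hF (mderiv_cst t 1 B); rewrite mulmx0 addr0.
have fc := @frame_cross _ _ _ S x0 FBl hFB Ss _ x00 ker.
rewrite -dE -(GBE t N't) in fc; have {}fc := fc inS d0.
have fc' : \forall s \near within [set t | a <= t <= b] (nbhs t),
  tau S ((fun v => v *m B) @` Gam s) = tau S ((fun v => v *m B) @` Gam t) + sgz d * sgz (s - t).
  apply: cvg_within; apply: filterS2 nN' fc => s N's; by rewrite (GBE s N's).
have sr : \forall s \near within [set t | a <= t <= b] (nbhs t),
     forall c, c \in r -> c != t -> sgz (s - c) = sgz (t - c).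
  by apply: cvg_within; apply: sgz_near_seq.
apply/near_withinP; move: fc' hS sr => /near_withinP fc' /near_withinP hS /near_withinP sr.
apply: filterS3 fc' hS sr => s E1 E2 E3 sab; have {}E1 := E1 sab.
have {}E2 := E2 sab; have {}E3 := E3 sab; rewrite /k.
have tr_ : t \in r by rewrite inr inE.
have ur : uniq r by exact: finmap.fset_uniq.
rewrite !(bigD1_seq t tr_ ur) /= subrr sgz0 signE.
have shift (x y z w p : int) : x + y = z + w -> y = w + p -> x = z - p by lia.
have hs : h s = h t - sgz d * sgz (s - t) := shift _ _ _ _ _ E2 E1.
have -> : \sum_(i <- r | i != t) sg_ i * (sgz (s - i) + 1) =
    \sum_(i <- r | i != t) sg_ i * (sgz (t - i) + 1).
  rewrite big_seq_cond [RHS]big_seq_cond; apply: eq_bigr => c /andP[cr ct].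
  by rewrite E3.
by rewrite hs; ring.
Qed.
End Crossings.

(** * Second derivatives under changes of coordinates *)

Section Calculus.
Variable R : realType.

Lemma differentiable_near_eq (V W : normedModType R) (f g : V -> W) x :
  (\forall y \near x, f y = g y) -> differentiable f x -> differentiable g x.
Proof.
move=> fg /diff_locallyP[dfc /eqaddoP dxf].
have gx : g \o shift x = cst (g x) + 'd f x +o_ 0 id.
  apply/eqaddoP => e e0; have := dxf e e0.
  have fgs : \forall h \near (0 : V), f (h + x) = g (h + x).
    by move: fg; rewrite (near_shift 0) /= subr0.
  apply: filterS2 fgs => h E.
  change (`|f (h + x) - (f x + 'd f x h)| <= e * `|h| ->
          `|g (h + x) - (g x + 'd f x h)| <= e * `|h|).
  by rewrite E (nbhs_singleton fg).
by apply/diff_locallyP; rewrite (diff_unique dfc gx).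
Qed.

Lemma line_derive (V : normedModType R) (f : V -> R^o) (x u : V) (s : R) :
  differentiable f (x + s *: u) ->
  is_derive s (1 : R) (fun s : R => f (x + s *: u)) ('D_u f (x + s *: u)).
Proof.
move=> df; have E : (fun h : R => h^-1 *: (f (x + (h *: (1 : R) + s) *: u) - f (x + s *: u))) =
    (fun h : R => h^-1 *: (f (h *: u + (x + s *: u)) - f (x + s *: u))).
  apply/funext => h; congr (_ *: (f _ - _)).
  by rewrite [h *: 1]mulr1 scalerDl addrCA.
apply: DeriveDef.
  by rewrite /derivable E; apply: diff_derivable.
by rewrite /derive E.
Qed.

(** The mean value theorem twice: along u for s |-> f (x + t v + s u) - f (x + s u), then along v
    for the derivative of f in the direction u. *)
Lemma second_difference (V : normedModType R) (A : set V) (f : V -> R^o) (x u v : V) (t : R) :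
  0 < t -> smooth_on A f ->
  (forall a b : R, 0 <= a <= t -> 0 <= b <= t -> A (x + a *: u + b *: v)) ->
  exists a b : R, [/\ 0 <= a <= t, 0 <= b <= t &
    f (x + t *: u + t *: v) - f (x + t *: u) - (f (x + t *: v) - f x) =
    t * t * 'D_v ('D_u f) (x + a *: u + b *: v)].
Proof.
move=> t0 fs Ax.
have tt : 0 <= t <= t by rewrite lexx ltW.
have z0 : 0 <= (0 : R) <= t by rewrite lexx ltW.
have d1 y : A y -> differentiable f y by move=> Ay; exact: (fs [::] y Ay).
have d2 y : A y -> differentiable ('D_u f : V -> R^o) y by move=> Ay; exact: (fs [:: u] y Ay).
pose g (s : R) : R^o := f ((x + t *: v) + s *: u) - f (x + s *: u).
pose dg (s : R) : R^o := 'D_u f ((x + t *: v) + s *: u) - 'D_u f (x + s *: u).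
have Ax0 s : 0 <= s <= t -> A (x + s *: u).
  by move=> st; rewrite -[x + _]addr0 -(scale0r v); apply: Ax.
have gd s : 0 <= s <= t -> is_derive s (1 : R) g (dg s).
  move=> st; apply: is_deriveB; apply: line_derive; apply: d1; last exact: Ax0.
  by rewrite addrAC; apply: Ax.
have gc : {within `[0, t], continuous g}.
  apply: derivable_within_continuous => s; rewrite in_itv /= => st.
  exact: (@ex_derive _ _ _ _ _ _ _ (gd s st)).
have itvW s (a b : R) : s \in `]a, b[ -> a <= s <= b.
  by rewrite in_itv /= => /andP[/ltW -> /ltW ->].
have [a a_in ga] := MVT t0 (fun s st => gd s (itvW _ _ _ st)) gc.
have {}a_in := itvW _ _ _ a_in.
pose k (s : R) : R^o := 'D_u f ((x + a *: u) + s *: v).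
pose dk (s : R) : R^o := 'D_v ('D_u f) ((x + a *: u) + s *: v).
have kd s : 0 <= s <= t -> is_derive s (1 : R) k (dk s).
  by move=> st; apply: line_derive; apply: d2; apply: Ax.
have kc : {within `[0, t], continuous k}.
  apply: derivable_within_continuous => s; rewrite in_itv /= => st.
  exact: (@ex_derive _ _ _ _ _ _ _ (kd s st)).
have [b b_in kb] := MVT t0 (fun s st => kd s (itvW _ _ _ st)) kc.
exists a, b; split=> //; first exact: itvW b_in.
move: ga kb; rewrite /g /dg /k /dk !subr0 !scale0r !addr0 => ga kb.
rewrite [x + t *: u + _]addrAC ga [x + t *: v + _]addrAC kb.
by rewrite mulrC mulrA mulrAC.
Qed.

Lemma second_difference_sym (F1 F2 F3 F0 T d1 d2 : R) : T != 0 ->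
  F1 - F2 - (F3 - F0) = T * d1 -> F1 - F3 - (F2 - F0) = T * d2 -> d1 = d2.
Proof. by move=> T0 E1 E2; apply: (mulfI T0); rewrite -E1 -E2; ring. Qed.

Lemma norm_half_triangle (a b p e : R) :
  `|a - p| < e / 2 -> `|b - p| < e / 2 -> `|b - a| <= e.
Proof.
move=> h1 h2; rewrite (splitr e) -(subrKA p); apply: le_trans (ler_normD _ _) _.
by apply: lerD; [exact: ltW|rewrite distrC ltW].
Qed.

(* Both mixed derivatives are limits of the same second difference. *)
Lemma derive_comm (V : normedModType R) (A : set V) (f : V -> R^o) (x u v : V) :
  open A -> A x -> smooth_on A f -> 'D_u ('D_v f) x = 'D_v ('D_u f) x.
Proof.
move=> oA Ax fs.
have cont w z : 'D_w ('D_z f) y @[y --> x] --> ('D_w ('D_z f) x : R^o).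
  have d : differentiable ('D_w ('D_z f) : V -> R^o) x := fs [:: w; z] x Ax.
  exact: (differentiable_continuous d).
suff key (e : R) : 0 < e -> `|'D_u ('D_v f) x - 'D_v ('D_u f) x| <= e.
  apply/eqP; rewrite -subr_eq0; apply/negPn/negP => ne0.
  have n0 : 0 < `|'D_u ('D_v f) x - 'D_v ('D_u f) x| by rewrite normr_gt0.
  have := key _ (divr_gt0 n0 (ltr0Sn R 1)).
  by rewrite ler_pdivlMr // mulr_natr mulr2n gerDl leNgt n0.
move=> e0.
have e20 : 0 < e / 2 by rewrite divr_gt0.
have : \forall y \near x, A y /\ (`|'D_v ('D_u f) x - 'D_v ('D_u f) y| < e / 2 /\
    `|'D_u ('D_v f) x - 'D_u ('D_v f) y| < e / 2).
  have nA : nbhs x A by apply: open_nbhs_nbhs.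
  have n1 : \forall y \near x, `|'D_v ('D_u f) x - 'D_v ('D_u f) y| < e / 2.
    exact: (@cvgr_dist_lt _ _ _ _ _ _ _ (cont v u) _ e20).
  have n2 : \forall y \near x, `|'D_u ('D_v f) x - 'D_u ('D_v f) y| < e / 2.
    exact: (@cvgr_dist_lt _ _ _ _ _ _ _ (cont u v) _ e20).
  by apply: filterS3 nA n1 n2 => y a b c; split.
move=> /nbhs_ballP[d /= d0 hd].
(* Chosen so that t (1 + |u| + |v|) = d/2, which keeps the whole parallelogram inside the ball; the
   summand 1 keeps the denominator positive. *)
pose t := d / (1 + `|u| + `|v|) / 2.
have uv0 : 0 < 1 + `|u| + `|v| by rewrite -addrA ltr_pwDl // addr_ge0.
have t0 : 0 < t by rewrite !divr_gt0.
have inball a b : 0 <= a <= t -> 0 <= b <= t -> ball x d (x + a *: u + b *: v).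
  move=> /andP[a0 at_] /andP[b0 bt]; rewrite -ball_normE /ball_ /= -addrA opprD addNKr.
  rewrite normrN (le_lt_trans (ler_normD _ _)) // !normrZ !ger0_norm //.
  apply: (@le_lt_trans _ _ (t * (1 + `|u| + `|v|))).
    rewrite !mulrDr mulr1 -addrA; apply: ler_wpDl; first exact: ltW.
    by apply: lerD; apply: ler_wpM2r.
  by rewrite /t mulrAC divfK ?gt_eqF // ltr_pdivrMr // mulr_natr mulr2n ltrDl.
have [a [b [a_in b_in E1]]] : exists a b : R, [/\ 0 <= a <= t, 0 <= b <= t &
    f (x + t *: u + t *: v) - f (x + t *: u) - (f (x + t *: v) - f x) =
    t * t * 'D_v ('D_u f) (x + a *: u + b *: v)].
  by apply: (@second_difference _ A) => // a b ? ?; have [] := hd _ (inball a b _ _).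
have [a' [b' [a'_in b'_in E2]]] : exists a b : R, [/\ 0 <= a <= t, 0 <= b <= t &
    f (x + t *: v + t *: u) - f (x + t *: v) - (f (x + t *: u) - f x) =
    t * t * 'D_u ('D_v f) (x + a *: v + b *: u)].
  by apply: (@second_difference _ A) => // c1 c2 ? ?; rewrite addrAC; have [] := hd _ (inball c2 c1 _ _).
have E : 'D_v ('D_u f) (x + a *: u + b *: v) = 'D_u ('D_v f) (x + b' *: u + a' *: v).
  have tt : t * t != 0 by rewrite mulf_neq0 // gt_eqF.
  rewrite [x + t *: v + t *: u]addrAC in E2; rewrite [x + b' *: u + _]addrAC.
  exact: second_difference_sym tt E1 E2.
have [_ [h1 _]] := hd _ (inball _ _ a_in b_in).
have [_ [_ h2]] := hd _ (inball _ _ b'_in a'_in).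
rewrite E in h1; exact: norm_half_triangle h1 h2.
Qed.

Lemma differentiable_rV (V : normedModType R) n (F : V -> 'rV[R]_n) x :
  (forall k, differentiable (fun y => F y 0 k : R^o) x) -> differentiable F x.
Proof.
move=> dF.
have -> : F = fun y => (\sum_k (fun y => F y 0 k *: (delta_mx 0 k : 'rV[R]_n))) y.
  by apply/funext => y; rewrite fct_sumE -row_sum_delta.
by apply: differentiable_sum => k; apply: differentiableZl.
Qed.

Lemma differentiable_entry (V : normedModType R) n (F : V -> 'rV[R]_n) x k :
  differentiable F x -> differentiable (fun y => F y 0 k : R^o) x.
Proof.
move=> dF; apply: (@differentiable_comp _ _ _ _ F (fun M : 'rV[R]_n => M 0 k : R^o)) => //.
exact: differentiable_coord.
Qed.

Lemma derive_entry (V : normedModType R) n (F : V -> 'rV[R]_n) x v k :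
  differentiable F x -> ('D_v F x) 0 k = 'D_v (fun y => F y 0 k : R^o) x.
Proof. by move=> dF; rewrite derive_mx ?mxE //; apply: diff_derivable. Qed.

Lemma jacobianE n m (F : 'rV[R]_n -> 'rV[R]_m) x :
  differentiable F x ->
  'J F x = \matrix_(i, k) 'D_(delta_mx 0 i) (fun y => F y 0 k : R^o) x.
Proof.
move=> dF; apply/matrixP => i k; rewrite [RHS]mxE -derive_entry // deriveEjacobian //.
by rewrite -rowE [RHS]mxE.
Qed.

Lemma derive_grad n (f : 'rV[R]_n -> R^o) x v :
  differentiable f x -> 'D_v f x = (v *m grad f x) 0 0.
Proof.
move=> df; rewrite deriveE // [in LHS](row_sum_delta v) linear_sum mxE.
by apply: eq_bigr => k _; rewrite linearZ /= mxE deriveE.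
Qed.

Lemma derive_chain (V : normedModType R) m (F : V -> 'rV[R]_m) (g : 'rV[R]_m -> R^o) x v :
  differentiable F x -> differentiable g (F x) ->
  'D_v (fun y => g (F y) : R^o) x = ('D_v F x *m grad g (F x)) 0 0.
Proof.
move=> dF dg; rewrite -derive_grad // !deriveE //; last exact: differentiable_comp.
by rewrite (diff_comp dF dg).
Qed.

Lemma hess_near_eq n (f g : 'rV[R]_n -> R^o) x :
  (\forall y \near x, f y = g y) -> hess f x = hess g x.
Proof.
move=> fg; apply/matrixP => i j.
have hE (h : 'rV[R]_n -> R^o) :
  hess h x i j = 'D_(delta_mx 0 i) (fun y => 'D_(delta_mx 0 j) h y) x by rewrite mxE.
apply: (etrans (hE f) (etrans _ (esym (hE g)))).
suff fg' : \forall y \near x, 'D_(delta_mx 0 j) f y = 'D_(delta_mx 0 j) g y.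
  by rewrite (near_eq_derive _ fg').
have := nbhs_interior fg; apply: filterS => y hy.
by rewrite (near_eq_derive _ (hy : \forall z \near y, f z = g z)).
Qed.

Lemma jacobian_near_eq n m (F G : 'rV[R]_n -> 'rV[R]_m) x :
  (\forall y \near x, F y = G y) -> differentiable F x -> 'J F x = 'J G x.
Proof.
move=> FG dF; rewrite !jacobianE //; last exact: differentiable_near_eq dF.
apply/matrixP => i k; rewrite !mxE; apply: near_eq_derive.
by apply: filterS FG => y ->.
Qed.

Lemma jacobian_chain n m p (F : 'rV[R]_n -> 'rV[R]_m) (G : 'rV[R]_m -> 'rV[R]_p) x :
  differentiable F x -> differentiable G (F x) ->
  'J (fun y => G (F y)) x = 'J F x *m 'J G (F x).
Proof.
move=> dF dG; rewrite [LHS]jacobianE; last exact: differentiable_comp.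
apply/matrixP => i k; rewrite [LHS]mxE (derive_chain (g := fun y => G y 0 k) _ dF); last exact: differentiable_entry.
rewrite deriveEjacobian // -mulmxA -rowE mxE [LHS]mxE [RHS]mxE; apply: eq_bigr => j _; congr (_ * _).
by rewrite [in RHS]jacobianE // [LHS]mxE [RHS]mxE.
Qed.

Lemma smooth_map_diff n m (A : set 'rV[R]_n) (F : 'rV[R]_n -> 'rV[R]_m) x :
  smooth_map_on A F -> A x -> differentiable F x.
Proof. by move=> Fs Ax; apply: differentiable_rV => k; exact: (Fs 0 k [::] x Ax). Qed.

Lemma hess_sym n (A : set 'rV[R]_n) (f : 'rV[R]_n -> R^o) x :
  open A -> A x -> smooth_on A f -> (hess f x)^T = hess f x.
Proof. by move=> oA Ax fs; apply/matrixP => i j; rewrite !mxE; apply: derive_comm oA Ax fs. Qed.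

Lemma hess_chain n m (A : set 'rV[R]_n) (B : set 'rV[R]_m)
    (F : 'rV[R]_n -> 'rV[R]_m) (g : 'rV[R]_m -> R^o) x :
  open A -> A x -> (forall y, A y -> B (F y)) -> smooth_map_on A F -> smooth_on B g ->
  hess (fun y => g (F y)) x = 'J F x *m hess g (F x) *m ('J F x)^T +
    \sum_k grad g (F x) k 0 *: hess (fun y => F y 0 k) x.
Proof.
move=> oA Ax AB Fs gs.
have dF y : A y -> differentiable F y by exact: smooth_map_diff.
have dg y : A y -> differentiable g (F y) by move=> Ay; exact: (gs [::] _ (AB y Ay)).
have dFk y k j : A y -> differentiable ('D_(delta_mx 0 j) (fun y => F y 0 k : R^o) : _ -> R^o) y.
  by move=> Ay; exact: (Fs 0 k [:: delta_mx 0 j] y Ay).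
have dgk y k : A y -> differentiable ('D_(delta_mx 0 k) g : _ -> R^o) (F y).
  by move=> Ay; exact: (gs [:: delta_mx 0 k] _ (AB y Ay)).
apply/matrixP => i j; rewrite mxE.
pose h y := \sum_k ('D_(delta_mx 0 j) (fun y => F y 0 k : R^o) y *
                    'D_(delta_mx 0 k) g (F y)).
rewrite (@near_eq_derive _ _ _ _ (h : _ -> R^o)); last first.
  have : nbhs x A by apply: open_nbhs_nbhs.
  apply: filterS => y Ay; rewrite (derive_chain _ (dF y Ay) (dg y Ay)) mxE.
  by apply: eq_bigr => k _; rewrite derive_entry ?mxE //; exact: dF.
have -> : h = \sum_k ((fun y => 'D_(delta_mx 0 j) (fun y => F y 0 k : R^o) y) *
                      (fun y => 'D_(delta_mx 0 k) g (F y)) : _ -> R^o).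
  by apply/funext => y; rewrite fct_sumE.
have dgF k : differentiable (fun y => 'D_(delta_mx 0 k) g (F y) : R^o) x.
  by apply: (@differentiable_comp _ _ _ _ F ('D_(delta_mx 0 k) g : _ -> R^o)); [exact: dF|exact: dgk].
rewrite derive_sum; last first.
  move=> k; apply: derivableM; apply: diff_derivable; [exact: dFk|exact: dgF].
under eq_bigr => k _.
  rewrite (deriveM (diff_derivable (dFk x k j Ax)) (diff_derivable (dgF k))).
  rewrite (derive_chain (g := 'D_(delta_mx 0 k) g : _ -> R^o) _ (dF x Ax) (dgk x k Ax)).
  over.
rewrite big_split /= mxE; congr (_ + _).
  rewrite mxE; apply: eq_bigr => k _; rewrite [in RHS]mulrC; congr (_ * _).
    by rewrite mxE jacobianE ?mxE //; exact: dF.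
  rewrite deriveEjacobian; last exact: dF.
  rewrite -mulmxA -rowE mxE !mxE; apply: eq_bigr => l _.
  by rewrite !mxE.
rewrite summxE; apply: eq_bigr => k _; rewrite !mxE //.
Qed.
End Calculus.

(** * Second-order chain rules for Q and for the cotangent lift *)

Section SecondOrder.
Variable R : realType.

(** The second derivatives of T appear with coefficients [grad f - 'J F *m p], which vanish by the
    multiplier equation. Hence f'' - p F'' transforms as a quadratic form at such a point. *)
Lemma critical_hess_change n n' m (A : set 'rV[R]_n) (B : set 'rV[R]_n')
    (T : 'rV[R]_n -> 'rV[R]_n') (f : 'rV[R]_n' -> R^o) (F : 'rV[R]_n' -> 'rV[R]_m) (p : 'cV[R]_m) x :
  open A -> A x -> (forall y, A y -> B (T y)) ->
  smooth_map_on A T -> smooth_on B f -> smooth_map_on B F ->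
  grad f (T x) = 'J F (T x) *m p ->
  hess (fun y => f (T y)) x - \sum_k p k 0 *: hess (fun y => F (T y) 0 k) x =
  'J T x *m (hess f (T x) - \sum_k p k 0 *: hess (fun y => F y 0 k) (T x)) *m ('J T x)^T.
Proof.
move=> oA Ax AB Ts fs Fs crit.
rewrite (hess_chain oA Ax AB Ts fs).
under [X in _ - X]eq_bigr => k _.
  rewrite (hess_chain oA Ax AB Ts (Fs 0 k)) scalerDr.
  over.
rewrite big_split /= mulmxBr mulmxBl opprD addrACA.
have -> : \sum_k p k 0 *: \sum_k0 grad (fun y => F y 0 k) (T x) k0 0 *: hess (fun y => T y 0 k0) x =
     \sum_k0 grad f (T x) k0 0 *: hess (fun y => T y 0 k0) x.
  under eq_bigr do rewrite scaler_sumr.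
  rewrite exchange_big /=; apply: eq_bigr => l _.
  rewrite crit mxE scaler_suml; apply: eq_bigr => k _.
  rewrite scalerA jacobianE ?mxE ?[p k 0 * _]mulrC //.
  exact: smooth_map_diff Fs (AB _ Ax).
rewrite subrr addr0.
congr (_ - _); rewrite mulmx_sumr mulmx_suml; apply: eq_bigr => k _.
by rewrite -scalemxAr -scalemxAl.
Qed.

(** For a change of coordinates in the target the second derivatives of T survive, but only through
    the Jacobian of F; this becomes the correction D E D^T of Q. *)
Lemma covector_hess_change n m m' (A : set 'rV[R]_n) (B : set 'rV[R]_m)
    (F : 'rV[R]_n -> 'rV[R]_m) (T : 'rV[R]_m -> 'rV[R]_m') (p : 'cV[R]_m') x :
  open A -> A x -> (forall y, A y -> B (F y)) -> smooth_map_on A F -> smooth_map_on B T ->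
  \sum_k p k 0 *: hess (fun y => T (F y) 0 k) x =
  'J F x *m (\sum_k p k 0 *: hess (fun y => T y 0 k) (F x)) *m ('J F x)^T +
  \sum_k ('J T (F x) *m p) k 0 *: hess (fun y => F y 0 k) x.
Proof.
move=> oA Ax AB Fs Ts.
under eq_bigr => k _.
  rewrite (hess_chain oA Ax AB Fs (Ts 0 k)) scalerDr.
  over.
rewrite big_split /=; congr (_ + _).
  rewrite mulmx_sumr mulmx_suml; apply: eq_bigr => k _.
  by rewrite -scalemxAr -scalemxAl.
under eq_bigr do rewrite scaler_sumr.
rewrite exchange_big /=; apply: eq_bigr => l _.
rewrite mxE scaler_suml; apply: eq_bigr => k _.
rewrite scalerA jacobianE ?mxE ?[p k 0 * _]mulrC //.
exact: smooth_map_diff Ts (AB _ Ax).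
Qed.

Lemma mderiv_id k (z v : 'rV[R]_k) : mderiv (fun z : 'rV[R]_k => z) z v v.
Proof.
move=> i j; rewrite ord1.
have : derivable (fun z : 'rV[R]_k => z 0 j : R^o) z v by apply: diff_derivable; exact: differentiable_coord.
move=> d; apply: DeriveDef => //.
by rewrite -derive_entry // derive_id.
Qed.

Lemma mderiv_derive (V : normedModType R) k (F : V -> 'rV[R]_k) z v F' :
  mderiv F z v F' -> 'D_v F z = F'.
Proof.
move=> hF; apply/rowP => j; rewrite derive_mx ?mxE.
  exact: (@derive_val _ _ _ _ _ _ _ (hF 0 j)).
apply/derivable_mxP => i' j'; exact: (@ex_derive _ _ _ _ _ _ _ (hF i' j')).
Qed.

(** Local model of [ct_change]: h is the change of base coordinates and, in use, T its inverse,
    through whose Jacobian covectors are transported. *)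
Definition cotangent_lift m (h T : 'rV[R]_m -> 'rV[R]_m) (z : 'rV[R]_(m + m)) : 'rV[R]_(m + m) :=
  row_mx ('J T (h (rsubmx z)) *m (lsubmx z)^T)^T (h (rsubmx z)).

Lemma cotangent_lift_jacobian m (A B : set 'rV[R]_m) (h T : 'rV[R]_m -> 'rV[R]_m) z :
  open A -> A (rsubmx z) -> (forall y, A y -> B (h y)) ->
  smooth_map_on A h -> smooth_map_on B T ->
  differentiable (cotangent_lift h T) z /\
  'J (cotangent_lift h T) z =
    block_mx ('J T (h (rsubmx z)))^T 0
      ('J h (rsubmx z) *m \sum_k lsubmx z 0 k *: hess (fun y => T y 0 k) (h (rsubmx z)))
      ('J h (rsubmx z)).
Proof.
move=> oA Az AB hs Ts.
have dr : differentiable (fun z : 'rV[R]_(m + m) => rsubmx z) z by exact: differentiable_rsubmx.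
have dh : differentiable h (rsubmx z) by exact: smooth_map_diff hs Az.
have dT : differentiable T (h (rsubmx z)) by exact: smooth_map_diff Ts (AB _ Az).
have dhr : differentiable (fun z : 'rV[R]_(m + m) => h (rsubmx z)) z by exact: differentiable_comp.
(* The Jacobian written with partial derivatives, whose differentiability is part of smoothness; it
   agrees with ['J T] near the point. *)
pose K (y : 'rV[R]_m) : 'M[R]_m := \matrix_(i, k) 'D_(delta_mx 0 i) (fun y => T y 0 k : R^o) y.
have dK i k : differentiable (fun y => K y i k : R^o) (h (rsubmx z)).
  by under eq_fun do rewrite mxE; exact: (Ts 0 k [:: delta_mx 0 i] _ (AB _ Az)).
have dKh i k : differentiable (fun z : 'rV[R]_(m + m) => K (h (rsubmx z)) i k : R^o) z.
  exact: (@differentiable_comp _ _ _ _ (fun z : 'rV[R]_(m + m) => h (rsubmx z)) (fun y => K y i k : R^o)).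
pose H (z : 'rV[R]_(m + m)) : 'rV[R]_(m + m) :=
  row_mx (K (h (rsubmx z)) *m (lsubmx z)^T)^T (h (rsubmx z)).
have HE : \forall y \near z, H y = cotangent_lift h T y.
  have : nbhs z [set y : 'rV[R]_(m + m) | A (rsubmx y)].
    by apply: (differentiable_continuous dr); apply: open_nbhs_nbhs.
  apply: filterS => y Ay; rewrite /H /cotangent_lift /K -jacobianE //.
  exact: smooth_map_diff Ts (AB _ Ay).
have dH : differentiable H z.
  apply: differentiable_rV => j.
  rewrite -(splitK j); case: (fintype.split j) => l /=; rewrite /H.
    under eq_fun do rewrite row_mxEl mxE mxE.
    rewrite (_ : (fun y => _) = \sum_k ((fun y : 'rV[R]_(m + m) => K (h (rsubmx y)) l k) *
        (fun y : 'rV[R]_(m + m) => y 0 (lshift m k)) : _ -> R^o)); last first.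
      apply/funext => y; rewrite fct_sumE; apply: eq_bigr => k _.
      rewrite [RHS](_ : _ = K (h (rsubmx y)) l k * y 0 (lshift m k)) //; congr (_ * _).
      by rewrite [LHS]mxE [LHS]mxE.
    apply: differentiable_sum => k; apply: differentiableM; first exact: dKh.
    exact: differentiable_coord.
  by under eq_fun do rewrite row_mxEr; exact: differentiable_entry.
have dL : differentiable (cotangent_lift h T) z by exact: differentiable_near_eq HE dH.
split=> //; rewrite -(jacobian_near_eq HE dH).
set E := \sum_k _; set Jh := 'J h _; set JT := 'J T _.
suff DH v : 'D_v H z = v *m block_mx JT^T 0 (Jh *m E) Jh.
  by apply/row_matrixP => i; rewrite !rowE -deriveEjacobian // DH.
have hr : mderiv (fun z : 'rV[R]_(m + m) => rsubmx z) z v (rsubmx v) by exact/mderiv_rsub/mderiv_id.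
have hh : mderiv (fun z : 'rV[R]_(m + m) => h (rsubmx z)) z v (rsubmx v *m Jh).
  move=> i j; rewrite ord1.
  have dd : derivable (fun z : 'rV[R]_(m + m) => h (rsubmx z) 0 j : R^o) z v.
    by apply: diff_derivable; apply: differentiable_entry.
  apply: DeriveDef => //.
  rewrite (derive_chain (g := fun y => h y 0 j) v dr); last exact: differentiable_entry.
  rewrite (mderiv_derive hr) !mxE; apply: eq_bigr => l _; congr (_ * _).
  by rewrite /Jh jacobianE // !mxE.
pose K' : 'M[R]_m := \matrix_(i, k) \sum_l (rsubmx v *m Jh) 0 l * hess (fun y => T y 0 k) (h (rsubmx z)) l i.
have hK : mderiv (fun z : 'rV[R]_(m + m) => K (h (rsubmx z))) z v K'.
  move=> i k; apply: DeriveDef; first by apply: diff_derivable; exact: dKh.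
  rewrite (derive_chain (g := fun y => K y i k) v dhr (dK i k)) (mderiv_derive hh) !mxE.
  have Kik : (fun y => K y i k : R^o) = 'D_(delta_mx 0 i) (fun y => T y 0 k : R^o).
    by apply/funext => y; rewrite mxE.
  by rewrite Kik; apply: eq_bigr => l _; congr (_ * _); rewrite mxE [RHS]mxE.
have hl : mderiv (fun z : 'rV[R]_(m + m) => (lsubmx z)^T) z v (lsubmx v)^T.
  exact/mderivT/mderiv_lsub/mderiv_id.
have hP := mderivT (mderivM hK hl).
have KE : K (h (rsubmx z)) = JT by rewrite /JT jacobianE.
rewrite (mderiv_derive (F' := row_mx ((K' *m (lsubmx z)^T + K (h (rsubmx z)) *m (lsubmx v)^T)^T)
  (rsubmx v *m Jh))); last first.
  move=> i j; rewrite !ord1 -(splitK j); case: (fintype.split j) => l /=.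
    by rewrite row_mxEl; under eq_fun do rewrite /H row_mxEl; exact: hP.
  by rewrite row_mxEr; under eq_fun do rewrite /H row_mxEr; exact: hh.
rewrite -[v in RHS]hsubmxK mul_row_block mulmx0 add0r KE; congr row_mx.
rewrite linearD /= trmx_mul trmxK addrC trmx_mul trmxK; congr (_ + _).
rewrite mulmxA; set w := rsubmx v *m Jh.
apply/rowP => i; rewrite !mxE.
under eq_bigr do rewrite !mxE mulr_sumr.
rewrite exchange_big /=; apply: eq_bigr => l _.
rewrite /E summxE mulr_sumr; apply: eq_bigr => k _.
by rewrite !mxE mulrCA.
Qed.
End SecondOrder.

(** * Transition maps of the cotangent bundle *)

Section Charts.
Variable R : realType.

Lemma smooth_on_sub (V : normedModType R) (A B : set V) (f : V -> R) :
  A `<=` B -> smooth_on B f -> smooth_on A f.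
Proof. by move=> AB fs s x /AB; apply: fs. Qed.

Lemma chart_image_open n (X : topologicalType) (c : chart R n X) (O : set X) :
  is_chart c -> open O -> open (c @` (chart_dom c `&` O)).
Proof.
move=> [od oi cK _ ci] oO; move: ci; rewrite continuous_open_subspace // => ci.
have := (continuous_inP (chart_inv c) oi).1 ci _ oO.
congr open; apply/seteqP; split=> y.
  by move=> [[x dx <-] /=]; rewrite cK // => Ox; exists x.
by move=> [x [dx Ox] <-]; split; [exists x|rewrite /= cK].
Qed.

Section Manifold.
Variables (n : nat) (X : manifold R n).
Implicit Types c d e : chart R n X.

Definition trans c d : 'rV[R]_n -> 'rV[R]_n := d \o chart_inv c.

Lemma atlasK c x : atlas c -> chart_dom c x -> chart_inv c (c x) = x.
Proof. by move=> /atlas_chart[_ _ cK _ _]; apply: cK. Qed.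

Lemma atlas_dom_open c : atlas c -> open (chart_dom c).
Proof. by move=> /atlas_chart[]. Qed.

Definition overlap c d : set 'rV[R]_n := c @` (chart_dom c `&` chart_dom d).

Lemma overlap_open c d : atlas c -> atlas d -> open (overlap c d).
Proof. by move=> cA dA; apply: chart_image_open; [exact: atlas_chart|exact: atlas_dom_open]. Qed.

Lemma overlap_at x c d : charts_at x c -> charts_at x d -> overlap c d (c x).
Proof. by move=> [_ cx] [_ dx]; exists x. Qed.

Lemma overlap_trans c d y : atlas c -> overlap c d y -> overlap d c (trans c d y).
Proof. by move=> cA [x [cx dx] <-]; rewrite /trans /= atlasK //; exists x. Qed.

Lemma trans_at x c d : charts_at x c -> trans c d (c x) = d x.
Proof. by move=> [cA cx]; rewrite /trans /= atlasK. Qed.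

Lemma trans_smooth c d : atlas c -> atlas d -> smooth_map_on (overlap c d) (trans c d).
Proof. exact: atlas_compat. Qed.

Lemma trans_diff_on c d y : atlas c -> atlas d -> overlap c d y -> differentiable (trans c d) y.
Proof. by move=> cA dA; apply: smooth_map_diff; apply: trans_smooth. Qed.

Lemma trans_diff x c d : charts_at x c -> charts_at x d -> differentiable (trans c d) (c x).
Proof. by move=> cx dx; apply: trans_diff_on (overlap_at cx dx); [case: cx|case: dx]. Qed.

Lemma trans_jac_chain_on c d e y : atlas c -> atlas d -> atlas e ->
  overlap c d y -> overlap d e (trans c d y) ->
  'J (trans c e) y = 'J (trans c d) y *m 'J (trans d e) (trans c d y).
Proof.
move=> cA dA eA cdy dey; rewrite -jacobian_chain; [|exact: trans_diff_on|exact: trans_diff_on].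
have nb : \forall z \near y, trans d e (trans c d z) = trans c e z.
  have : nbhs y (overlap c d) by apply: open_nbhs_nbhs; split=> //; apply: overlap_open.
  by apply: filterS => z [x [cx dx] <-]; rewrite /trans /= !atlasK.
apply: esym; apply: jacobian_near_eq => //.
by apply: differentiable_comp; apply: trans_diff_on.
Qed.

Lemma trans_jac_chain x c d e : charts_at x c -> charts_at x d -> charts_at x e ->
  'J (trans c e) (c x) = 'J (trans c d) (c x) *m 'J (trans d e) (d x).
Proof.
move=> cx dx ex; rewrite -(trans_at d cx); have [cA _] := cx; have [dA _] := dx; have [eA _] := ex.
apply: trans_jac_chain_on => //; first exact: overlap_at.
by rewrite trans_at //; apply: overlap_at.
Qed.

Lemma jacobian_id m y : 'J (fun z : 'rV[R]_m => z) y = 1%:M.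
Proof.
apply/row_matrixP => i; rewrite !rowE mulmx1 -deriveEjacobian.
  by rewrite (mderiv_derive (@mderiv_id _ _ _ _)).
by apply: differentiable_rV => k; exact: differentiable_coord.
Qed.

Lemma trans_id_on c y : atlas c -> overlap c c y -> 'J (trans c c) y = 1%:M.
Proof.
move=> cA ccy; rewrite -[RHS](jacobian_id y); apply: jacobian_near_eq; last exact: trans_diff_on.
have : nbhs y (overlap c c) by apply: open_nbhs_nbhs; split=> //; apply: overlap_open.
by apply: filterS => z [x [cx _] <-]; rewrite /trans /= atlasK.
Qed.

Lemma overlap_refl c d y : overlap c d y -> overlap c c y.
Proof. by move=> [x [cx _] <-]; exists x. Qed.

Lemma trans_jac_inv_on c d y : atlas c -> atlas d -> overlap c d y ->
  'J (trans c d) y *m 'J (trans d c) (trans c d y) = 1%:M.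
Proof.
move=> cA dA cdy; rewrite -trans_jac_chain_on //; last exact: overlap_trans.
exact/trans_id_on/overlap_refl/cdy.
Qed.

Lemma trans_jac_inv x c d : charts_at x c -> charts_at x d ->
  'J (trans c d) (c x) *m 'J (trans d c) (d x) = 1%:M.
Proof.
move=> cx dx; rewrite -(trans_at d cx); apply: trans_jac_inv_on; last exact: overlap_at.
  by case: cx.
by case: dx.
Qed.

Lemma trans_hess_sym c d y k : atlas c -> atlas d -> overlap c d y ->
  (hess (fun y => trans c d y 0 k) y)^T = hess (fun y => trans c d y 0 k) y.
Proof.
move=> cA dA cdy; apply: (hess_sym (overlap_open cA dA) cdy).
exact: (trans_smooth cA dA 0 k).
Qed.

Lemma ct_change_lift d d' : ct_change d d' = cotangent_lift (trans d d') (trans d' d).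
Proof. by []. Qed.

Definition ct_jac d d' (lam : cotangent X) := 'J (ct_change d d') (ct_coord d lam).

(** The covector applied to the second derivative of the change of charts. It governs both the shear
    part of the derivative of [ct_change] and the change of Q under a change of target chart. *)
Definition ct_hess d d' (lam : cotangent X) : 'M[R]_n :=
  \sum_k ct_comp lam d k 0 *: hess (fun y => trans d' d y 0 k) (d' (ct_base lam)).

Lemma rsub_coord d (lam : cotangent X) : rsubmx (ct_coord d lam) = d (ct_base lam).
Proof. by rewrite /ct_coord row_mxKr. Qed.

Lemma lsub_coord d (lam : cotangent X) : lsubmx (ct_coord d lam) = (ct_comp lam d)^T.
Proof. by rewrite /ct_coord row_mxKl. Qed.

Lemma ct_jacE d d' (lam : cotangent X) :
  charts_at (ct_base lam) d -> charts_at (ct_base lam) d' ->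
  differentiable (ct_change d d') (ct_coord d lam) /\
  ct_jac d d' lam = block_mx ('J (trans d' d) (d' (ct_base lam)))^T 0
    ('J (trans d d') (d (ct_base lam)) *m ct_hess d d' lam)
    ('J (trans d d') (d (ct_base lam))).
Proof.
move=> dx d'x; have [dA _] := dx; have [d'A _] := d'x.
have := @cotangent_lift_jacobian R n (overlap d d') (overlap d' d) (trans d d') (trans d' d)
  (ct_coord d lam) (overlap_open dA d'A).
rewrite rsub_coord => /(_ (overlap_at dx d'x) (fun y => overlap_trans dA)).
move=> /(_ (trans_smooth dA d'A) (trans_smooth d'A dA)).
rewrite trans_at // /ct_jac ct_change_lift => -[? ->]; split=> //.
congr block_mx; congr (_ *m _); apply: eq_bigr => k _.
by rewrite lsub_coord mxE.
Qed.

Lemma ct_hess_sym d d' (lam : cotangent X) :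
  charts_at (ct_base lam) d -> charts_at (ct_base lam) d' ->
  (ct_hess d d' lam)^T = ct_hess d d' lam.
Proof.
move=> dx d'x; rewrite /ct_hess linear_sum /=; apply: eq_bigr => k _.
rewrite linearZ /= trans_hess_sym //; [by case: d'x|by case: dx|exact: overlap_at].
Qed.

Lemma ct_change_at x d d' z : charts_at x d -> rsubmx z = d x ->
  ct_change d d' z = row_mx ('J (trans d' d) (d' x) *m (lsubmx z)^T)^T (d' x).
Proof. by move=> dx E; rewrite ct_change_lift /cotangent_lift E trans_at. Qed.

Lemma ct_change_coord d d' (lam : cotangent X) :
  charts_at (ct_base lam) d -> charts_at (ct_base lam) d' ->
  ct_change d d' (ct_coord d lam) = ct_coord d' lam.
Proof.
move=> dx d'x; rewrite ct_change_lift /cotangent_lift rsub_coord lsub_coord trans_at //.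
by rewrite trmxK /ct_coord (ct_compat d'x dx).
Qed.

(** The chain rule for [ct_change]; the three changes of coordinates compose over the points of the
    base lying in all three chart domains. *)
Lemma ct_jac_chain d d' d'' (lam : cotangent X) :
  charts_at (ct_base lam) d -> charts_at (ct_base lam) d' -> charts_at (ct_base lam) d'' ->
  ct_jac d d'' lam = ct_jac d d' lam *m ct_jac d' d'' lam.
Proof.
move=> dx d'x d''x; have [df _] := ct_jacE dx d'x; have [df' _] := ct_jacE d'x d''x.
have [dA _] := dx; have [d'A _] := d'x; have [d''A _] := d''x.
have df'2 : differentiable (ct_change d' d'') (ct_change d d' (ct_coord d lam)).
  by rewrite ct_change_coord.
have E' := @jacobian_chain R (n + n) (n + n) (n + n) (ct_change d d') (ct_change d' d'') (ct_coord d lam) df df'2.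
have zE := ct_change_coord dx d'x.
rewrite zE in E'.
apply: (etrans _ E'); apply: jacobian_near_eq; last by case: (ct_jacE dx d''x).
have dr : {for ct_coord d lam, continuous (fun z : 'rV[R]_(n + n) => rsubmx z)}.
  by apply: differentiable_continuous; exact: differentiable_rsubmx.
have nb : nbhs (ct_coord d lam) [set z : 'rV[R]_(n + n) |
    (d @` (chart_dom d `&` (chart_dom d' `&` chart_dom d''))) (rsubmx z)].
  apply: dr; rewrite rsub_coord; apply: open_nbhs_nbhs; split.
    apply: chart_image_open; first exact: atlas_chart.
    by apply: openI; apply: atlas_dom_open.
  by exists (ct_base lam) => //; split; [case: dx|split; [case: d'x|case: d''x]].
apply: filterS nb => z [x [dxx [d'xx d''xx]] E].
have cx : charts_at x d by []. have cx' : charts_at x d' by []. have cx'' : charts_at x d'' by [].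
have E1 := ct_change_at d' cx (esym E); have E2 := ct_change_at d'' cx (esym E).
have E3 : rsubmx (ct_change d d' z) = d' x by rewrite E1 row_mxKr.
apply: (etrans E2); apply: (etrans _ (esym (ct_change_at d'' cx' E3))).
have E4 : (lsubmx (ct_change d d' z))^T = 'J (trans d' d) (d' x) *m (lsubmx z)^T.
  by rewrite E1 row_mxKl trmxK.
have E5 := trans_jac_chain cx'' cx' cx.
rewrite E4 E5; congr (row_mx _^T _); apply: esym; exact: mulmxA.
Qed.

Lemma symplectic_block (a b e : 'M[R]_n) : a *m e^T = 1%:M -> (b *m e^T)^T = b *m e^T ->
  block_mx a 0 b e *m Jmx R n *m (block_mx a 0 b e)^T = Jmx R n.
Proof.
move=> ae be; have ea : e *m a^T = 1%:M by rewrite -[LHS]trmxK trmx_mul trmxK ae trmx1.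
rewrite /Jmx tr_block_mx !mulmx_block !trmx0 !(mulmx0, mul0mx, addr0, add0r, mulmxN, mulNmx, mulmx1).
by rewrite ae ea -be trmx_mul trmxK addrC subrr.
Qed.

(** Jacobians of inverse transitions are inverse to each other, and the shear block is symmetric
    because mixed derivatives commute. *)
Lemma ct_jac_symplectic d d' (lam : cotangent X) :
  charts_at (ct_base lam) d -> charts_at (ct_base lam) d' ->
  ct_jac d d' lam *m Jmx R n *m (ct_jac d d' lam)^T = Jmx R n.
Proof.
move=> dx d'x; have [_ ->] := ct_jacE dx d'x; apply: symplectic_block.
  by rewrite -trmx_mul trans_jac_inv // trmx1.
by apply: sym_congr; apply: ct_hess_sym.
Qed.
End Manifold.
End Charts.

(** * The signature of the Hessian as an index function *)

Section SignatureBorder.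
Variable R : realType.

(** A basis as in [has_signature] is a basis of the kernel of D that diagonalizes Q, so
    [sg_restrict] fixes the value; diagonalizing Q on any basis of the kernel shows that one exists,
    hence the default value of [signature] is not taken. *)
Lemma signature_border n m (Q : 'M[R]_n) (D : 'M[R]_(n, m)) :
  Q^T = Q -> row_full D ->
  signature [set v : 'rV[R]_n | v *m D = 0] (fun v => (v *m Q *m v^T) 0 0) =
  sg (block_mx Q D D^T 0).
Proof.
move=> Qs Df; set K := [set v | _]; set f := fun v => _.
have dimK k (B : 'M[R]_(k, n)) : row_free B -> K = range (fun x : 'rV[R]_k => x *m B) ->
    (k + m = n)%N /\ B *m D = 0.
  move=> Bf KB.
  have BK : (B :=: kermx D)%MS.
    apply/eqmxP/andP; split; apply/rV_subP => v.
      move=> /submxP[x ->]; apply/sub_kermxP.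
      by have : K (x *m B) by rewrite KB; exists x.
    move=> /sub_kermxP vD; have : K v by [].
    by rewrite KB => -[x _ <-]; apply: submxMl.
  split; last by apply/sub_kermxP; rewrite BK.
  have := mxrank_ker D; rewrite -BK (eqP Bf) (eqP Df) => ->.
  by rewrite subnK // -(eqP Df) rank_leq_row.
have uniq s : has_signature K f s -> s = sg (block_mx Q D D^T 0).
  move=> [k [B [e [Bf KB fB ->]]]]; have [kmn BD] := dimK _ _ Bf KB.
  rewrite (sg_restrict Qs Df Bf BD kmn).
  have -> : B *m Q *m B^T = diag_mx (\row_i e i).
    apply: subr0_eq; apply: qform0_eq0.
      by rewrite linearB /= sym_congr // tr_diag_mx.
    move=> x; rewrite qformB -qform_mul qform_diag.
    have := fB x; rewrite /f /qform => ->; apply/eqP; rewrite subr_eq0; apply/eqP.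
    by apply: eq_bigr => i _; rewrite mxE.
  rewrite sg_diag sum_sgz; congr (_%:Z - _%:Z); apply: eq_card => i; rewrite !inE mxE //.
rewrite /signature; case: xgetP => [s _ /uniq //|none].
exfalso.
pose B0 := row_base (kermx D).
have Bf : row_free B0 by exact: row_base_free.
have [k [P [e [Pf Pfull PB _]]]] := sgP (sym_congr B0 Qs).
apply: (none (sg (block_mx Q D D^T 0))).
have H : has_signature K f (#|[pred i | 0 < e 0 i]|%:Z - #|[pred i | e 0 i < 0]|%:Z).
  exists k, (P *m B0), (fun i => e 0 i); split=> //.
  - by rewrite /row_free mxrankMfree // (eqP Pf).
  - apply/seteqP; split=> v.
      move=> vD; have /submxP[x ->] : (v <= B0)%MS by rewrite eq_row_base; apply/sub_kermxP.
      have /submxP[y ->] : (x <= P)%MS by apply: submx_full.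
      by exists y; rewrite ?mulmxA.
    move=> [x _ <-]; rewrite /K /= -mulmxA -mulmxA.
    have -> : B0 *m D = 0 by apply/sub_kermxP; rewrite eq_row_base.
    by rewrite !mulmx0.
  - move=> x; rewrite /f -/(qform Q (x *m (P *m B0))) qform_mul.
    by rewrite -qform_diag -PB trmx_mul !mulmxA.
by rewrite -(uniq _ H).
Qed.
End SignatureBorder.

(** * The tangent space as a graph over a chart *)

Section TangentFrame.
Variables (R : realType) (n m : nat) (Q : 'M[R]_n) (D : 'M[R]_(n, m)).

Definition tangent_set : set 'rV[R]_(m + m) :=
  [set z | exists2 du : 'rV[R]_n, du *m D = rsubmx z & Q *m du^T = D *m (lsubmx z)^T].

(** With x = p - q S the equation Q du^T = D p^T becomes G du^T = D x^T. Thus x is a free parameter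
    that determines du, and q = du D = x T. *)
Lemma tangent_frame (S : 'M[R]_m) : Q^T = Q -> S^T = S -> Q - D *m S *m D^T \in unitmx ->
  let T := D^T *m invmx (Q - D *m S *m D^T) *m D in
  T^T = T /\ tangent_set = row_span (shear_frame S T).
Proof.
move=> Qs Ss; set G := Q - _ => Gu T.
have Gs : G^T = G by rewrite /G linearB /= Qs sym_congr.
have iGs : (invmx G)^T = invmx G by rewrite trmx_inv Gs.
have Ts : T^T = T by rewrite /T -{2 4}[D]trmxK sym_congr.
have QG : Q = G + D *m S *m D^T by rewrite /G subrK.
split=> //; apply/seteqP; split=> z.
  move=> [du duD Qdu]; pose x := lsubmx z - rsubmx z *m S.
  have Gdu : G *m du^T = D *m x^T.
    rewrite /G mulmxBl Qdu -(mulmxA (D *m S)) -trmx_mul duD -(mulmxA D S) -mulmxBr /x.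
    by congr (_ *m _); rewrite linearB /= trmx_mul Ss.
  have duE : du = x *m D^T *m invmx G.
    apply: trmx_inj; rewrite !trmx_mul trmxK iGs; apply: (can_inj (mulKmx Gu)).
    by rewrite Gdu mulKVmx.
  have zq : rsubmx z = x *m T by rewrite -duD duE /T !mulmxA.
  exists x => //; rewrite /shear_frame mul_mx_row mulmxDr mulmx1 mulmxA -zq.
  by rewrite /x subrK hsubmxK.
move=> [x _ <-]; exists (x *m D^T *m invmx G).
  by rewrite /shear_frame mul_mx_row row_mxKr /T !mulmxA.
rewrite /shear_frame mul_mx_row row_mxKl {1}QG !trmx_mul trmxK iGs mulmxDl mulKVmx //.
rewrite -(mulmxA (D *m S)) -(mulmxA D S).
have -> : D^T *m (invmx G *m (D *m x^T)) = T *m x^T by rewrite /T !mulmxA.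
rewrite -mulmxDr; congr (D *m _).
by rewrite linearD /= trmx1 trmx_mul Ts Ss mulmxDl mul1mx mulmxA.
Qed.

(** A scalar matrix S suffices: one of the m + 1 matrices Q - i D D^T is invertible, by the pencil
    lemma, since no nonzero vector is killed by both Q and D. *)
Lemma exists_tangent_chart : Q^T = Q ->
  (forall v : 'rV_n, v *m Q = 0 -> v *m D = 0 -> v = 0) ->
  exists2 S : 'M[R]_m, S^T = S & Q - D *m S *m D^T \in unitmx.
Proof.
move=> Qs QD.
have [||||i Hi] := @exists_unit_pencil R n m Q (D *m D^T) 1%:M D _ _ _ (@natr_inj_ord R m.+1).
- by rewrite trmx1 mulmx1.
- by rewrite trmx1 mulmx1.
- by move=> v vD; rewrite mulmxA vD mul0mx.
- exact: QD.
exists (i%:R)%:M; first by rewrite tr_scalar_mx.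
by rewrite mul_mx_scalar -scalemxAl.
Qed.
End TangentFrame.

(** * Dependence on the charts of U and M *)

Section MorseCharts.
Variables (R : realType) (n m : nat) (U : manifold R n) (M : manifold R m).
Variables (phi : U -> R) (Phi : U -> M).
Hypothesis phi_smooth : smooth_fun phi.
Hypothesis Phi_submersion : submersion Phi.
Hypothesis phi_Phi_morse : morse_problem phi Phi.

Let Phi_cont : continuous Phi := Phi_submersion.1.1.

Definition rep (c : chart R n U) (d : chart R m M) : 'rV[R]_n -> 'rV[R]_m :=
  d \o Phi \o chart_inv c.
Definition rep_dom (c : chart R n U) (d : chart R m M) : set 'rV[R]_n :=
  c @` (chart_dom c `&` Phi @^-1` chart_dom d).

Lemma rep_smooth c d : atlas c -> atlas d -> smooth_map_on (rep_dom c d) (rep c d).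
Proof. by move=> cA dA; exact: Phi_submersion.1.2. Qed.

Lemma rep_open c d : atlas c -> atlas d -> open (rep_dom c d).
Proof.
move=> cA dA; apply: chart_image_open; first exact: atlas_chart.
by apply: open_comp => [x _|]; [exact: Phi_cont|exact: atlas_dom_open].
Qed.

Lemma phi_smooth_rep c d : atlas c -> smooth_on (rep_dom c d) (phi \o chart_inv c : _ -> R^o).
Proof.
move=> cA; apply: smooth_on_sub (phi_smooth cA) => y [x [cx _] <-]; by exists x.
Qed.

Lemma dmap_row_full c d u : charts_at u c -> charts_at (Phi u) d -> row_full (dmap Phi c d u).
Proof. exact: Phi_submersion.2. Qed.

Section Point.
Variables (u : U) (lam : cotangent M).
Hypothesis Lx : lagrange_points phi Phi (u, lam).
Let base : ct_base lam = Phi u := Lx.1.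

Lemma Qmx_sym c d : charts_at u c -> charts_at (Phi u) d ->
  (Qmx phi Phi c d (u, lam))^T = Qmx phi Phi c d (u, lam).
Proof.
move=> [cA cu] [dA du]; have yD : rep_dom c d (c u) by exists u.
have oD := rep_open cA dA.
rewrite /Qmx linearB linear_sum /= (hess_sym oD yD (phi_smooth_rep cA)); congr (_ - _).
apply: eq_bigr => k _; rewrite linearZ /=; congr (_ *: _).
exact: (hess_sym oD yD (rep_smooth cA dA 0 k)).
Qed.

Lemma chart_change_left c c' d : charts_at u c -> charts_at u c' -> charts_at (Phi u) d ->
  dmap Phi c d u = 'J (trans c c') (c u) *m dmap Phi c' d u /\
  Qmx phi Phi c d (u, lam) =
    'J (trans c c') (c u) *m Qmx phi Phi c' d (u, lam) *m ('J (trans c c') (c u))^T.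
Proof.
move=> cu c'u du; have [cA cx] := cu; have [c'A c'x] := c'u; have [dA dx] := du.
pose A : set 'rV[R]_n := c @` (chart_dom c `&` (chart_dom c' `&` Phi @^-1` chart_dom d)).
have oA : open A.
  apply: chart_image_open; first exact: atlas_chart.
  apply: openI; first exact: atlas_dom_open.
  by apply: open_comp => [x _|]; [exact: Phi_cont|exact: atlas_dom_open].
have Ay : A (c u) by exists u.
have nA : nbhs (c u) A by apply: open_nbhs_nbhs.
have AB y : A y -> rep_dom c' d (trans c c' y).
  by move=> [x [xc [xc' xd]] <-]; rewrite /trans /= atlasK //; exists x.
have Ts : smooth_map_on A (trans c c').
  move=> i j; apply: smooth_on_sub (trans_smooth cA c'A i j).
  by move=> y [x [xc [xc' _]] <-]; exists x.
have Tu : trans c c' (c u) = c' u by exact: trans_at.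
have frep : \forall y \near c u, (phi \o chart_inv c') (trans c c' y) = (phi \o chart_inv c) y.
  by apply: filterS nA => y [x [xc [xc' xd]] <-]; rewrite /trans /= !atlasK.
have Frep : \forall y \near c u, rep c' d (trans c c' y) = rep c d y.
  by apply: filterS nA => y [x [xc [xc' xd]] <-]; rewrite /rep /trans /= !atlasK.
have Frepk k : \forall y \near c u, rep c' d (trans c c' y) 0 k = rep c d y 0 k.
  by apply: filterS Frep => y ->.
have dT : differentiable (trans c c') (c u) by exact: trans_diff.
have dF : differentiable (rep c' d) (trans c c' (c u)).
  by apply: smooth_map_diff (rep_smooth c'A dA) _; apply: AB.
split.
  have := jacobian_chain dT dF; rewrite Tu => <-.
  by apply: esym; apply: jacobian_near_eq Frep _; exact: differentiable_comp.
have crit : grad (phi \o chart_inv c' : _ -> R^o) (trans c c' (c u)) =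
    'J (rep c' d) (trans c c' (c u)) *m ct_comp lam d.
  by rewrite Tu; apply: Lx.2.
have E := critical_hess_change oA Ay AB Ts (phi_smooth_rep c'A) (rep_smooth c'A dA) crit.
have Q1 := hess_near_eq frep.
have Q2 : \sum_k ct_comp lam d k 0 *: hess (fun y => rep c' d (trans c c' y) 0 k) (c u) =
    \sum_k ct_comp lam d k 0 *: hess (fun y => rep c d y 0 k) (c u).
  apply: eq_bigr => k _; have H := hess_near_eq (Frepk k).
  exact: (congr1 (fun X : 'M[R]_n => ct_comp lam d k 0 *: X) H).
rewrite Tu in E.
exact: (etrans (esym (congr2 (fun a b : 'M[R]_n => a - b) Q1 Q2)) E).
Qed.

Lemma chart_change_left_ex c c' d : charts_at u c -> charts_at u c' -> charts_at (Phi u) d ->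
  exists N, [/\ N \in unitmx, dmap Phi c d u = N *m dmap Phi c' d u &
    Qmx phi Phi c d (u, lam) = N *m Qmx phi Phi c' d (u, lam) *m N^T].
Proof.
move=> cu c'u du; have [D' Q'] := chart_change_left cu c'u du.
exists ('J (trans c c') (c u)); split=> //.
by have [h _] := mulmx1_unit (trans_jac_inv cu c'u); exact: h.
Qed.

(** Q is not invariant under a change of the target chart. Its correction vanishes on the kernel of
    the differential, which protects the Hessian, and is absorbed by the shear part of [ct_jac] in
    the tangent space. *)
Lemma chart_change_right c d d' : charts_at u c -> charts_at (Phi u) d -> charts_at (Phi u) d' ->
  dmap Phi c d u = dmap Phi c d' u *m 'J (trans d' d) (d' (Phi u)) /\
  Qmx phi Phi c d (u, lam) = Qmx phi Phi c d' (u, lam) -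
    dmap Phi c d' u *m ct_hess d d' lam *m (dmap Phi c d' u)^T.
Proof.
move=> cu du d'u; have [cA cx] := cu; have [d'A d'x] := d'u; have [dA dx] := du.
pose A : set 'rV[R]_n := c @` (chart_dom c `&` (Phi @^-1` (chart_dom d `&` chart_dom d'))).
have oA : open A.
  apply: chart_image_open; first exact: atlas_chart.
  apply: open_comp => [x _|]; first exact: Phi_cont.
  by apply: openI; exact: atlas_dom_open.
have Ay : A (c u) by exists u.
have nA : nbhs (c u) A by apply: open_nbhs_nbhs.
have AB y : A y -> overlap d' d (rep c d' y).
  by move=> [x [xc [xd xd']] <-]; rewrite /rep /= atlasK //; exists (Phi x).
have Fs : smooth_map_on A (rep c d').
  move=> i j; apply: smooth_on_sub (rep_smooth cA d'A i j).
  by move=> y [x [xc [_ xd]] <-]; exists x.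
have Fu : rep c d' (c u) = d' (Phi u) by rewrite /rep /= atlasK.
have Frep : \forall y \near c u, trans d' d (rep c d' y) = rep c d y.
  by apply: filterS nA => y [x [xc [xd xd']] <-]; rewrite /rep /trans /= !atlasK.
have Frepk k : \forall y \near c u, trans d' d (rep c d' y) 0 k = rep c d y 0 k.
  by apply: filterS Frep => y ->.
have dF : differentiable (rep c d') (c u) by exact: smooth_map_diff Fs Ay.
have dT : differentiable (trans d' d) (rep c d' (c u)) by rewrite Fu; exact: trans_diff.
split.
  have := jacobian_chain dF dT; rewrite Fu => <-.
  by apply: esym; apply: jacobian_near_eq Frep _; exact: differentiable_comp.
have E := covector_hess_change (ct_comp lam d) oA Ay AB Fs (trans_smooth d'A dA).
have p' : 'J (trans d' d) (rep c d' (c u)) *m ct_comp lam d = ct_comp lam d'.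
  by rewrite Fu; have := @ct_compat _ _ _ lam d' d; rewrite base => ->.
have Q2 : \sum_k ct_comp lam d k 0 *: hess (fun y => trans d' d (rep c d' y) 0 k) (c u) =
   \sum_k ct_comp lam d k 0 *: hess (fun y => rep c d y 0 k) (c u).
  apply: eq_bigr => k _; have H := hess_near_eq (Frepk k).
  exact: (congr1 (fun X : 'M[R]_n => ct_comp lam d k 0 *: X) H).
rewrite p' Fu in E.
have E2 := etrans (esym Q2) E.
apply: (etrans (congr1 (fun X : 'M[R]_n => hess (phi \o chart_inv c) (c u) - X) E2)).
by rewrite opprD addrA addrAC /ct_hess base.
Qed.

Lemma chart_change_right_ex c d d' : charts_at u c -> charts_at (Phi u) d -> charts_at (Phi u) d' ->
  exists J E, [/\ J \in unitmx, E^T = E, dmap Phi c d u = dmap Phi c d' u *m J &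
    Qmx phi Phi c d (u, lam) = Qmx phi Phi c d' (u, lam) - dmap Phi c d' u *m E *m (dmap Phi c d' u)^T].
Proof.
move=> cu dx d'x; have [D' Q'] := chart_change_right cu dx d'x.
exists ('J (trans d' d) (d' (Phi u))), (ct_hess d d' lam); split=> //.
  by have [h _] := mulmx1_unit (trans_jac_inv d'x dx); exact: h.
by apply: ct_hess_sym; rewrite base.
Qed.

(** Such a v is orthogonal to the image of the differential in the Morse condition, which is
    everything. *)
Lemma kernel_morse c d (v : 'rV[R]_n) : charts_at u c -> charts_at (Phi u) d ->
  v *m Qmx phi Phi c d (u, lam) = 0 -> v *m dmap Phi c d u = 0 -> v = 0.
Proof.
move=> cu dx vQ vD; apply/rowP => i; rewrite [RHS]mxE.
have [du [dp E]] := phi_Phi_morse Lx cu dx (delta_mx i 0).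
have : v *m delta_mx i (0 : 'I_1) = 0.
  by rewrite -E mulmxBr !mulmxA vQ vD !mul0mx subr0.
by rewrite -colE => /matrixP/(_ 0 0); rewrite !mxE.
Qed.

Lemma lag_tangentE c d : charts_at u c -> charts_at (Phi u) d ->
  lag_tangent phi Phi d (u, lam) =
  tangent_set (Qmx phi Phi c d (u, lam)) (dmap Phi c d u).
Proof.
move=> cu dx; apply/seteqP; split=> z.
  move=> [c' [du' [/= c'u E1 E2]]].
  have [N [Nu D' Q']] := chart_change_left_ex c'u cu dx.
  exists (du' *m N); first by rewrite -mulmxA -D'.
  apply: (can_inj (mulKmx Nu)); rewrite [RHS]mulmxA -D' -E2 Q' trmx_mul !mulmxA //.
by move=> [du' E1 E2]; exists c, du'.
Qed.

(** The term [K *m E] adds q K E to the fibre coordinates; as q K = du D', this is exactly what the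
    correction of Q asks for. *)
Lemma tangent_set_change (Q Q' : 'M[R]_n) (D D' : 'M[R]_(n, m)) (E J K : 'M[R]_m) z :
  D = D' *m J -> Q = Q' - D' *m E *m D'^T -> E^T = E -> J *m K = 1%:M ->
  tangent_set Q D z -> tangent_set Q' D' (z *m block_mx J^T 0 (K *m E) K).
Proof.
move=> DE Q'E Es JK [du E1 E2]; exists du.
all: rewrite -[z]hsubmxK mul_row_block mulmx0 add0r ?row_mxKl ?row_mxKr.
  by rewrite -E1 DE -!mulmxA JK mulmx1.
have zq : rsubmx z *m K = du *m D' by rewrite -E1 DE -!mulmxA JK mulmx1.
have -> : Q' = Q + D' *m E *m D'^T by rewrite Q'E subrK.
rewrite mulmxDl E2 mulmxA zq DE linearD /= mulmxDr !trmx_mul trmxK Es !mulmxA //.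
Qed.

Lemma lag_tangent_change d d' z : charts_at (Phi u) d -> charts_at (Phi u) d' ->
  lag_tangent phi Phi d (u, lam) z -> lag_tangent phi Phi d' (u, lam) (z *m ct_jac d d' lam).
Proof.
move=> dx d'x; have [c cA cu] := atlas_cover u; have c_u : charts_at u c by [].
rewrite (lag_tangentE c_u dx) (lag_tangentE c_u d'x).
have [D' Q'] := chart_change_right c_u dx d'x.
have := @ct_jacE _ _ _ d d' lam; rewrite base => /(_ dx d'x)[_ ->].
apply: (tangent_set_change D' Q').
  by apply: ct_hess_sym; rewrite base.
exact: trans_jac_inv.
Qed.

Lemma sgn_hess_border c d : charts_at u c -> charts_at (Phi u) d ->
  sgn_hess phi Phi c d (u, lam) =
  sg (block_mx (Qmx phi Phi c d (u, lam)) (dmap Phi c d u) (dmap Phi c d u)^T 0).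
Proof.
by move=> cu du; exact: (signature_border (Qmx_sym cu du) (dmap_row_full cu du)).
Qed.

(** Both changes of charts act on the bordered matrix by congruence: N on the coordinates of U, and
    J^T on the border coordinates. *)
Lemma sgn_hess_charts c d c' d' : charts_at u c -> charts_at (Phi u) d ->
  charts_at u c' -> charts_at (Phi u) d' ->
  sgn_hess phi Phi c d (u, lam) = sgn_hess phi Phi c' d' (u, lam).
Proof.
move=> cu dx c'u d'x; apply: (etrans (sgn_hess_border cu dx)).
apply: (etrans _ (esym (sgn_hess_border c'u d'x))).
have z0 : (0 : 'M[R]_m)^T = 0 by rewrite trmx0.
transitivity (sg (block_mx (Qmx phi Phi c' d (u, lam)) (dmap Phi c' d u) (dmap Phi c' d u)^T 0)).
  have [N [Nu -> ->]] := chart_change_left_ex cu c'u dx.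
  have Qs := Qmx_sym c'u dx; move: (dmap _ _ _ _) (Qmx _ _ _ _ _) Qs => D Q Qs.
  have Pu : block_mx N 0 0 1%:M \in @unitmx R (n + m).
    by rewrite unitmxE det_ublock det1 mulr1 -unitmxE.
  rewrite -[RHS](sg_unit_congr (sym_block _ Qs z0) Pu).
  rewrite tr_block_mx !mulmx_block !trmx0 !trmx1 trmx_mul.
  by rewrite !(mulmx0, mul0mx, addr0, add0r, mulmx1, mul1mx).
have [J [E [Ju hs -> ->]]] := chart_change_right_ex c'u dx d'x.
have Qs := Qmx_sym c'u d'x.
move: (dmap _ _ _ _) (Qmx _ _ _ _ _) Qs => D Q Qs.
(* Each off-diagonal block contributes one half of the correction -D E D^T. *)
pose X := - 2^-1 *: (D *m E).
have Pu : block_mx 1%:M X 0 J^T \in @unitmx R (n + m).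
  by rewrite unitmxE det_ublock det1 mul1r -unitmxE unitmx_tr.
rewrite -[RHS](sg_unit_congr (sym_block _ Qs z0) Pu).
rewrite tr_block_mx !mulmx_block !trmx0 !trmx1 !trmxK trmx_mul.
rewrite !(mulmx0, mul0mx, addr0, add0r, mulmx1, mul1mx).
suff -> : Q + X *m D^T + D *m X^T = Q - D *m E *m D^T by [].
rewrite /X -scalemxAl linearZ /= -scalemxAr trmx_mul hs mulmxA.
by apply/matrixP => i j; rewrite !mxE; lra.
Qed.
End Point.
End MorseCharts.

(** * Continuity along the curve and symplectic block matrices *)

Section CurveContinuity.
Variable R : realType.

Lemma seg_itv (a b : R) : [set t : R | a <= t <= b] = `[a, b]%classic.
Proof. by apply/seteqP; split=> x; rewrite /= in_itv. Qed.

Lemma mcvg_jacobian T (F : set_system T) (FF : Filter F) n m (A : set 'rV[R]_n)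
    (G : 'rV[R]_n -> 'rV[R]_m) (y : T -> 'rV[R]_n) y0 :
  open A -> A y0 -> smooth_map_on A G -> y @ F --> y0 ->
  mcvg F (fun t => 'J G (y t)) ('J G y0).
Proof.
move=> oA Ay Gs yc.
have nA : \forall t \near F, A (y t) by apply: yc; apply: open_nbhs_nbhs.
pose K (z : 'rV[R]_n) : 'M[R]_(n, m) := \matrix_(i, k) 'D_(delta_mx 0 i) (fun y => G y 0 k : R^o) z.
have KE z : A z -> K z = 'J G z by move=> Az; rewrite jacobianE //; exact: smooth_map_diff Gs Az.
apply: (@mcvg_near_eq _ _ _ _ _ _ (fun t => K (y t))).
  by apply: filterS nA => t At; apply: KE.
rewrite -KE // => i k; rewrite mxE; under eq_fun do rewrite mxE.
have d : differentiable ('D_(delta_mx 0 i) (fun y => G y 0 k : R^o) : _ -> R^o) y0 :=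
  Gs 0 k [:: delta_mx 0 i] y0 Ay.
exact: (cvg_comp _ _ yc (differentiable_continuous d)).
Qed.

Lemma mcvg_hess T (F : set_system T) (FF : Filter F) n (A : set 'rV[R]_n)
    (g : 'rV[R]_n -> R^o) (y : T -> 'rV[R]_n) y0 :
  A y0 -> smooth_on A g -> y @ F --> y0 ->
  mcvg F (fun t => hess g (y t)) (hess g y0).
Proof.
move=> Ay gs yc i j.
have hE z : hess g z i j = 'D_(delta_mx 0 i) ('D_(delta_mx 0 j) g) z by rewrite mxE.
have d : differentiable ('D_(delta_mx 0 i) ('D_(delta_mx 0 j) g) : _ -> R^o) y0 :=
  gs [:: delta_mx 0 i; delta_mx 0 j] y0 Ay.
have c := cvg_comp _ _ yc (differentiable_continuous d).
have c' : 'D_(delta_mx 0 i) ('D_(delta_mx 0 j) g) (y t) @[t --> F] --> (hess g y0 i j : R^o).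
  by rewrite hE; exact: c.
by apply: cvg_trans c'; apply: near_eq_cvg; apply: nearW => t; exact: (esym (hE (y t))).
Qed.

Lemma mcvg_sum T (F : set_system T) (FF : Filter F) k l n (f : 'I_n -> T -> 'M[R]_(k, l)) a :
  (forall i, mcvg F (f i) (a i)) -> mcvg F (fun t => \sum_i f i t) (\sum_i a i).
Proof.
move=> fa i j; rewrite summxE; under eq_fun do rewrite summxE.
by apply: cvg_sum => h _; exact: fa.
Qed.

Lemma chart_continuous n (X : manifold R n) (c : chart R n X) x :
  charts_at x c -> c @ nbhs x --> c x.
Proof.
move=> [cA cx]; have [od _ _ cc _] := atlas_chart cA.
move: cc; rewrite continuous_open_subspace // => /(_ x).
by rewrite inE => /(_ cx).
Qed.

Section Trivialized.
Variables (n m : nat).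

(** The trivialization carries the chart centred at e S e^T - b e^T to the chart centred at S, and
    the coordinate T0 to e^T T0 e. The latter is a congruence, so the signature is unchanged. *)
Lemma tangent_set_trivialized (Q : 'M[R]_n) (D : 'M[R]_(n, m)) (a b e S : 'M[R]_m) :
  Q^T = Q -> S^T = S -> a *m e^T = 1%:M -> (b *m e^T)^T = b *m e^T ->
  let G := Q - D *m (e *m S *m e^T - b *m e^T) *m D^T in
  let T := e^T *m (D^T *m invmx G *m D) *m e in
  G \in unitmx ->
  [/\ T^T = T, sg T = sg (D^T *m invmx G *m D) &
    (fun z => z *m block_mx a 0 b e) @` tangent_set Q D = row_span (shear_frame S T)].
Proof.
move=> Qs Ss ae be; set S0 := e *m S *m e^T - b *m e^T => G T Gu.
have ea : e^T *m a = 1%:M by apply: mulmx1C.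
have [_ eTu] := mulmx1_unit ae; have [_ au] := mulmx1_unit ea.
have S0s : S0^T = S0 by rewrite /S0 linearB /= be sym_congr.
have [T0s ->] := tangent_frame Qs S0s Gu; rewrite /T; set T0 := _ *m D in T0s *.
have eE : e = (e^T)^T by rewrite trmxK.
split.
- by rewrite {2 4}eE sym_congr.
- by rewrite {2}eE sg_unit_congr.
rewrite -(row_span_mul (shear_frame S _) au).
have -> : a *m shear_frame S (e^T *m T0 *m e) = shear_frame S0 T0 *m block_mx a 0 b e.
  rewrite /shear_frame mul_mx_row mul_row_block mulmx0 add0r; congr row_mx.
    rewrite mulmxDr mulmxDl mulmx1 mul1mx -addrA; congr (_ + _).
    rewrite !mulmxA ae mul1mx -!(mulmxA T0) -mulmxDr; congr (T0 *m _).
    by rewrite /S0 mulmxBl -!mulmxA ea !mulmx1 subrK.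
  by rewrite !mulmxA ae mul1mx.
apply/seteqP; split=> w.
  by move=> [z [x _ <-] <-]; exists x; rewrite ?mulmxA.
by move=> [x _ <-]; exists (x *m shear_frame S0 T0); [exists x|rewrite mulmxA].
Qed.

(** Preserving the vertical subspace kills the upper right block; the remaining identities are read
    off from the blocks of A J A^T = J. *)
Lemma symplectic_vertical (A : 'M[R]_(m + m)) :
  A *m Jmx R m *m A^T = Jmx R m -> (forall v, vertical v -> vertical (v *m A)) ->
  exists a b e, [/\ A = block_mx a 0 b e, a *m e^T = 1%:M & (b *m e^T)^T = b *m e^T].
Proof.
move=> AJ Av; exists (ulsubmx A), (dlsubmx A), (drsubmx A).
have ur0 : ursubmx A = 0.
  apply/row_matrixP => i; rewrite row0 rowE.
  have : vertical (row_mx (delta_mx 0 i) (0 : 'rV[R]_m)) by rewrite /vertical /= row_mxKr.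
  move=> /Av; rewrite /vertical /= -{1}[A]submxK mul_row_block row_mxKr mul0mx addr0 //.
have AE : A = block_mx (ulsubmx A) 0 (dlsubmx A) (drsubmx A) by rewrite -ur0 submxK.
split=> //; move: AJ; rewrite {1 2}AE /Jmx tr_block_mx !mulmx_block !trmx0;
  rewrite !(mulmx0, mul0mx, addr0, add0r, mulmxN, mulNmx, mulmx1) => /eq_block_mx[_ h1 _ h2] //.
by rewrite trmx_mul trmxK; move/eqP: h2; rewrite addrC subr_eq0 => /eqP ->.
Qed.

Lemma symplectic_forms (A : 'M[R]_(m + m)) :
  (forall v w, sympl (v *m A) (w *m A) = sympl v w) <-> A *m Jmx R m *m A^T = Jmx R m.
Proof.
split=> [h|AJ v w]; last by rewrite !symplE trmx_mul !mulmxA -(mulmxA v) -(mulmxA v) AJ.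
apply: subr0_eq; apply: mx_eq0_form => x y.
rewrite mulmxBr mulmxBl mxDE [X in _ + X]mxE -[X in _ - X]symplE -h symplE.
by rewrite trmx_mul !mulmxA subrr.
Qed.

Lemma symplectic_unit (A : 'M[R]_(m + m)) : A *m Jmx R m *m A^T = Jmx R m -> A \in unitmx.
Proof.
move=> AJ; have : A *m Jmx R m *m A^T \in unitmx by rewrite AJ Jmx_unit.
by rewrite !unitmx_mul => /andP[/andP[]].
Qed.

Lemma symplectic_inv (A : 'M[R]_(m + m)) :
  A *m Jmx R m *m A^T = Jmx R m -> invmx A *m Jmx R m *m (invmx A)^T = Jmx R m.
Proof.
move=> AJ; have Au := symplectic_unit AJ.
rewrite -{1}AJ trmx_inv !mulmxA mulVmx // mul1mx mulmxK // unitmx_tr //.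
Qed.

Lemma symplectic_mul (A B : 'M[R]_(m + m)) : A *m Jmx R m *m A^T = Jmx R m ->
  B *m Jmx R m *m B^T = Jmx R m -> (A *m B) *m Jmx R m *m (A *m B)^T = Jmx R m.
Proof.
move=> AJ BJ; rewrite trmx_mul !mulmxA -(mulmxA A B) -(mulmxA A (B *m _)) BJ //.
Qed.

Lemma lagframe_mul (F : 'M[R]_(m, m + m)) (B : 'M[R]_(m + m)) :
  B *m Jmx R m *m B^T = Jmx R m -> lagframe F -> lagframe (F *m B).
Proof.
move=> BJ [Ff FJ]; split.
  by rewrite /row_free mxrankMfree // row_free_unit symplectic_unit.
by rewrite trmx_mul !mulmxA -(mulmxA F) -(mulmxA F) BJ.
Qed.

Lemma image_row_span (F : 'M[R]_(m, m + m)) (B : 'M[R]_(m + m)) :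
  (fun v => v *m B) @` row_span F = row_span (F *m B).
Proof.
apply/seteqP; split=> w.
  by move=> [_ [x _ <-] <-]; exists x; rewrite ?mulmxA.
by move=> [x _ <-]; exists (x *m F); [exists x|rewrite mulmxA].
Qed.

Lemma lag_continuous_mul (X : topologicalType) (Dm : set X) Lam (B : 'M[R]_(m + m)) :
  B *m Jmx R m *m B^T = Jmx R m -> lag_continuous Dm Lam ->
  lag_continuous Dm (fun x => (fun v : 'rV[R]_(m + m) => v *m B) @` Lam x).
Proof.
move=> BJ Lc x Dx; have [Lx [N [F [Nx Fc LF]]]] := Lc x Dx; split.
  have xN := nbhs_singleton Nx.
  rewrite (LF x xN Dx) image_row_span; apply/lagframeP; apply: lagframe_mul => //.
  by apply/lagframeP; rewrite -LF.
exists N, (fun y => F y *m B); split=> //; last by move=> y Ny Dy; rewrite LF // image_row_span.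
apply/subspace_continuousP => y NDy; apply/mcvg_entries; apply: mcvgM; last exact: mcvg_cst.
by apply/mcvg_entries; move/subspace_continuousP: Fc; apply.
Qed.
End Trivialized.
End CurveContinuity.

Lemma mcvg_dsub (R : realType) T (F : set_system T) (FF : Filter F) k k' l
    (f : T -> 'M[R]_(k + k', l)) a :
  mcvg F f a -> mcvg F (fun t => dsubmx (f t)) (dsubmx a).
Proof. by move=> fa i j; rewrite mxE; under eq_fun do rewrite mxE; exact: fa. Qed.

Lemma image_mul (R : realType) k l p (X : set 'rV[R]_k) (A : 'M[R]_(k, l)) (B : 'M[R]_(l, p)) :
  (fun v => v *m B) @` ((fun z => z *m A) @` X) = (fun z => z *m (A *m B)) @` X.
Proof.
apply/seteqP; split=> w; first by move=> [_ [z zX <-] <-]; exists z; rewrite ?mulmxA.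
by move=> [z zX <-]; exists (z *m A); [exists z|rewrite mulmxA].
Qed.

(** * The trivialized tangent spaces along the curve *)

Section MorseCurve.
Variables (R : realType) (n m : nat) (U : manifold R n) (M : manifold R m).
Variables (phi : U -> R) (Phi : U -> M).
Hypothesis phi_smooth : smooth_fun phi.
Hypothesis Phi_submersion : submersion Phi.
Hypothesis phi_Phi_morse : morse_problem phi Phi.
Variables (t0 t1 : R) (u : R -> U) (lam : R -> cotangent M).
Hypothesis u_cont : {within `[t0, t1], continuous u}.
Hypothesis lam_cont : ct_continuous `[t0, t1] lam.
Hypothesis in_L : forall t, t0 <= t <= t1 -> lagrange_points phi Phi (u t, lam t).

Let seg : set R := [set t | t0 <= t <= t1].

Lemma u_cvg t : t0 <= t <= t1 -> u @ within seg (nbhs t) --> u t.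
Proof.
move=> tab; have := (subspace_continuousP _ _).1 u_cont t.
by rewrite -seg_itv; apply.
Qed.

Lemma near_charts t c d : t0 <= t <= t1 -> charts_at (u t) c -> charts_at (Phi (u t)) d ->
  \forall s \near within seg (nbhs t), [/\ t0 <= s <= t1, charts_at (u s) c & charts_at (Phi (u s)) d].
Proof.
move=> tab [cA cu] [dA du].
have oP : open (Phi @^-1` chart_dom d).
  by apply: open_comp => [x _|]; [exact: Phi_submersion.1.1|exact: atlas_dom_open].
have nb : nbhs (u t) (chart_dom c `&` Phi @^-1` chart_dom d).
  by apply: open_nbhs_nbhs; split=> //; apply: openI => //; exact: atlas_dom_open.
have := u_cvg tab nb => /near_withinP h; apply/near_withinP.
by apply: filterS h => s h sab; have [cs ds] := h sab.
Qed.

Lemma base_lam t : t0 <= t <= t1 -> ct_base (lam t) = Phi (u t).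
Proof. by move=> /in_L[]. Qed.

Lemma chart_u_cvg t c : t0 <= t <= t1 -> charts_at (u t) c ->
  (fun s => c (u s)) @ within seg (nbhs t) --> c (u t).
Proof. by move=> tab cu; exact: (cvg_comp _ _ (u_cvg tab) (chart_continuous cu)). Qed.

Lemma chart_base_cvg t d : t0 <= t <= t1 -> charts_at (Phi (u t)) d ->
  (fun s => d (Phi (u s))) @ within seg (nbhs t) --> d (Phi (u t)).
Proof.
move=> tab du; have PhiC : Phi x @[x --> u t] --> Phi (u t) by exact: Phi_submersion.1.1.
exact: (cvg_comp _ _ (cvg_comp _ _ (u_cvg tab) PhiC) (chart_continuous du)).
Qed.

Lemma ct_comp_cvg t d : t0 <= t <= t1 -> charts_at (Phi (u t)) d ->
  mcvg (within seg (nbhs t)) (fun s => ct_comp (lam s) d) (ct_comp (lam t) d).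
Proof.
move=> tab du; have [cA cu'] := du; have [c ca cu] := atlas_cover (u t).
have := (subspace_continuousP _ _).1 (lam_cont.2 d cA) t.
rewrite -seg_itv => /(_ (conj tab _)); rewrite /= base_lam // => /(_ cu') h.
apply/mcvg_entries; apply: cvg_trans h; apply: cvg_app => A hA.
have nc := (near_withinP _ _ _).1 (near_charts tab (conj ca cu : charts_at (u t) c) du).
have hA' : \forall s \near nbhs t, (seg `&` [set t | chart_dom d (ct_base (lam t))]) s -> A s := hA.
suff : \forall s \near nbhs t, seg s -> A s by [].
apply: filterS2 hA' nc => s h1 h2 sab; apply: h1; split=> //.
by have [_ _ [_ ds]] := h2 sab; rewrite /= base_lam.
Qed.

Lemma dmap_cvg t c d : t0 <= t <= t1 -> charts_at (u t) c -> charts_at (Phi (u t)) d ->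
  mcvg (within seg (nbhs t)) (fun s => dmap Phi c d (u s)) (dmap Phi c d (u t)).
Proof.
move=> tab cu du; have [cA cx] := cu; have [dA dx] := du.
apply: (mcvg_jacobian _ (rep_open Phi_submersion cA dA) _ (rep_smooth Phi_submersion cA dA) (chart_u_cvg tab cu)).
by exists (u t).
Qed.

Lemma Qmx_cvg t c d : t0 <= t <= t1 -> charts_at (u t) c -> charts_at (Phi (u t)) d ->
  mcvg (within seg (nbhs t)) (fun s => Qmx phi Phi c d (u s, lam s)) (Qmx phi Phi c d (u t, lam t)).
Proof.
move=> tab cu du; have [cA cx] := cu; have [dA dx] := du.
have yD : rep_dom Phi c d (c (u t)) by exists (u t).
apply: mcvgB; first exact: (mcvg_hess _ yD (phi_smooth_rep phi_smooth cA) (chart_u_cvg tab cu)).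
apply: mcvg_sum => k; apply: mcvgZ; first exact: (ct_comp_cvg tab du).
exact: (mcvg_hess _ yD (rep_smooth Phi_submersion cA dA 0 k) (chart_u_cvg tab cu)).
Qed.

Section Trivialization.
Variables (Pi : set 'rV[R]_(m + m)) (A : chart R m M -> R -> 'M[R]_(m + m)).
Hypothesis A_triv : sympl_trivialization t0 t1 lam Pi A.

Local Notation curve := (trivialized_tangent phi Phi A (fun t => (u t, lam t))).

Lemma triv_symplectic t d : t0 <= t <= t1 -> charts_at (Phi (u t)) d ->
  A d t *m Jmx R m *m (A d t)^T = Jmx R m.
Proof.
move=> tab du; have := A_triv.2 t d tab; rewrite base_lam // => /(_ du)[h _ _].
exact/symplectic_forms.
Qed.

Lemma triv_vertical t d : t0 <= t <= t1 -> charts_at (Phi (u t)) d ->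
  Pi = (fun z => z *m A d t) @` @vertical R m.
Proof. by move=> tab du; have := A_triv.2 t d tab; rewrite base_lam // => /(_ du)[_ ->]. Qed.

Lemma triv_change t d d' : t0 <= t <= t1 -> charts_at (Phi (u t)) d -> charts_at (Phi (u t)) d' ->
  A d t = ct_jac d d' (lam t) *m A d' t.
Proof.
by move=> tab du du'; have := A_triv.2 t d tab; rewrite base_lam // => /(_ du)[_ _ /(_ d' du')].
Qed.

Lemma triv_cvg t d : t0 <= t <= t1 -> charts_at (Phi (u t)) d ->
  mcvg (within seg (nbhs t)) (A d) (A d t).
Proof.
move=> tab du; have [cA cu'] := du; have [c ca cu] := atlas_cover (u t).
have := (subspace_continuousP _ _).1 (A_triv.1 d cA) t.
rewrite -seg_itv => /(_ (conj tab _)); rewrite /= base_lam // => /(_ cu') h.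
apply/mcvg_entries; apply: cvg_trans h; apply: cvg_app => B hB.
have nc := (near_withinP _ _ _).1 (near_charts tab (conj ca cu : charts_at (u t) c) du).
have hB' : \forall s \near nbhs t, (seg `&` [set t | chart_dom d (ct_base (lam t))]) s -> B s := hB.
suff : \forall s \near nbhs t, seg s -> B s by [].
apply: filterS2 hB' nc => s h1 h2 sab; apply: h1; split=> //.
by have [_ _ [_ ds]] := h2 sab; rewrite /= base_lam.
Qed.

(** The definition takes a union over the charts of M; the compatibility of A with [ct_jac] makes
    all the members of the union equal. *)
Lemma trivialized_tangentE t c d : t0 <= t <= t1 -> charts_at (u t) c -> charts_at (Phi (u t)) d ->
  curve t = (fun z => z *m A d t) @`
    tangent_set (Qmx phi Phi c d (u t, lam t)) (dmap Phi c d (u t)).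
Proof.
move=> tab cu du; have Lt := in_L tab.
rewrite -(lag_tangentE phi_smooth Phi_submersion Lt cu du).
apply/seteqP; split=> w; last first.
  by move=> [z zt <-]; exists d, z; rewrite /= base_lam.
move=> [d' [z [/=]]]; rewrite base_lam // => d'u zt ->.
exists (z *m ct_jac d' d (lam t)).
  exact: (lag_tangent_change phi_smooth Phi_submersion Lt d'u du zt).
by rewrite -mulmxA -triv_change.
Qed.

Variable B : 'M[R]_(m + m).
Hypothesis B_sympl : B *m Jmx R m *m B^T = Jmx R m.
Hypothesis B_vert : forall v, Pi v <-> vertical (v *m B).

(** One chart S, fixed for times near t, whose pullbacks through the moving trivialization keep G
    invertible. Then sgn G is the constant g, and [sg_border] expresses the signature of T through
    that of the Hessian. *)
Lemma trivialized_chart t c d : t0 <= t <= t1 -> charts_at (u t) c -> charts_at (Phi (u t)) d ->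
  exists (S : 'M[R]_m) (T : R -> 'M[R]_m) (g : int),
    [/\ S^T = S, mcvg (within seg (nbhs t)) T (T t) &
    \forall s \near within seg (nbhs t), [/\ (T s)^T = T s,
       (fun v => v *m B) @` curve s = row_span (shear_frame S (T s)) &
       sg (T s) = g - sgn_hess phi Phi c d (u s, lam s)]].
Proof.
move=> tab cu du.
pose A' s := A d s *m B.
have A'J s : t0 <= s <= t1 -> charts_at (Phi (u s)) d -> A' s *m Jmx R m *m (A' s)^T = Jmx R m.
  by move=> sab ds; apply: symplectic_mul => //; apply: triv_symplectic.
have A'v s : t0 <= s <= t1 -> charts_at (Phi (u s)) d -> forall v, vertical v -> vertical (v *m A' s).
  move=> sab ds v vv; rewrite /A' mulmxA; apply/B_vert.
  by rewrite (triv_vertical sab ds); exists v.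
pose a s := ulsubmx (A' s); pose b s := dlsubmx (A' s); pose e s := drsubmx (A' s).
have blk s : t0 <= s <= t1 -> charts_at (Phi (u s)) d ->
    [/\ A' s = block_mx (a s) 0 (b s) (e s), a s *m (e s)^T = 1%:M & (b s *m (e s)^T)^T = b s *m (e s)^T].
  move=> sab ds; have [a0 [b0 [e0 [AE ae be]]]] := symplectic_vertical (A'J s sab ds) (A'v s sab ds).
  by rewrite /a /b /e AE block_mxKul block_mxKdl block_mxKdr.
have [A't ae be] := blk t tab du.
have ea : e t *m (a t)^T = 1%:M by rewrite -[LHS]trmxK trmx_mul trmxK ae trmx1.
have eTa : (e t)^T *m a t = 1%:M by apply: mulmx1C.
have aTe : (a t)^T *m e t = 1%:M by apply: mulmx1C.
pose Q s := Qmx phi Phi c d (u s, lam s); pose D s := dmap Phi c d (u s).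
have Qs s : t0 <= s <= t1 -> charts_at (u s) c -> charts_at (Phi (u s)) d -> (Q s)^T = Q s.
  by move=> sab; apply: (Qmx_sym phi_smooth Phi_submersion).
have [S0 S0s G0u] := exists_tangent_chart (Qs t tab cu du)
  (fun v => kernel_morse phi_Phi_morse (in_L tab) cu du).
(* The centre whose pullback at time t is the admissible S0. *)
pose S := (a t)^T *m S0 *m a t + (a t)^T *m b t.
have bE : (a t)^T *m b t = (a t)^T *m (b t *m (e t)^T) *m a t.
  by rewrite -!mulmxA eTa mulmx1.
have Ss : S^T = S.
  rewrite /S bE linearD /=; congr (_ + _).
    by rewrite -{2 4}[a t]trmxK sym_congr.
  by rewrite -{2 4}[a t]trmxK sym_congr.
(* The fixed centre S seen through the trivialization at time s. *)
pose St s := e s *m S *m (e s)^T - b s *m (e s)^T.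
have StE : St t = S0.
  rewrite /St /S mulmxDr mulmxDl !mulmxA ea !mul1mx -(mulmxA S0) ae mulmx1 addrK //.
pose G s := Q s - D s *m St s *m (D s)^T.
pose T s := (e s)^T *m ((D s)^T *m invmx (G s) *m D s) *m e s.
have FF : Filter (within seg (nbhs t)) by exact: within_filter.
have Ac : mcvg (within seg (nbhs t)) A' (A' t).
  by apply: mcvgM; [exact: triv_cvg|exact: mcvg_cst].
have ec : mcvg (within seg (nbhs t)) e (e t).
  by apply: mcvg_rsub; exact: mcvg_dsub.
have bc : mcvg (within seg (nbhs t)) b (b t).
  by apply: mcvg_lsub; exact: mcvg_dsub.
have Dc : mcvg (within seg (nbhs t)) D (D t) by exact: dmap_cvg.
have Gc : mcvg (within seg (nbhs t)) G (G t).
  apply: mcvgB; first exact: Qmx_cvg.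
  apply: mcvgM; last exact: mcvgT.
  apply: mcvgM => //; apply: mcvgB; last by apply: mcvgM => //; exact: mcvgT.
  by apply: mcvgM; [apply: mcvgM => //; exact: mcvg_cst|exact: mcvgT].
have Gtu : G t \in unitmx by rewrite /G StE.
have Tc : mcvg (within seg (nbhs t)) T (T t).
  apply: mcvgM => //; apply: mcvgM; first exact: mcvgT.
  by apply: mcvgM => //; apply: mcvgM; [exact: mcvgT|exact: mcvg_inv].
have Sts s : t0 <= s <= t1 -> charts_at (Phi (u s)) d -> (St s)^T = St s.
  by move=> sab ds; have [_ _ bs] := blk s sab ds; rewrite /St linearB /= bs sym_congr.
have Gs s : t0 <= s <= t1 -> charts_at (u s) c -> charts_at (Phi (u s)) d -> (G s)^T = G s.
  by move=> sab cs ds; rewrite /G linearB /= Qs // sym_congr // Sts.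
have nch := near_charts tab cu du.
have nGs : \forall s \near within seg (nbhs t), (G s)^T = G s.
  by apply: filterS nch => s [h1 h2 h3]; exact: Gs.
have nsg : \forall s \near within seg (nbhs t), sg (G s) = sg (G t).
  by apply: sg_cvg => //; exact: Gs.
have nu : \forall s \near within seg (nbhs t), G s \in unitmx by exact: mcvg_unit Gc Gtu.
exists S, T, (sg (G t)); split=> //.
apply: filterS3 nch nsg nu => s [sab cs ds] sgs us.
have [As aes bes] := blk s sab ds.
have [Ts sT E] := tangent_set_trivialized (Qs s sab cs ds) Ss aes bes us.
split; first exact: Ts.
  rewrite (trivialized_tangentE sab cs ds) -[RHS]E -As; exact: image_mul.
have h3 : sgn_hess phi Phi c d (u s, lam s) = sg (G s) - sg ((D s)^T *m invmx (G s) *m D s) :=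
  etrans (sgn_hess_border phi_smooth Phi_submersion (lam s) cs ds)
    (sg_border (Qs s sab cs ds) (Sts s sab ds) us).
have h4 : sg (T s) = sg ((D s)^T *m invmx (G s) *m D s) := sT.
have aux (h x y z w : int) : h = x - y -> z = y -> x = w -> z = w - h by move=> -> -> ->; lia.
exact: (aux _ _ _ _ _ h3 h4 sgs).
Qed.

(** The choices of charts [cs] and [ds] may depend on t without any continuity, because the
    signature does not depend on the charts. *)
Lemma sgn_hess_index (cs : R -> chart R n U) (ds : R -> chart R m M) :
  (forall t, charts_at (u t) (cs t)) -> (forall t, charts_at (Phi (u t)) (ds t)) ->
  lag_index seg (fun t => (fun v => v *m B) @` curve t)
    (fun t => sgn_hess phi Phi (cs t) (ds t) (u t, lam t)).
Proof.
move=> csP dsP t tab.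
have [S [T [g [Ss _ nT]]]] := trivialized_chart tab (csP t) (dsP t).
have tt := (near_withinP _ _ _).1 nT; have [Ts Ct sT] := nbhs_singleton tt tab.
exists S; split=> //; first by exists (T t).
have nch := near_charts tab (csP t) (dsP t).
move: nT nch; apply: filterS2 => s [Tss Cs sTs] [sab cst dst].
have hs := sgn_hess_charts phi_smooth Phi_submersion (in_L sab) (csP s) (dsP s) cst dst.
have es := etrans (congr1 (tau S) Cs) (congr1 (@sg R m) (lcoordE Ss Tss)).
have et := etrans (congr1 (tau S) Ct) (congr1 (@sg R m) (lcoordE Ss Ts)).
have aux (h h' k x y ts ts' : int) : h = h' -> ts = x -> x = g - h' -> ts' = y -> y = g - k ->
  h + ts = k + ts' by move=> -> -> -> -> ->; lia.
exact: (aux _ _ _ _ _ _ _ hs es sTs et sT).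
Qed.

Lemma trivialized_lag_continuous :
  lag_continuous seg (fun t => (fun v => v *m B) @` curve t).
Proof.
apply/lag_continuousP => t tab.
have [c cA cu] := atlas_cover (u t); have [d dA du] := atlas_cover (Phi (u t)).
have [S [T [g [Ss Tc nT]]]] := trivialized_chart tab (conj cA cu : charts_at _ _) (conj dA du : charts_at _ _).
have tt := (near_withinP _ _ _).1 nT; have [Ts Ct sT] := nbhs_singleton tt tab.
have Fl := shear_frame_lag Ss Ts.
rewrite Ct; split; first by exists (shear_frame S (T t)).
have FF : Filter (within seg (nbhs t)) by exact: within_filter.
apply: (@lcvg_near_eq _ _ _ _ _ (fun s => row_span (shear_frame S (T s)))).
  by apply: filterS nT => s [_ -> _].
apply: lcvg_frames => //; last by apply: filterS nT => s [Tss _ _]; exact: shear_frame_lag.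
apply: mcvg_row => //; apply: mcvgD; first exact: mcvg_cst.
by apply: mcvgM => //; exact: mcvg_cst.
Qed.
End Trivialization.
End MorseCurve.

(** * The formula for every value of the cocycle *)

(** The homotopy carries the index function given by the Hessian to one along the generic curve,
    with the same total variation, and [crossing_total] evaluates the latter. *)
Lemma maslov_sgn_hess (R : realType) (n m : nat)
    (U : manifold R n) (M : manifold R m) (phi : U -> R) (Phi : U -> M)
    (t0 t1 : R) (u : R -> U) (lam : R -> cotangent M) (mu : int) :
  smooth_fun phi -> submersion Phi -> morse_problem phi Phi -> t0 < t1 ->
  {within `[t0, t1], continuous u} -> ct_continuous `[t0, t1] lam ->
  (forall t, t0 <= t <= t1 -> lagrange_points phi Phi (u t, lam t)) ->
  maslov_cocycle phi Phi t0 t1 (fun t => (u t, lam t)) mu ->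
  forall c0 d0 c1 d1,
    charts_at (u t0) c0 -> charts_at (Phi (u t0)) d0 ->
    charts_at (u t1) c1 -> charts_at (Phi (u t1)) d1 ->
    - 2 * mu = sgn_hess phi Phi c1 d1 (u t1, lam t1)
             - sgn_hess phi Phi c0 d0 (u t0, lam t0).
Proof.
move=> ps Ps pm t01 uc lc iL [Pi [A [PiL triv [nt0 nt1 [Gam [Gs hom cr fin ->]]]]]].
move=> c0 d0 c1 d1 hc0 hd0 hc1 hd1.
have t0in : t0 <= t0 <= t1 by rewrite lexx ltW.
have t1in : t0 <= t1 <= t1 by rewrite lexx ltW.
have AJ := triv_symplectic iL triv t0in hd0.
(* Pi is the image of the vertical subspace under the trivialization at t0, so this single
   symplectic matrix returns it to the vertical one at all times. *)
pose B := invmx (A d0 t0).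
have BJ : B *m Jmx R m *m B^T = Jmx R m := symplectic_inv AJ.
have Au := symplectic_unit AJ.
have Bv v : Pi v <-> vertical (v *m B).
  rewrite (triv_vertical iL triv t0in hd0); split=> [[z zv <-]|vv].
    by rewrite mulmxK.
  by exists (v *m B) => //; rewrite mulmxKV.
have /choice[cs csP] : forall t, exists c, charts_at (u t) c.
  by move=> t; have [c ? ?] := atlas_cover (u t); exists c.
have /choice[ds dsP] : forall t, exists d, charts_at (Phi (u t)) d.
  by move=> t; have [c ? ?] := atlas_cover (Phi (u t)); exists c.
have ih := sgn_hess_index ps Ps pm uc lc iL triv BJ Bv csP dsP.
have [H [Hc H0 H1 Ha Hb]] := hom.
have in01 (t : R) : t0 <= t <= t1 ->
  ([set s : R | 0 <= s <= 1] `*` [set t : R | t0 <= t <= t1]) (1, t).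
  by move=> tin; split=> //=; rewrite ler01 lexx.
have Gc : lag_continuous [set t | t0 <= t <= t1] Gam.
  apply: lag_continuous_ext (H1) _.
  apply: (@lag_continuous_comp R m _ _ (fun t : R => ((1 : R), t)) _ _ H _ _ Hc) => // t _.
  exact: cvg_pairl.
have one01 : 0 <= (1 : R) <= 1 by rewrite ler01 lexx.
have Gb : Gam t1 = trivialized_tangent phi Phi A (fun t => (u t, lam t)) t1.
  by rewrite -H1 // Hb.
have Ga : Gam t0 = trivialized_tangent phi Phi A (fun t => (u t, lam t)) t0.
  by rewrite -H1 // Ha.
have homB : lag_homotopic t0 t1
    (fun t => (fun v => v *m B) @` trivialized_tangent phi Phi A (fun t => (u t, lam t)) t)
    (fun t => (fun v => v *m B) @` Gam t).
  exists (fun x => (fun v => v *m B) @` H x); split.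
  - exact: lag_continuous_mul BJ Hc.
  - by move=> t /H0 ->.
  - by move=> t /H1 ->.
  - by move=> s /Ha ->.
  - by move=> s /Hb ->.
have [g ig gE] := index_homotopy t01 homB ih.
have := crossing_total t01 BJ Bv Gs _ _ cr fin (lag_continuous_mul BJ Gc) ig.
rewrite Ga Gb => /(_ nt0 nt1) <-; apply: (etrans gE).
have e1 := sgn_hess_charts ps Ps (iL _ t1in) (csP t1) (dsP t1) hc1 hd1.
have e0 := sgn_hess_charts ps Ps (iL _ t0in) (csP t0) (dsP t0) hc0 hd0.
exact: (congr2 (fun x y : int => x - y) e1 e0).
Qed.

(** * Existence of symplectic trivializations *)


Lemma mcvg_within_sub (R : realType) (X : topologicalType) k l (D D' : set X) (x : X)
    (f : X -> 'M[R]_(k, l)) a :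
  D' `<=` D -> mcvg (within D (nbhs x)) f a -> mcvg (within D' (nbhs x)) f a.
Proof. by move=> DD h i j A hA; exact: (near_within_sub DD (h i j A hA)). Qed.

Lemma mcvg_withinU (R : realType) (X : topologicalType) k l (D D' : set X) (x : X)
    (f : X -> 'M[R]_(k, l)) a :
  mcvg (within D (nbhs x)) f a -> mcvg (within D' (nbhs x)) f a ->
  mcvg (within (D `|` D') (nbhs x)) f a.
Proof. by move=> h h' i j A hA; exact: (near_withinU (h i j A hA) (h' i j A hA)). Qed.

Lemma mcvg_within_out (R : realType) (X : topologicalType) k l (D : set X) (x : X)
    (f : X -> 'M[R]_(k, l)) a :
  closed D -> ~ D x -> mcvg (within D (nbhs x)) f a.
Proof.
by move=> cD nD i j A hA; exact: (@near_within_out _ D x (fun y => A (f y i j)) cD nD).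
Qed.

Lemma mcvg_within_eq (R : realType) (X : topologicalType) k l (D : set X) (x : X)
    (f g : X -> 'M[R]_(k, l)) a :
  (forall y, D y -> f y = g y) -> mcvg (within D (nbhs x)) f a -> mcvg (within D (nbhs x)) g a.
Proof.
move=> fg; apply: (@mcvg_near_eq _ _ _ (within_filter _ (nbhs_filter x))).
by apply/near_withinP; apply: nearW => y /fg.
Qed.

Lemma segU (R : realType) (a b c : R) : a <= b -> b <= c ->
  [set t : R | a <= t <= b] `|` [set t | b <= t <= c] = [set t | a <= t <= c].
Proof.
move=> ab bc; apply/seteqP; split=> t /=.
  by move=> [/andP[h1 h2]|/andP[h1 h2]]; rewrite ?h1 ?h2 ?(le_trans h2 bc) ?(le_trans ab h1).
by move=> /andP[h1 h2]; case: (lerP t b) => h; [left|right]; rewrite ?h1 // (ltW h) h2.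
Qed.

Section Trivialize.
Variables (R : realType) (n m : nat) (U : manifold R n) (M : manifold R m).
Variables (phi : U -> R) (Phi : U -> M).
Hypothesis Phi_submersion : submersion Phi.
Variables (t0 t1 : R) (u : R -> U) (lam : R -> cotangent M).
Hypothesis t01 : t0 < t1.
Hypothesis u_cont : {within `[t0, t1], continuous u}.
Hypothesis lam_cont : ct_continuous `[t0, t1] lam.
Hypothesis in_L : forall t, t0 <= t <= t1 -> lagrange_points phi Phi (u t, lam t).

Let seg : set R := [set t | t0 <= t <= t1].
Let base t (tab : t0 <= t <= t1) := base_lam in_L tab.

Lemma ct_jac_cvg t d d' : t0 <= t <= t1 -> charts_at (Phi (u t)) d -> charts_at (Phi (u t)) d' ->
  mcvg (within seg (nbhs t)) (fun s => ct_jac d d' (lam s)) (ct_jac d d' (lam t)).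
Proof.
move=> tab dx d'x; have [c cA cu] := atlas_cover (u t).
have cc : charts_at (u t) c by [].
have [dA _] := dx; have [d'A _] := d'x.
have FF : Filter (within seg (nbhs t)) by exact: within_filter.
have nd := near_charts Phi_submersion u_cont tab cc dx.
have nd' := near_charts Phi_submersion u_cont tab cc d'x.
have bt := base tab.
have J1 : mcvg (within seg (nbhs t)) (fun s => 'J (trans d d') (d (Phi (u s)))) ('J (trans d d') (d (Phi (u t)))).
  apply: (mcvg_jacobian _ (overlap_open dA d'A) _ (trans_smooth dA d'A)); first exact: overlap_at.
  exact: (chart_base_cvg Phi_submersion u_cont tab dx).
have cd' := chart_base_cvg Phi_submersion u_cont tab d'x.
have J2 : mcvg (within seg (nbhs t)) (fun s => 'J (trans d' d) (d' (Phi (u s)))) ('J (trans d' d) (d' (Phi (u t)))).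
  apply: (mcvg_jacobian _ (overlap_open d'A dA) _ (trans_smooth d'A dA) cd'); exact: overlap_at.
have J3 : mcvg (within seg (nbhs t))
    (fun s => \sum_k ct_comp (lam s) d k 0 *: hess (fun y => trans d' d y 0 k) (d' (Phi (u s))))
    (\sum_k ct_comp (lam t) d k 0 *: hess (fun y => trans d' d y 0 k) (d' (Phi (u t)))).
  apply: mcvg_sum => k; apply: mcvgZ.
    exact: (ct_comp_cvg Phi_submersion u_cont lam_cont in_L tab dx).
  exact: (mcvg_hess _ (overlap_at d'x dx) (trans_smooth d'A dA 0 k) cd').
pose K s := block_mx ('J (trans d' d) (d' (Phi (u s))))^T 0
  ('J (trans d d') (d (Phi (u s))) *m
   (\sum_k ct_comp (lam s) d k 0 *: hess (fun y => trans d' d y 0 k) (d' (Phi (u s)))))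
  ('J (trans d d') (d (Phi (u s)))).
have KE s : t0 <= s <= t1 -> charts_at (Phi (u s)) d -> charts_at (Phi (u s)) d' ->
    K s = ct_jac d d' (lam s).
  move=> sab; have bs := base sab; rewrite -bs => ds d's; have [_ ->] := ct_jacE ds d's.
  by rewrite /K -bs.
rewrite -KE //; apply: (@mcvg_near_eq _ _ _ FF _ _ K).
  by apply: filterS2 nd nd' => s [sab _ ds] [_ _ d's]; exact: KE.
apply: mcvg_block => //; [exact: mcvgT|exact: mcvg_cst|exact: mcvgM].
Qed.

Let triv_on a b (A : chart R m M -> R -> 'M[R]_(m + m)) :=
  forall t d, a <= t <= b -> charts_at (Phi (u t)) d ->
  [/\ A d t *m Jmx R m *m (A d t)^T = Jmx R m,
      forall v, vertical v -> vertical (v *m A d t),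
      mcvg (within [set t | a <= t <= b] (nbhs t)) (A d) (A d t) &
      forall d', charts_at (Phi (u t)) d' -> A d t = ct_jac d d' (lam t) *m A d' t].

Lemma vertical_inv (A : 'M[R]_(m + m)) :
  A *m Jmx R m *m A^T = Jmx R m -> (forall v, vertical v -> vertical (v *m A)) ->
  forall v, vertical v -> vertical (v *m invmx A).
Proof.
move=> AJ Av v vv; have Au := symplectic_unit AJ.
have [a [b [e [AE ae be]]]] := symplectic_vertical AJ Av.
have ea : e^T *m a = 1%:M by apply: mulmx1C.
suff -> : v *m invmx A = row_mx (lsubmx v *m e^T) 0 by rewrite /vertical /= row_mxKr.
apply: (can_inj (mulmxK Au)); rewrite mulmxKV // AE mul_row_block !mul0mx mulmx0 !addr0.
by rewrite -mulmxA ea mulmx1 -{1}[v]hsubmxK vv.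
Qed.

(** At a division time b two trivializations differ by a symplectic matrix K that preserves the
    vertical subspace; multiplying the second one by this constant K makes them continuous together
    and keeps all their properties. *)
Lemma trivialization_exists :
  exists A, sympl_trivialization t0 t1 lam (@vertical R m) A.
Proof.
suff [A hA] : exists A, triv_on t0 t1 A.
  exists A; split=> [d dA|t d tab]; last first.
    rewrite base // => dt; have [AJ Av _ Ac] := hA t d tab dt; split=> //.
    - exact/symplectic_forms.
    - apply/seteqP; split=> w; first by move=> [z zv <-]; exact: Av.
      move=> wv; exists (w *m invmx (A d t)); first exact: vertical_inv.
      by rewrite mulmxKV // symplectic_unit.
  apply/subspace_continuousP => t; rewrite -seg_itv => -[tab]; rewrite /= base // => dt.
  have [_ _ h _] := hA t d tab (conj dA dt); apply/mcvg_entries.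
  by apply: mcvg_within_sub h => s [].
apply: (@cousin _ t0 t1 (fun a b => exists A, triv_on a b A)) => //; last first.
  move=> a b c ta ab bc ct [A1 h1] [A2 h2].
  have bt : t0 <= b <= t1 by rewrite (ltW (le_lt_trans ta ab)) (ltW (lt_le_trans bc ct)).
  have bab : a <= b <= b by rewrite (ltW ab) lexx.
  have bbc : b <= b <= c by rewrite (ltW bc) lexx.
  have [d0 d0A d0x] := atlas_cover (Phi (u b)).
  have d0b : charts_at (Phi (u b)) d0 by [].
  have [A1J A1v _ _] := h1 b d0 bab d0b; have [A2J A2v _ _] := h2 b d0 bbc d0b.
  (* K does not depend on the chart d0. *)
  pose K := invmx (A2 d0 b) *m A1 d0 b.
  have KJ : K *m Jmx R m *m K^T = Jmx R m by apply: symplectic_mul => //; exact: symplectic_inv.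
  have Kv v : vertical v -> vertical (v *m K).
    by move=> vv; rewrite mulmxA; apply: A1v; exact: vertical_inv.
  have agree d : charts_at (Phi (u b)) d -> A1 d b = A2 d b *m K.
    move=> db; have [_ _ _ /(_ d0 d0b) ->] := h1 b d bab db.
    have [_ _ _ /(_ d0 d0b) ->] := h2 b d bbc db.
    by rewrite /K -mulmxA mulKVmx // symplectic_unit.
  clearbody K.
  pose A d t := if t <= b then A1 d t else A2 d t *m K.
  have AE1 d t : a <= t <= b -> A1 d t = A d t by move=> /andP[_ tb]; rewrite /A tb.
  have AE2 d t : b <= t <= c -> charts_at (Phi (u t)) d -> A2 d t *m K = A d t.
    move=> /andP[]; rewrite le_eqVlt /A => /orP[/eqP <-|bt' _]; first by rewrite lexx => _ /agree.
    by rewrite leNgt bt'.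
  exists A => t d tac dt; split.
  - case: (lerP t b) => tb; last first.
      rewrite -AE2 //; last by rewrite (ltW tb); case/andP: tac.
      by apply: symplectic_mul => //; case: (h2 t d _ dt) => //; rewrite (ltW tb); case/andP: tac.
    have tab : a <= t <= b by rewrite tb; case/andP: tac => ->.
    by rewrite -AE1 //; case: (h1 t d tab dt).
  - case: (lerP t b) => tb v vv; last first.
      have tbc : b <= t <= c by rewrite (ltW tb); case/andP: tac.
      by rewrite -AE2 // mulmxA; apply: Kv; case: (h2 t d tbc dt) => _ + _ _; apply.
    have tab : a <= t <= b by rewrite tb; case/andP: tac => ->.
    by rewrite -AE1 //; case: (h1 t d tab dt) => _ + _ _; apply.
  - rewrite -(segU (ltW ab) (ltW bc)); apply: mcvg_withinU.
      case: (pselect (a <= t <= b)) => tab; last exact: mcvg_within_out (@closed_seg _ _ _) tab.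
      rewrite -AE1 //; apply: (mcvg_within_eq (AE1 d)).
      by case: (h1 t d tab dt).
    case: (pselect (b <= t <= c)) => tbc; last exact: mcvg_within_out (@closed_seg _ _ _) tbc.
    rewrite -AE2 //; have tt : t0 <= t <= t1.
      by case/andP: tbc => x1 x2; rewrite (le_trans _ x1) ?(le_trans x2) // ?(le_trans ta (ltW ab)).
    apply: (@mcvg_near_eq _ _ _ (within_filter _ (nbhs_filter t)) _ _ (fun s => A2 d s *m K)).
      have [e eA eu] := atlas_cover (u t).
      have /(near_within_sub (D' := [set s | b <= s <= c])) :=
        near_charts Phi_submersion u_cont tt (conj eA eu : charts_at (u t) e) dt.
      have sub : [set s | b <= s <= c] `<=` [set s | t0 <= s <= t1].
        by move=> s /= /andP[x1 x2]; rewrite (le_trans _ x1) ?(le_trans x2) // ?(le_trans ta (ltW ab)).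
      move=> /(_ sub) /near_withinP nc; apply/near_withinP.
      by apply: filterS nc => s h sbc; have [_ _ ds] := h sbc; exact: AE2.
    apply: (@mcvgM _ _ _ (within_filter _ (nbhs_filter t))).
      by case: (h2 t d tbc dt).
    exact: (@mcvg_cst _ _ _ (within_filter _ (nbhs_filter t))).
  - move=> d' d't; case: (lerP t b) => tb; last first.
      have tbc : b <= t <= c by rewrite (ltW tb); case/andP: tac.
      by have [_ _ _ /(_ d' d't) E] := h2 t d tbc dt; rewrite -!AE2 // mulmxA -E.
    have tab : a <= t <= b by rewrite tb; case/andP: tac => ->.
    by rewrite -!AE1 //; case: (h1 t d tab dt) => _ _ _; apply.
move=> x xab; have [d0 d0A d0x] := atlas_cover (Phi (u x)).
have [c cA cu] := atlas_cover (u x).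
have := near_charts Phi_submersion u_cont xab (conj cA cu : charts_at (u x) c) (conj d0A d0x : charts_at _ d0).
move=> /near_withinP/nbhs_ballP[e /= e0 be]; exists e => // a b ta ab bt xa ax xb bx.
have sub : [set s | a <= s <= b] `<=` [set s | t0 <= s <= t1].
  by move=> s /= /andP[x1 x2]; rewrite (le_trans ta x1) (le_trans x2).
have near0 t : a <= t <= b -> t0 <= t <= t1 /\ charts_at (Phi (u t)) d0.
  move=> tab; have tt := sub t tab; split=> //.
  suff bt' : ball x e t by case: (be t bt' tt).
  case/andP: tab => x1 x2; rewrite /ball /= ltr_distlC; apply/andP; split; lra.
(* Over a single chart d0, its own coordinates (p, q) trivialize; in another chart d they are read
   through the derivative of the change of coordinates. *)
exists (fun d t => ct_jac d d0 (lam t)) => t d tab dt; have [tt d0t] := near0 t tab.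
have bt' := base tt; split.
- by apply: ct_jac_symplectic; rewrite bt'.
- move=> v vv; have dx : charts_at (ct_base (lam t)) d by rewrite bt'.
  have d0x' : charts_at (ct_base (lam t)) d0 by rewrite bt'.
  have [_ ->] := ct_jacE dx d0x'.
  by rewrite -[v]hsubmxK vv /vertical /= mul_row_block row_mxKr mulmx0 mul0mx addr0.
- by apply: mcvg_within_sub sub _; exact: ct_jac_cvg.
- by move=> d' d't; apply: ct_jac_chain; rewrite bt'.
Qed.
End Trivialize.

(** * Generic curves inside a chart *)


Section Bump.
Variable R : realType.

(** The polynomial factor in 1/x makes the family of these functions closed under differentiation,
    so that one computation yields derivatives of all orders. *)
Definition flat (q : {poly R}) (x : R) : R :=
  if 0 < x then q.[x^-1] * expR (- x^-1) else 0.

Lemma horner_growth (q : {poly R}) :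
  exists2 C : R, 0 <= C & exists k : nat, forall y, 1 <= y -> `|q.[y]| <= C * y ^+ k.
Proof.
elim/poly_ind: q => [|q c [C C0 [k h]]].
  by exists 0 => //; exists 0%N => y _; rewrite horner0 normr0 mul0r.
exists (C + `|c|); first by rewrite addr_ge0.
exists k.+1 => y y1; rewrite hornerMXaddC (le_trans (ler_normD _ _)) // mulrDl lerD //.
  rewrite normrM (ger0_norm (le_trans ler01 y1)) exprSr mulrA ler_wpM2r //.
    exact: le_trans ler01 y1.
  exact: h.
by rewrite ler_peMr // exprn_ege1.
Qed.

(** From exp y = (exp (y/n))^n and exp (y/n) >= y/n. *)
Lemma expRN_le (n : nat) (y : R) : (0 < n)%N -> 0 < y -> expR (- y) <= (n%:R / y) ^+ n.
Proof.
move=> n0 y0; have nR : 0 < n%:R :> R by rewrite ltr0n.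
have -> : n%:R / y = (y / n%:R)^-1 by rewrite invf_div.
rewrite expRN exprVn lef_pV2 ?posrE ?expR_gt0 ?exprn_gt0 ?divr_gt0 //.
have {2}-> : y = n%:R * (y / n%:R) by rewrite mulrC divfK // gt_eqF.
rewrite expRM_natl lerXn2r ?nnegrE ?expR_ge0 ?divr_ge0 ?ltW //.
by apply: lt_le_trans (expR_ge1Dx _); rewrite ltrDr.
Qed.

(** A quadratic bound at 0 gives differentiability there with derivative 0. The exponential is
    estimated by the power k + 2, where k is the growth order of q, which leaves the factor h^2. *)
Lemma flat_small (q : {poly R}) :
  exists2 C : R, 0 < C & forall h, `|h| <= 1 -> `|flat q h| <= C * h ^+ 2.
Proof.
have [C C0 [k qC]] := horner_growth q.
exists (C * k.+2%:R ^+ k.+2 + 1) => [|h h1].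
  by rewrite ltr_wpDl // mulr_ge0 // exprn_ge0.
rewrite /flat; case: ifPn => [h0|_]; last first.
  by rewrite normr0 mulr_ge0 ?exprn_even_ge0 // addr_ge0 // mulr_ge0 // exprn_ge0.
have hi1 : 1 <= h^-1 by rewrite invf_ge1 // -(gtr0_norm h0).
rewrite mulrDl mul1r -[X in X <= _]addr0 lerD ?exprn_even_ge0 //.
rewrite normrM (gtr0_norm (expR_gt0 _)).
have hn : h != 0 by rewrite gt_eqF.
have -> : C * k.+2%:R ^+ k.+2 * h ^+ 2 = C * h^-1 ^+ k * (k.+2%:R / h^-1) ^+ k.+2.
  have e : h^-1 ^+ k * h ^+ k.+2 = h ^+ 2.
    by rewrite exprVn -[k.+2]addn2 exprD mulrA mulVf ?mul1r // expf_neq0.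
  by rewrite invrK exprMn -e mulrACA.
apply: ler_pM; [exact: normr_ge0|exact: expR_ge0|exact: qC|].
by apply: expRN_le => //; rewrite invr_gt0.
Qed.

(** For x > 0 the derivative of q(1/x) exp(-1/x) is x^-2 (q - q')(1/x) exp(-1/x). *)
Definition flat_step (q : {poly R}) : {poly R} := 'X^2 * (q - q^`()).

Lemma flat_derive (q : {poly R}) (x : R) :
  is_derive x 1 (flat q : R -> R^o) (flat (flat_step q) x).
Proof.
have [x0|x0|x0] := ltrgtP x 0.
- apply: (@near_eq_is_derive _ _ _ (fun=> 0)).
    near=> y; rewrite /flat ifN // -leNgt ltW //; near: y; exact: lt_nbhsl.
  have nx : (0 < x) = false by rewrite ltNge (ltW x0).
  by rewrite /flat nx; exact: is_derive_cst.
- have xn : x != 0 by rewrite gt_eqF.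
  have dV : is_derive x 1 (fun y : R => y^-1 : R^o) (- x ^- 2).
    by have := @is_deriveV R id x 1 1 xn (is_derive_id _ _); rewrite /GRing.scale /= mulr1.
  apply: (@near_eq_is_derive _ _ _ (fun y : R => q.[y^-1] * expR (- y^-1) : R^o) (flat q : R -> R^o)).
    near=> y; rewrite /flat ifT //; near: y; exact: lt_nbhsr.
  have dq := @is_derive1_comp _ (horner q) _ _ _ _ (is_derive_poly q x^-1) dV.
  have dN : is_derive x 1 (fun y : R => - y^-1 : R^o) (- - x ^- 2) := is_deriveN dV.
  have de := @is_derive1_comp _ expR (fun y : R => - y^-1) x _ _ (is_derive_expR (- x^-1)) dN.
  apply: is_derive_eq (is_deriveM dq de) _.
  rewrite /flat x0 /GRing.scale /= /flat_step hornerM hornerXn hornerD hornerN exprVn opprK; ring.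
have [C C0 hC] := flat_small q.
have f0 : flat (flat_step q) x = 0 by rewrite /flat x0 ltxx.
rewrite f0 x0.
have lim0 : h^-1 *: ((flat q \o shift 0) (h *: 1) - flat q 0 : R^o) @[h --> 0^'] --> (0 : R^o).
  apply/cvgr0Pnorm_lt => e e0; near=> h.
  have h0 : h != 0 by near: h; exact: nbhs_dnbhs_neq.
  have -> : flat q 0 = 0 by rewrite /flat ltxx.
  rewrite /= subr0 addr0 [h *: 1]mulr1 normrZ normfV.
  rewrite ltr_pdivrMl ?normr_gt0 //.
  apply: le_lt_trans (hC h _) _.
    near: h; apply: dnbhs0_le; exact: ltr01.
  rewrite -real_normK ?num_real // expr2 mulrA [ltRHS]mulrC ltr_pM2r ?normr_gt0 //.
  rewrite -ltr_pdivlMl //; near: h; apply: dnbhs0_lt; rewrite mulr_gt0 // invr_gt0 //.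
by apply: DeriveDef; [exact: cvgP lim0|exact: cvg_lim lim0].
Unshelve. all: by end_near.
Qed.

Lemma flatN q x : flat (- q) x = - flat q x.
Proof. by rewrite /flat; case: ifP => _; rewrite ?hornerN ?mulNr ?oppr0. Qed.

Lemma flatZ c q x : flat (c *: q) x = c * flat q x.
Proof. by rewrite /flat; case: ifP => _; rewrite ?hornerZ ?mulrA ?mulr0. Qed.

(** A term vanishing from b on plus a term vanishing up to a: the entries of the interpolating
    frames below have this form, which differentiation preserves. *)
Definition flat2 (a b : R) (q1 q2 : {poly R}) (t : R) : R := flat q1 (b - t) + flat q2 (t - a).

Lemma flat2_derive a b q1 q2 (t : R) :
  is_derive t 1 (flat2 a b q1 q2 : R -> R^o) (flat2 a b (- flat_step q1) (flat_step q2) t).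
Proof.
have d1 : is_derive t 1 (fun s : R => b - s : R^o) (0 - 1) := is_deriveB (is_derive_cst b t 1) (is_derive_id t 1).
have d2 : is_derive t 1 (fun s : R => s - a : R^o) (1 - 0) := is_deriveB (is_derive_id t 1) (is_derive_cst a t 1).
have e1 := @is_derive1_comp _ (flat q1) (fun s : R => b - s) t _ _ (flat_derive q1 _) d1.
have e2 := @is_derive1_comp _ (flat q2) (fun s : R => s - a) t _ _ (flat_derive q2 _) d2.
apply: is_derive_eq (is_deriveD e1 e2) _.
by rewrite /flat2 flatN sub0r subr0 mulrN !mulr1.
Qed.

Lemma derive_scale (f : R -> R^o) (v t df : R) : is_derive t 1 f df -> 'D_v f t = v * df.
Proof.
move=> h; have fd : differentiable f t by apply/derivable1_diffP; exact: ex_derive.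
have <- : 'D_1 f t = df by exact: derive_val.
rewrite !deriveE // -[v in LHS]mulr1 -[v * 1]/(v *: (1 : R^o)) linearZ //.
Qed.

Lemma smooth_flat2 a b q1 q2 : smooth_on setT (flat2 a b q1 q2 : R -> R^o).
Proof.
move=> s x _; suff [r1 [r2 ->]] : exists r1 r2,
    foldr (fun v (g : R -> R^o) => fun y => 'D_v g y) (flat2 a b q1 q2) s = flat2 a b r1 r2.
  by apply/derivable1_diffP; exact: (@ex_derive _ _ _ _ _ _ _ (flat2_derive a b r1 r2 x)).
elim: s => [|v s [r1 [r2 /= ->]]]; first by exists q1, q2.
exists (v *: - flat_step r1), (v *: flat_step r2); apply/funext => t.
by rewrite (derive_scale v (flat2_derive a b r1 r2 t)) /flat2 !flatZ mulrDr.
Qed.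
End Bump.

(** * Generic curves and their concatenation *)

Section GenericCurve.
Variables (R : realType) (m : nat).
Local Notation W := 'rV[R]_(m + m).
Implicit Types (Gam : R -> set W) (S T : 'M[R]_m).

Lemma smooth_on_cst (A : set R) (c : R) : smooth_on A (fun=> c : R^o).
Proof.
move=> s x _; suff [k ->] : exists k, foldr (fun v (g : R -> R^o) => fun y => 'D_v g y)
  (fun=> c) s = (fun=> k) by exact: differentiable_cst.
elim: s => [|v s [k /= ->]]; first by exists c.
by exists 0; apply/funext => y; rewrite derive_cst.
Qed.

Lemma smooth_map_on_sub k l (A B : set R) (F : R -> 'M[R]_(k, l)) :
  A `<=` B -> smooth_map_on B F -> smooth_map_on A F.
Proof. by move=> AB Fs i j; exact: smooth_on_sub AB (Fs i j). Qed.

Lemma open_nbhs_near t (N : set R) (P : R -> Prop) : open_nbhs t N -> (\forall s \near t, P s) ->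
  exists2 N' : set R, open_nbhs t N' & N' `<=` N `&` P.
Proof.
move=> [oN Nt] nP; exists (N `&` P^°); last by apply: setIS; exact: interior_subset.
by split; [apply: openI => //; exact: open_interior|split].
Qed.

Lemma lag_dot_near Gam Gam' t : (\forall s \near t, Gam s = Gam' s) -> lag_dot Gam t = lag_dot Gam' t.
Proof.
have key G G' v r : (\forall s \near t, G s = G' s) ->
    (exists (N : set R) (l : R -> W), [/\ open_nbhs t N, smooth_map_on N l,
      forall s, N s -> G s (l s), l t = v & r = sympl (l t) ('D_1 l t)]) ->
    (exists (N : set R) (l : R -> W), [/\ open_nbhs t N, smooth_map_on N l,
      forall s, N s -> G' s (l s), l t = v & r = sympl (l t) ('D_1 l t)]).
  move=> E [N [l [oN ls lG lt ->]]]; have [N' oN' sub] := open_nbhs_near oN E.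
  exists N', l; split=> //.
    by apply: smooth_map_on_sub ls => s /sub[].
  by move=> s /sub[Ns /= <-]; exact: lG.
move=> E; apply/funext => v; congr (xget 0 _); apply/seteqP; split=> r; apply: key => //.
by apply: filterS E => s ->.
Qed.

Lemma transversal_crossing_near (Del : set W) Gam Gam' t : (\forall s \near t, Gam s = Gam' s) ->
  transversal_crossing Del Gam t -> transversal_crossing Del Gam' t.
Proof.
move=> E; have Et : Gam t = Gam' t := nbhs_singleton E.
by rewrite /transversal_crossing Et (lag_dot_near E).
Qed.

(** Constancy near and beyond both ends is what makes concatenations smooth again. *)
Definition generic_curve (a b : R) Gam :=
  [/\ lag_smooth_curve setT Gam,
      exists2 d : R, 0 < d & forall t, t <= a + d -> Gam t = Gam a,
      exists2 d : R, 0 < d & forall t, b - d <= t -> Gam t = Gam b,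
      ~ train (@vertical R m) (Gam a) /\ ~ train (@vertical R m) (Gam b) &
      (forall t, crossings a b (@vertical R m) Gam t -> transversal_crossing (@vertical R m) Gam t) /\
      finite_set (crossings a b (@vertical R m) Gam)].

Lemma generic_glue a b c Gam Gam' : a < b -> b < c ->
  generic_curve a b Gam -> generic_curve b c Gam' -> Gam b = Gam' b ->
  generic_curve a c (fun t => if t <= b then Gam t else Gam' t).
Proof.
move=> ab bc [Gs [d1 d10 f1] [d2 d20 f2] [ta tb] [cr fin]] [Gs' [e1 e10 g1] [e2 e20 g2] [ta' tb'] [cr' fin']] E.
set G := fun t => _.
have bcF : (c <= b) = false by rewrite leNgt bc.
have lt_near t : t < b -> \forall s \near t, Gam s = G s.
  move=> tb1; near=> s; rewrite /G ifT // ltW //; near: s; exact: lt_nbhsl.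
have gt_near t : b < t -> \forall s \near t, Gam' s = G s.
  move=> tb1; near=> s; rewrite /G ifF //; apply/negbTE; rewrite -ltNge; near: s; exact: lt_nbhsr.
have b_near : \forall s \near b, G s = Gam b.
  near=> s; rewrite /G; case: ifP => _.
    apply: f2; apply: ltW; near: s; apply: lt_nbhsr; by rewrite ltrBlDr ltrDl.
  rewrite E; apply: g1; apply: ltW; near: s; apply: lt_nbhsl; by rewrite ltrDl.
have Ga : G a = Gam a by rewrite /G ltW.
have Gc : G c = Gam' c by rewrite /G bcF.
split.
- move=> t _; have [tb1|tb1|->] := ltgtP t b.
  + have [Gl [N [F [oN Fs GF]]]] := Gs t I; rewrite -(nbhs_singleton (lt_near _ tb1)); split=> //.
    have [N' oN' sub] := open_nbhs_near oN (lt_near t tb1); exists N', F; split=> //.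
      by apply: smooth_map_on_sub Fs => s /sub[].
    by move=> s /sub[Ns /= <-] _; exact: GF.
  + have [Gl [N [F [oN Fs GF]]]] := Gs' t I; rewrite -(nbhs_singleton (gt_near _ tb1)); split=> //.
    have [N' oN' sub] := open_nbhs_near oN (gt_near t tb1); exists N', F; split=> //.
      by apply: smooth_map_on_sub Fs => s /sub[].
    by move=> s /sub[Ns /= <-] _; exact: GF.
  + have [Gl [N [F [[_ Nb] Fs GF]]]] := Gs b I.
    rewrite (nbhs_singleton b_near); split=> //.
    have [N' oN' sub] := open_nbhs_near (open_nbhsT b) b_near.
    exists N', (fun=> F b); split=> //; first by move=> i j; exact: smooth_on_cst.
    by move=> s /sub[_ /= ->] _; exact: GF.
- exists (Num.min d1 (b - a)); first by rewrite lt_min d10 subr_gt0.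
  move=> t tad; rewrite Ga /G ifT ?f1 //.
    by apply: le_trans tad _; rewrite lerD2l ge_min lexx.
  by apply: le_trans tad _; rewrite -lerBrDl ge_min lexx orbT.
- exists (Num.min e2 ((c - b) / 2)); first by rewrite lt_min e20 divr_gt0 // subr_gt0.
  move=> t tad; rewrite Gc /G ifF ?g2 //.
    by apply: le_trans _ tad; rewrite lerD2l lerN2 ge_min lexx.
  apply/negbTE; rewrite -ltNge; apply: lt_le_trans _ tad.
  rewrite ltrBrDl -ltrBrDr gt_min; apply/orP; right.
  by rewrite ltr_pdivrMr // ltr_pMr ?subr_gt0 // ltr1n.
- by rewrite Ga Gc.
- split=> [t [/andP[at_ tc] tr]|].
    have [tb1|tb1|tb1] := ltgtP t b.
    + apply: transversal_crossing_near (lt_near t tb1) _; apply: cr; split.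
        by rewrite at_ ltW.
      by rewrite (nbhs_singleton (lt_near _ tb1)).
    + apply: transversal_crossing_near (gt_near t tb1) _; apply: cr'; split.
        by rewrite (ltW tb1).
      by rewrite (nbhs_singleton (gt_near _ tb1)).
    + by case: tb; rewrite -(nbhs_singleton b_near) -tb1.
  apply: (@sub_finite_set _ _ (crossings a b (@vertical R m) Gam `|` crossings b c (@vertical R m) Gam')).
    move=> t [/andP[at_ tc]]; rewrite /G; case: ifP => tb1 tr; [left|right]; split=> //.
      by rewrite at_.
    by rewrite tc ltW // ltNge tb1.
  by rewrite finite_setU.
Unshelve. all: by end_near.
Qed.

Lemma train_vertical (F : 'M[R]_(m, m + m)) : row_free F ->
  train (@vertical R m) (row_span F) <-> rsubmx F \notin unitmx.
Proof.
move=> Ff; split=> [[v [[x _ <-] vv] v0]|nu].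
  apply/negP => u; move: vv; rewrite /vertical /= -mulmx_rsub => xX.
  case/eqP: v0; rewrite (_ : x = 0) ?mul0mx //.
  by apply: (can_inj (mulmxK u)); rewrite xX mul0mx.
have : ~~ row_free (rsubmx F) by rewrite row_free_unit.
rewrite -kermx_eq0 => /rowV0Pn[x xk x0]; exists (x *m F); last first.
  by apply: contraNneq x0 => xF; apply/eqP; apply: (row_free_inj Ff); rewrite xF mul0mx.
split; first by exists x.
by rewrite /vertical /= -mulmx_rsub; apply/sub_kermxP.
Qed.
End GenericCurve.

(** * Interpolation between two coordinates in a chart *)

Section Pieces.
Variables (R : realType) (m : nat).

(** The coordinate T is kept beside the curve it spans: its continuity serves the homotopy, the
    genericity of the curve serves the count of crossings. *)
Definition chart_path (S : 'M[R]_m) (a b : R) (T0 T1 : 'M[R]_m) := exists T : R -> 'M[R]_m,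
  [/\ forall t, (T t)^T = T t, T a = T0, T b = T1,
      forall t, a <= t <= b -> mcvg (within [set t | a <= t <= b] (nbhs t)) T (T t) &
      generic_curve a b (fun t => row_span (shear_frame S (T t)))].

Lemma chart_path_glue S a b c T0 T1 T2 : a < b -> b < c ->
  chart_path S a b T0 T1 -> chart_path S b c T1 T2 -> chart_path S a c T0 T2.
Proof.
move=> ab bc [T [Ts Ta Tb Tc gT]] [T' [Ts' Ta' Tb' Tc' gT']].
have bcF : (c <= b) = false by rewrite leNgt bc.
pose X t := if t <= b then T t else T' t.
have X1 t : a <= t <= b -> T t = X t by rewrite /X => /andP[_ ->].
have X2 t : b <= t <= c -> T' t = X t.
  rewrite /X le_eqVlt => /andP[/orP[/eqP <- _|bt _]]; first by rewrite lexx Ta' Tb.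
  by rewrite leNgt bt.
exists X; split.
- by move=> t; rewrite /X; case: ifP.
- by rewrite -X1 // lexx ltW.
- by rewrite -X2 // lexx ltW.
- move=> t tac; rewrite -(segU (ltW ab) (ltW bc)); apply: mcvg_withinU.
    case: (pselect (a <= t <= b)) => tab; last exact: mcvg_within_out (@closed_seg _ _ _) tab.
    by rewrite -X1 //; apply: (mcvg_within_eq X1); exact: Tc.
  case: (pselect (b <= t <= c)) => tab; last exact: mcvg_within_out (@closed_seg _ _ _) tab.
  by rewrite -X2 //; apply: (mcvg_within_eq X2); exact: Tc'.
have := generic_glue ab bc gT gT'; rewrite Tb Ta' => /(_ erefl).
by congr generic_curve; apply/funext => t; rewrite /X; case: ifP.
Qed.

Lemma flat1E (x : R) : 0 < x -> flat 1 x = expR (- x^-1).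
Proof. by move=> x0; rewrite /flat x0 hornerC mul1r. Qed.

Lemma flat_npos (q : {poly R}) x : x <= 0 -> flat q x = 0.
Proof. by rewrite leNgt /flat => /negbTE ->. Qed.

Lemma flat1_ge0 (x : R) : 0 <= flat 1 x.
Proof. by case: (ltrP 0 x) => h; [rewrite flat1E // expR_ge0|rewrite flat_npos]. Qed.

Lemma flat1_gt0 (x : R) : (0 < flat 1 x) = (0 < x).
Proof. by case: (ltrP 0 x) => h; [rewrite flat1E // expR_gt0|rewrite flat_npos // ltxx]. Qed.

Lemma flat1_lt (x y : R) : 0 < x -> x < y -> flat 1 x < flat 1 y.
Proof.
move=> x0 xy; have y0 := lt_trans x0 xy; rewrite !flat1E // ltr_expR ltrN2.
by rewrite ltf_pV2 ?posrE.
Qed.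

Lemma flat1_step_gt0 (x : R) : 0 < x -> 0 < flat (flat_step 1) x.
Proof.
move=> x0; rewrite /flat x0 mulr_gt0 ?expR_gt0 // /flat_step derivC subr0 mulr1.
by rewrite hornerXn exprn_gt0 // invr_gt0.
Qed.

Lemma shear_frameJ S (T T' : 'M[R]_m) : S^T = S -> T'^T = T' ->
  shear_frame S T *m Jmx R m *m (shear_frame S T')^T = T' - T.
Proof.
move=> Ss Ts; rewrite row_frameJ linearD /= trmx1 trmx_mul Ss Ts mulmxDl mulmxDr mul1mx mulmx1 mulmxA.
by rewrite opprD addrACA subrr addr0.
Qed.

Section Piece.
Variables (S T0 T1 : 'M[R]_m) (a b : R).
Hypothesis (Ss : S^T = S) (T0s : T0^T = T0) (T1s : T1^T = T1) (ab : a < b).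

(** The transition takes place in the middle third; the outer thirds are the flat ends. *)
Let d := (b - a) / 3.
Let a1 := a + d.
Let b1 := b - d.
Definition weight0 (t : R) := flat 1 (b1 - t).
Definition weight1 (t : R) := flat 1 (t - a1).
Local Notation w0 := weight0.
Local Notation w1 := weight1.
(** This is w0 w1' - w0' w1. *)
Definition wronskian (t : R) :=
  w0 t * flat (flat_step 1) (t - a1) + w1 t * flat (flat_step 1) (b1 - t).

Let d0 : 0 < d. Proof. by rewrite divr_gt0 // subr_gt0. Qed.
Let a1b1 : a1 < b1.
Proof. by rewrite /a1 /b1 /d; move: ab; lra. Qed.

Definition blend (t : R) : 'M[R]_m := (w0 t + w1 t)^-1 *: (w0 t *: T0 + w1 t *: T1).
Definition blend_curve (t : R) := row_span (shear_frame S (blend t)).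
(** An unnormalized frame of the same subspace: linear in the weights, it can be differentiated
    without a quotient. *)
Let F t : 'M[R]_(m, m + m) := w0 t *: shear_frame S T0 + w1 t *: shear_frame S T1.

Lemma weight_gt0 t : 0 < w0 t + w1 t.
Proof.
case: (ltrP t b1) => h; first by rewrite ltr_pwDl ?flat1_ge0 // flat1_gt0 subr_gt0.
by rewrite ltr_wpDl ?flat1_ge0 // flat1_gt0 subr_gt0 (lt_le_trans a1b1).
Qed.

Lemma blend_sym t : (blend t)^T = blend t.
Proof. by rewrite /blend linearZ /= linearD /= !linearZ /= T0s T1s. Qed.

Lemma blend_left t : t <= a1 -> blend t = T0.
Proof.
move=> ta; have := weight_gt0 t; rewrite /blend.
have -> : w1 t = 0 by rewrite /weight1 flat_npos // subr_le0.
by rewrite addr0 scale0r addr0 => h; rewrite scalerA mulVf ?scale1r // gt_eqF.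
Qed.

Lemma blend_right t : b1 <= t -> blend t = T1.
Proof.
move=> ta; have := weight_gt0 t; rewrite /blend.
have -> : w0 t = 0 by rewrite /weight0 flat_npos // subr_le0.
by rewrite add0r scale0r add0r => h; rewrite scalerA mulVf ?scale1r // gt_eqF.
Qed.

Let FE t : F t = (w0 t + w1 t) *: shear_frame S (blend t).
Proof.
have h : w0 t + w1 t != 0 by rewrite gt_eqF // weight_gt0.
rewrite /F /shear_frame !scale_row_mx add_row_mx; congr row_mx; last first.
  by rewrite /blend scalerA mulfV // scale1r.
rewrite /blend -scalemxAl !scalerDr scalerA mulfV // scale1r mulmxDl -!scalemxAl scalerDl.
by rewrite addrACA.
Qed.

Lemma blend_lag t : lagframe (F t).
Proof.
have h : w0 t + w1 t != 0 by rewrite gt_eqF // weight_gt0.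
have [Sf SJ] := shear_frame_lag Ss (blend_sym t).
rewrite FE; split; first by rewrite /row_free mxrank_scale_nz.
by rewrite linearZ /= -!scalemxAl -scalemxAr SJ !scaler0.
Qed.

Lemma blend_curveE t : blend_curve t = row_span (F t).
Proof.
have h : w0 t + w1 t != 0 by rewrite gt_eqF // weight_gt0.
rewrite /blend_curve FE -mul_scalar_mx row_span_mul //.
by rewrite unitmxE det_scalar unitfE expf_neq0.
Qed.

Lemma weight0_derive (t : R) : is_derive t 1 (w0 : R -> R^o) (- flat (flat_step 1) (b1 - t)).
Proof.
have := flat2_derive a1 b1 1 0 t.
have -> : (flat2 a1 b1 1 0 : R -> R^o) = w0.
  by apply/funext => s; rewrite /flat2 /weight0 [flat 0 _]/flat horner0 mul0r if_same addr0.
rewrite /flat2 flatN; congr is_derive.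
rewrite [X in _ + X](_ : _ = 0) ?addr0 //.
by rewrite /flat /flat_step deriv0 subr0 mulr0 horner0 mul0r if_same.
Qed.

Lemma weight1_derive (t : R) : is_derive t 1 (w1 : R -> R^o) (flat (flat_step 1) (t - a1)).
Proof.
have := flat2_derive a1 b1 0 1 t.
have -> : (flat2 a1 b1 0 1 : R -> R^o) = w1.
  by apply/funext => s; rewrite /flat2 /weight1 [flat 0 _]/flat horner0 mul0r if_same add0r.
rewrite /flat2 flatN; congr is_derive.
rewrite [X in - X](_ : _ = 0) ?oppr0 ?add0r //.
by rewrite /flat /flat_step deriv0 subr0 mulr0 horner0 mul0r if_same.
Qed.

Lemma blend_smooth : smooth_map_on setT F.
Proof.
move=> i j; have -> : (fun t => F t i j) = flat2 a1 b1
    ((shear_frame S T0 i j) *: 1) ((shear_frame S T1 i j) *: 1).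
  by apply/funext => t; rewrite /F mxDE !mxE /flat2 !flatZ mulrC [X in _ + X]mulrC.
exact: smooth_flat2.
Qed.

(** The frames of T0 and T1 pair to T1 - T0 with each other and to 0 with themselves, so only the
    Wronskian of the weights survives. *)
Lemma blend_dot t x : lag_dot blend_curve t (x *m F t) = wronskian t * (x *m (T1 - T0) *m x^T) 0 0.
Proof.
rewrite (@lag_dotE R m blend_curve t setT F) //; last 4 first.
- exact: open_nbhsT.
- exact: blend_smooth.
- by move=> s _; exact: blend_curveE.
- by move=> s _; exact: blend_lag.
have -> : 'D_1 F t = (- flat (flat_step 1) (b1 - t)) *: shear_frame S T0 +
    flat (flat_step 1) (t - a1) *: shear_frame S T1.
  apply: (mderiv_unique (smooth_mderiv blend_smooth _)) => // i j.
  have := is_deriveD (is_deriveM (weight0_derive t) (is_derive_cst (shear_frame S T0 i j) t 1))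
    (is_deriveM (weight1_derive t) (is_derive_cst (shear_frame S T1 i j) t 1)).
  rewrite (_ : (fun s => F s i j) = w0 * cst (shear_frame S T0 i j) + w1 * cst (shear_frame S T1 i j)).
    move=> h; apply: is_derive_eq h _; rewrite /GRing.scale /= !mulr0 !add0r mxDE !mxE.
    by rewrite mulrC [X in _ + X]mulrC.
  by apply/funext => s; rewrite /F mxDE !mxE.
rewrite symplE trmx_mul; set G := _ + _; rewrite !mulmxA -(mulmxA x) -(mulmxA x).
have -> : F t *m Jmx R m *m G^T = wronskian t *: (T1 - T0).
  rewrite /F /G linearD /= !linearZ /= mulmxDl !mulmxDr !mulmxDl -!scalemxAl -!scalemxAr.
  rewrite !shear_frameJ // !subrr !scaler0 addr0 add0r !scalerA -[T0 - T1]opprB scalerN -scaleNr.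
  by rewrite -scalerDl /wronskian mulrN opprK addrC.
by rewrite -scalemxAr -scalemxAl mxE.
Qed.

Lemma blend_train t :
  train (@vertical R m) (blend_curve t) <-> w0 t *: T0 + w1 t *: T1 \notin unitmx.
Proof.
rewrite blend_curveE train_vertical; last by case: (blend_lag t).
by rewrite /F linearD /= !linearZ /= !row_mxKr.
Qed.

Lemma blend_path : T0 \in unitmx -> T1 \in unitmx ->
  (forall t, w0 t *: T0 + w1 t *: T1 \notin unitmx ->
     transversal_crossing (@vertical R m) blend_curve t) ->
  finite_set [set t | w0 t *: T0 + w1 t *: T1 \notin unitmx] ->
  chart_path S a b T0 T1.
Proof.
move=> u0 u1 tr fin; exists blend.
have aa1 : a <= a1 by rewrite lerDl ltW.
have b1b : b1 <= b by rewrite gerBl ltW.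
have Ta : blend a = T0 by exact: blend_left.
have Tb : blend b = T1 by exact: blend_right.
split=> //.
- exact: blend_sym.
- move=> t _; apply: mcvg_within_sub (subsetT _) _.
  have cw (f : R -> R) (f' : R) : is_derive t 1 (f : R -> R^o) f' -> f s @[s --> within setT (nbhs t)] --> (f t : R^o).
    move=> h; have : {for t, continuous (f : R -> R^o)}.
      by apply: differentiable_continuous; apply/derivable1_diffP; exact: ex_derive.
    by apply: cvg_trans; apply: cvg_app; exact: cvg_within.
  have FF : Filter (within setT (nbhs t)) by exact: within_filter.
  have c0 := cw _ _ (weight0_derive t); have c1 := cw _ _ (weight1_derive t).
  apply: mcvgZ; first by apply: cvgV; [rewrite gt_eqF // weight_gt0|exact: cvgD].
  by apply: mcvgD; apply: mcvgZ => //; exact: mcvg_cst.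
split.
- move=> t _; split; first by apply/lagframeP; apply: shear_frame_lag => //; exact: blend_sym.
  exists setT, F; split=> //; [exact: open_nbhsT|exact: blend_smooth|].
  by move=> s _ _; exact: blend_curveE.
- exists d; [exact: d0|move=> t ta].
  exact: (congr1 (fun T => row_span (shear_frame S T)) (etrans (blend_left ta) (esym Ta))).
- exists d; [exact: d0|move=> t ta].
  exact: (congr1 (fun T => row_span (shear_frame S T)) (etrans (blend_right ta) (esym Tb))).
- rewrite Ta Tb; split; move=> /train_vertical.
    by move=> /(_ (shear_frame_lag Ss T0s).1); rewrite row_mxKr u0.
  by move=> /(_ (shear_frame_lag Ss T1s).1); rewrite row_mxKr u1.
split=> [t [_ /blend_train]|]; first exact: tr.
by apply: sub_finite_set fin => t [_ /blend_train].
Qed.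

(** A combination of positive definite matrices with nonnegative weights, not both zero, is
    definite: this piece has no crossings. *)
Lemma blend_path_posdef : T0 \in unitmx -> T1 \in unitmx ->
  (forall x, x != 0 -> 0 < qform T0 x) -> (forall x, x != 0 -> 0 < qform T1 x) ->
  chart_path S a b T0 T1.
Proof.
move=> u0 u1 p0 p1.
have u t : w0 t *: T0 + w1 t *: T1 \in unitmx.
  rewrite -row_free_unit -kermx_eq0; apply: contraT => /rowV0Pn[x /sub_kermxP xk x0].
  have := congr1 (fun A => (A *m x^T) 0 0) xk.
  rewrite mul0mx [RHS]mxE mulmxDr mulmxDl -!scalemxAr -!scalemxAl mxDE mxE [X in _ + X]mxE.
  move=> /eqP; rewrite paddr_eq0 ?mulr_ge0 ?flat1_ge0 //; [|exact/ltW/p0|exact/ltW/p1].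
  rewrite !mulf_eq0 !(gt_eqF (p0 x x0), gt_eqF (p1 x x0)) !orbF => /andP[/eqP h0 /eqP h1].
  by have := weight_gt0 t; rewrite h0 h1 addr0 ltxx.
apply: blend_path => //; first by move=> t; rewrite u.
by apply: (@sub_finite_set _ _ set0) => // t /=; rewrite u.
Qed.

(* The diagonal entries w0 e_i + w1 f_i vanish at different times, because
   the ratios e_i / f_i are distinct, and do so with nonzero speed. *)
Lemma blend_path_diag (P : 'M[R]_m) (e f : 'rV[R]_m) :
  P \in unitmx -> T0 = P *m diag_mx e *m P^T -> T1 = P *m diag_mx f *m P^T ->
  (forall i, e 0 i != 0) -> (forall i, f 0 i != 0) ->
  (forall i j, i != j -> e 0 i * f 0 j != e 0 j * f 0 i) ->
  chart_path S a b T0 T1.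
Proof.
move=> Pu E0 E1 e0 f0 ef.
pose k t := w0 t *: e + w1 t *: f.
have kE t i : k t 0 i = w0 t * e 0 i + w1 t * f 0 i by rewrite !mxE.
have NE t : w0 t *: T0 + w1 t *: T1 = P *m diag_mx (k t) *m P^T.
  by rewrite E0 E1 linearD /= !linearZ /= mulmxDr mulmxDl -!scalemxAr -!scalemxAl.
have diag_unit (c : 'rV[R]_m) : (diag_mx c \in unitmx) = [forall i, c 0 i != 0].
  rewrite unitmxE det_diag unitfE; apply/idP/forallP => [/prodf_neq0 h i|h]; first exact: h.
  by apply/prodf_neq0 => i _; exact: h.
have uE (c : 'rV[R]_m) : (P *m diag_mx c *m P^T \in unitmx) = [forall i, c 0 i != 0].
  by rewrite !unitmx_mul unitmx_tr Pu andbT /= diag_unit.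
have zero_weights t i : k t 0 i = 0 -> a1 < t < b1.
  rewrite kE => h; apply/andP; split; rewrite ltNge; apply/negP => ht; have := weight_gt0 t.
    have w10 : w1 t = 0 by rewrite /weight1 flat_npos // subr_le0.
    move/eqP: h; rewrite w10 mul0r addr0 mulf_eq0 (negbTE (e0 i)) orbF => /eqP ->.
    by rewrite addr0 ltxx.
  have w00 : w0 t = 0 by rewrite /weight0 flat_npos // subr_le0.
  move/eqP: h; rewrite w00 mul0r add0r mulf_eq0 (negbTE (f0 i)) orbF => /eqP ->.
  by rewrite addr0 ltxx.
have pos t : a1 < t < b1 -> 0 < w0 t /\ 0 < w1 t.
  by move=> /andP[h1 h2]; rewrite !flat1_gt0 !subr_gt0.
have wr_pos t : a1 < t < b1 -> 0 < wronskian t.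
  move=> h; have [p0 p1] := pos t h; case/andP: h => h1 h2.
  by rewrite addr_gt0 // mulr_gt0 // flat1_step_gt0 // subr_gt0.
(* In the middle third w0 decreases and w1 increases strictly, so w1 / w0 takes the value -e_i / f_i
   at most once. *)
have uniq_t i s t : s < t -> k s 0 i = 0 -> k t 0 i = 0 -> False.
  move=> st ks kt; have hs := zero_weights _ _ ks; have ht := zero_weights _ _ kt.
  have [s0 s1] := pos s hs; have [t0 t1] := pos t ht.
  move: ks kt; rewrite !kE => ks kt.
  have l0 : w0 t < w0 s.
    by apply: flat1_lt; [case/andP: ht => _; rewrite subr_gt0|rewrite ltrD2l ltrN2].
  have l1 : w1 s < w1 t.
    by apply: flat1_lt; [case/andP: hs; rewrite subr_gt0|rewrite ltrD2r].
  have : (w0 s * w1 t - w0 t * w1 s) * e 0 i = 0.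
    transitivity (w1 t * (w0 s * e 0 i + w1 s * f 0 i) - w1 s * (w0 t * e 0 i + w1 t * f 0 i)).
      by ring.
    by rewrite ks kt !mulr0 subrr.
  move=> /eqP; rewrite mulf_eq0 (negbTE (e0 i)) orbF subr_eq0 => /eqP h.
  have : w0 t * w1 s < w0 s * w1 t by apply: ltr_pM => //; exact: ltW.
  by rewrite h ltxx.
have uniq_i i j t : k t 0 i = 0 -> k t 0 j = 0 -> i = j.
  move=> ki kj; have [p0 p1] := pos t (zero_weights _ _ ki); apply/eqP.
  apply: contraT => /ef /eqP []; move: ki kj; rewrite !kE => ki kj.
  have : w0 t * (e 0 i * f 0 j - e 0 j * f 0 i) = 0.
    transitivity (f 0 j * (w0 t * e 0 i + w1 t * f 0 i) - f 0 i * (w0 t * e 0 j + w1 t * f 0 j)).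
      by ring.
    by rewrite ki kj !mulr0 subrr.
  by move=> /eqP; rewrite mulf_eq0 gt_eqF //= subr_eq0 => /eqP.
have singular t : w0 t *: T0 + w1 t *: T1 \notin unitmx -> exists i, k t 0 i = 0.
  by rewrite NE uE negb_forall => /existsP[i]; rewrite negbK => /eqP; exists i.
apply: blend_path.
- by rewrite E0 uE; apply/forallP.
- by rewrite E1 uE; apply/forallP.
- move=> t /singular[i ki].
  pose x0 : 'rV[R]_m := delta_mx 0 i *m invmx P.
  have x0P : x0 *m P = delta_mx 0 i by rewrite mulmxKV.
  have NF : rsubmx (F t) = w0 t *: T0 + w1 t *: T1.
    by rewrite /F linearD /= !linearZ /= !row_mxKr.
  have xN x : x *m rsubmx (F t) = 0 -> exists c, x = c *: x0.
    rewrite NF NE !mulmxA => h; exists ((x *m P) 0 i).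
    have hz : x *m P *m diag_mx (k t) = 0.
      by apply: (can_inj (mulmxK (_ : P^T \in unitmx))); rewrite ?unitmx_tr // h mul0mx.
    apply: (can_inj (mulmxK Pu)); rewrite -scalemxAl x0P; apply/rowP => j.
    have := congr1 (fun A : 'rV_m => A 0 j) hz; rewrite mul_mx_diag !mxE eqxx /=.
    have [->|ji] := eqVneq j i; first by rewrite mulr1.
    move=> /eqP; rewrite mulf_eq0 mulr0 => /orP[/eqP //|/eqP kj].
    by case/eqP: ji; apply: (uniq_i _ _ t) => //; rewrite kE.
  have Nx0 : x0 *m rsubmx (F t) = 0.
    rewrite NF NE !mulmxA x0P -rowE (_ : row i _ = 0) ?mul0mx //; apply/rowP => j.
    by rewrite row_diag_mx ki scale0r.
  have Fl := blend_lag t.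
  have x0n : x0 != 0.
    apply/negP => /eqP z; have := congr1 (fun A : 'rV_m => A 0 i) x0P.
    by rewrite z mul0mx !mxE !eqxx => /eqP; rewrite eq_sym oner_eq0.
  have xF x : x *m F t = 0 -> x = 0.
    by move=> h; apply: (row_free_inj Fl.1); rewrite h mul0mx.
  have memE v : (blend_curve t `&` @vertical R m) v -> exists c, v = (c *: x0) *m F t.
    rewrite blend_curveE => -[[x _ <-]]; rewrite /vertical /= -mulmx_rsub => /xN[c ->].
    by exists c.
  (* On x0 the form has the value f_i - e_i; were this zero, the vanishing entry would be (w0 + w1)
     e_i, which is nonzero. *)
  have q0 : qform (T1 - T0) x0 != 0.
    have qd (c : 'rV[R]_m) : qform (P *m diag_mx c *m P^T) x0 = c 0 i.
      rewrite /qform !mulmxA x0P -!mulmxA -trmx_mul x0P mulmxA.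
      by rewrite -rowE trmx_delta -colE !mxE eqxx mulr1n.
    rewrite qformB E0 E1 !qd subr_eq0; apply/eqP => fe.
    have := ki; rewrite kE fe -mulrDl => /eqP.
    by rewrite mulf_eq0 (negbTE (e0 i)) orbF gt_eqF // weight_gt0.
  split.
    exists (x0 *m F t); first by apply: contraNneq x0n => /xF ->.
    apply/seteqP; split=> v.
      by move=> /memE[c ->]; exists c; rewrite ?scalemxAl.
    move=> [c _ <-]; rewrite blend_curveE; split; first by exists (c *: x0); rewrite ?scalemxAl.
    by rewrite /vertical /= scalemxAl -mulmx_rsub -scalemxAl Nx0 scaler0.
  move=> v /memE[c ->] v0; rewrite blend_dot mulf_neq0 //.
    by rewrite gt_eqF // wr_pos // (zero_weights _ _ ki).
  have c0 : c != 0 by apply: contraNneq v0 => ->; rewrite scale0r mul0mx.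
  have -> : ((c *: x0) *m (T1 - T0) *m (c *: x0)^T) 0 0 = c * (c * qform (T1 - T0) x0).
    by rewrite [(c *: x0)^T]linearZ /= -scalemxAr -!scalemxAl mxE [X in _ * X]mxE.
  by rewrite !mulf_neq0.
have : finite_set (\bigcup_(i in [set: 'I_m]) [set t | k t 0 i = 0]).
  apply: bigcup_finite; first exact: finite_finset.
  move=> i _; case: (pselect (exists t, k t 0 i = 0)) => [[t kt]|nk].
    apply: (@sub_finite_set _ _ [set t]) => // s ks /=.
    by have [st|st|//] := ltgtP s t; [case: (uniq_t _ _ _ st ks kt)|case: (uniq_t _ _ _ st kt ks)].
  by apply: (@sub_finite_set _ _ set0) => // s ks; case: nk; exists s.
by apply: sub_finite_set => t /singular[i ki]; exists i.
Qed.
End Piece.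
End Pieces.

(** * Joining two invertible coordinates in a chart *)

Section ChartPath.
Variables (R : realType) (m : nat).

Lemma qform_diag_gt0 (P : 'M[R]_m) (f : 'rV[R]_m) x : P \in unitmx -> (forall i, 0 < f 0 i) ->
  x != 0 -> 0 < qform (P *m diag_mx f *m P^T) x.
Proof.
move=> Pu f0 x0; have -> : qform (P *m diag_mx f *m P^T) x = qform (diag_mx f) (x *m P).
  by rewrite /qform !mulmxA trmx_mul -!mulmxA.
have /rV_neq0P[i yi] : x *m P != 0.
  by apply: contraNneq x0 => h; apply/eqP; apply: (can_inj (mulmxK Pu)); rewrite h mul0mx.
rewrite qform_diag (bigD1 i) //= ltr_pwDl //; first by rewrite mulr_gt0 // exprn_even_gt0.
by apply: sumr_ge0 => j _; rewrite mulr_ge0 ?exprn_even_ge0 // ltW.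
Qed.

Lemma diagonalize (T : 'M[R]_m) : T^T = T -> T \in unitmx ->
  exists (P : 'M[R]_m) (e : 'rV[R]_m),
    [/\ P \in unitmx, T = P *m diag_mx e *m P^T & forall i, e 0 i != 0].
Proof.
move=> Ts Tu; have [k [P [e [Pf Pfull E _]]]] := sgP Ts.
have km : k = m by rewrite -(eqP Pf) (eqP Pfull).
subst k; have Pu : P \in unitmx by rewrite -row_free_unit.
have TE : T = invmx P *m diag_mx e *m (invmx P)^T.
  by rewrite -E trmx_inv !mulmxA mulVmx // mul1mx mulmxK // unitmx_tr.
exists (invmx P), e; split=> //; first by rewrite unitmx_inv.
have : diag_mx e \in unitmx by rewrite -E !unitmx_mul Pu Tu unitmx_tr.
by rewrite unitmxE det_diag unitfE => /prodf_neq0 h i; exact: h.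
Qed.

(* T0 and T1 are joined through positive definite matrices Tp and Tq, with
   crossings only between T0 and Tp and between Tq and T1. *)
Lemma exists_chart_path (S T0 T1 : 'M[R]_m) a b : S^T = S -> T0^T = T0 -> T1^T = T1 ->
  T0 \in unitmx -> T1 \in unitmx -> a < b -> chart_path S a b T0 T1.
Proof.
move=> Ss T0s T1s u0 u1 ab.
have [P [e [Pu TE e0]]] := diagonalize T0s u0; have [P' [e' [Pu' TE' e0']]] := diagonalize T1s u1.
(* The absolute values are taken to make the entries positive, and the factors i + 1 to make the
   ratios to the original entries pairwise distinct. *)
pose pos (e : 'rV[R]_m) : 'rV[R]_m := \row_i (i.+1%:R * `|e 0 i|).
have posE (c : 'rV[R]_m) i : pos c 0 i = i.+1%:R * `|c 0 i| by rewrite mxE.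
have pos0 (c : 'rV[R]_m) : (forall i, c 0 i != 0) -> forall i, 0 < pos c 0 i.
  by move=> c0 i; rewrite posE mulr_gt0 ?normr_gt0 ?ltr0Sn.
have posn (c : 'rV[R]_m) : (forall i, c 0 i != 0) -> forall i, pos c 0 i != 0.
  by move=> c0 i; rewrite gt_eqF // pos0.
have ratio (c : 'rV[R]_m) : (forall i, c 0 i != 0) ->
    forall i j, i != j -> c 0 i * pos c 0 j != c 0 j * pos c 0 i.
  move=> c0 i j ij; apply/eqP => /(congr1 Num.norm); rewrite !posE !normrM !normr_id !normr_nat.
  have -> : `|c 0 i| * (j.+1%:R * `|c 0 j|) = `|c 0 i| * `|c 0 j| * j.+1%:R by ring.
  have -> : `|c 0 j| * (i.+1%:R * `|c 0 i|) = `|c 0 i| * `|c 0 j| * i.+1%:R by ring.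
  have nz : `|c 0 i| * `|c 0 j| != 0 by rewrite mulf_neq0 ?normr_eq0.
  move=> /(mulfI nz)/eqP; rewrite eqr_nat eqSS => /eqP/ord_inj ji.
  by rewrite ji eqxx in ij.
pose Tp := P *m diag_mx (pos e) *m P^T; pose Tq := P' *m diag_mx (pos e') *m P'^T.
have dsym (A : 'M[R]_m) (c : 'rV[R]_m) : (A *m diag_mx c *m A^T)^T = A *m diag_mx c *m A^T.
  by rewrite sym_congr // tr_diag_mx.
have dunit (A : 'M[R]_m) (c : 'rV[R]_m) : A \in unitmx -> (forall i, c 0 i != 0) ->
    A *m diag_mx c *m A^T \in unitmx.
  move=> Au c0; rewrite !unitmx_mul unitmx_tr Au andbT /= unitmxE det_diag unitfE.
  by apply/prodf_neq0 => i _.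
pose d := (b - a) / 3; have d0 : 0 < d by rewrite divr_gt0 // subr_gt0.
have h1 : a < a + d by rewrite ltrDl.
have h2 : a + d < a + d + d by rewrite ltrDl.
have h3 : a + d + d < b by rewrite /d; move: ab; lra.
apply: (chart_path_glue (lt_trans h1 h2) h3 (T1 := Tq)); first apply: (chart_path_glue h1 h2 (T1 := Tp)).
- exact: (blend_path_diag Ss T0s (dsym _ _) h1 Pu TE erefl e0 (posn _ e0) (ratio _ e0)).
- apply: (blend_path_posdef Ss (dsym _ _) (dsym _ _) h2 (dunit _ _ Pu (posn _ e0)) (dunit _ _ Pu' (posn _ e0'))).
    by move=> x x0; apply: qform_diag_gt0 => //; exact: pos0.
  by move=> x x0; apply: qform_diag_gt0 => //; exact: pos0.
apply: (blend_path_diag Ss (dsym _ _) T1s h3 Pu' erefl TE' (posn _ e0') e0').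
by move=> i j ij; rewrite mulrC [X in _ != X]mulrC eq_sym ratio.
Qed.
End ChartPath.

(** * Existence of generic curves *)


Section Glue.
Variables (R : realType) (m : nat).
Local Notation W := 'rV[R]_(m + m).

Lemma lcvg_withinU (X : topologicalType) (D D' : set X) (x : X) (Lam : X -> set W) L :
  lcvg (within D (nbhs x)) Lam L -> lcvg (within D' (nbhs x)) Lam L ->
  lcvg (within (D `|` D') (nbhs x)) Lam L.
Proof.
move=> h h' S Ss inS; have [h1 h2] := h S Ss inS; have [h1' h2'] := h' S Ss inS.
by split; [exact: near_withinU|exact: mcvg_withinU].
Qed.

Lemma lcvg_within_out (X : topologicalType) (D : set X) (x : X) (Lam : X -> set W) L :
  closed D -> ~ D x -> lcvg (within D (nbhs x)) Lam L.
Proof.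
by move=> cD nD S Ss inS; split; [exact: near_within_out|exact: mcvg_within_out].
Qed.

Lemma lag_continuous_glue (X : topologicalType) (D1 D2 : set X) (H1 H2 : X -> set W) :
  closed D1 -> closed D2 -> lag_continuous D1 H1 -> lag_continuous D2 H2 ->
  (forall x, D1 x -> D2 x -> H1 x = H2 x) ->
  lag_continuous (D1 `|` D2) (fun x => if `[< D1 x >] then H1 x else H2 x).
Proof.
move=> c1 c2 /lag_continuousP L1 /lag_continuousP L2 E; set H := fun x => _.
have HE1 x : D1 x -> H1 x = H x by move=> h; rewrite /H asboolT.
have HE2 x : D2 x -> H2 x = H x.
  by move=> h; rewrite /H; case: asboolP => // h1; rewrite E.
apply/lag_continuousP => x Dx; split.
  by case: Dx => [h|h]; [rewrite -HE1 //; case: (L1 x h)|rewrite -HE2 //; case: (L2 x h)].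
have near_eq D H' : (forall x, D x -> H' x = H x) -> \forall y \near within D (nbhs x), H' y = H y.
  by move=> h; apply/near_withinP; apply: nearW => y /h.
apply: lcvg_withinU.
  case: (pselect (D1 x)) => h; last exact: lcvg_within_out.
  apply: (@lcvg_near_eq _ _ _ _ (within_filter _ (nbhs_filter x)) H1); first exact: near_eq.
  by rewrite -HE1 //; case: (L1 x h).
case: (pselect (D2 x)) => h; last exact: lcvg_within_out.
apply: (@lcvg_near_eq _ _ _ _ (within_filter _ (nbhs_filter x)) H2); first exact: near_eq.
by rewrite -HE2 //; case: (L2 x h).
Qed.

Lemma lcvg_shear (X : Type) (F : set_system X) (FF : Filter F) (S : 'M[R]_m) (T : X -> 'M[R]_m) T0 :
  S^T = S -> T0^T = T0 -> (\forall x \near F, (T x)^T = T x) -> mcvg F T T0 ->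
  lcvg F (fun x => row_span (shear_frame S (T x))) (row_span (shear_frame S T0)).
Proof.
move=> Ss Ts nT Tc; apply: lcvg_frames; [|exact: shear_frame_lag|].
  apply: mcvg_row => //; apply: mcvgD; first exact: mcvg_cst.
  by apply: mcvgM => //; exact: mcvg_cst.
by apply: filterS nT => s Tss; exact: shear_frame_lag.
Qed.

Lemma lag_continuous_shear (X : topologicalType) (D : set X) (S : 'M[R]_m) (T : X -> 'M[R]_m) :
  S^T = S -> (forall x, D x -> (T x)^T = T x) ->
  (forall x, D x -> mcvg (within D (nbhs x)) T (T x)) ->
  lag_continuous D (fun x => row_span (shear_frame S (T x))).
Proof.
move=> Ss Ts Tc; apply/lag_continuousP => x Dx; split.
  by exists (shear_frame S (T x)) => //; apply: shear_frame_lag => //; exact: Ts.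
apply: lcvg_shear => //; [exact: Ts| |exact: Tc].
by apply/near_withinP; apply: nearW => y /Ts.
Qed.

(** The pencil lemma with m + 1 equally spaced values in [0, e). *)
Lemma exists_unit_shift (T : 'M[R]_m) (e : R) : T^T = T -> 0 < e ->
  exists2 c : R, `|c| < e & T + c *: 1%:M \in unitmx.
Proof.
move=> Ts e0; pose c (i : 'I_m.+1) : R := e / m.+1%:R * i%:R.
have c0 : 0 < e / m.+1%:R by rewrite divr_gt0 // ltr0Sn.
have c_inj : injective c.
  by move=> i j /(mulfI (lt0r_neq0 c0))/eqP; rewrite eqr_nat => /eqP /ord_inj.
have [||||i Hi] := @exists_unit_pencil R m m T 1%:M 1%:M 1%:M c _ _ c_inj.
- by rewrite trmx1 mulmx1.
- by rewrite trmx1 mulmx1.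
- by move=> v ->.
- by move=> v _; rewrite mulmx1.
exists (- c i); last by rewrite scaleNr.
rewrite normrN ger0_norm; last by rewrite mulr_ge0 // ltW.
by rewrite /c mulrAC ltr_pdivrMr ?ltr0Sn // ltr_pM2l // ltr_nat.
Qed.

Lemma mcvg_comp (X Y : Type) (F : set_system X) (G : set_system Y) k l (f : Y -> X)
    (g : X -> 'M[R]_(k, l)) L :
  f @ G --> F -> mcvg F g L -> mcvg G (fun y => g (f y)) L.
Proof. by move=> fG gF i j; exact: (cvg_comp _ _ fG (gF i j)). Qed.

Lemma not_train_unit (S T : 'M[R]_m) : S^T = S -> T^T = T ->
  ~ train (@vertical R m) (row_span (shear_frame S T)) <-> T \in unitmx.
Proof.
move=> Ss Ts; have [Ff _] := shear_frame_lag Ss Ts.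
split=> [h|Tu /(train_vertical Ff)]; last by rewrite row_mxKr Tu.
by apply: contraT => nu; case: h; apply/(train_vertical Ff); rewrite row_mxKr.
Qed.

(** * Homotopy to a generic curve *)

Section GenericHomotopy.
Variables (t0 t1 : R) (Lam : R -> set W) (Sf : R -> 'M[R]_m).
Hypothesis Lam_cont : lag_continuous [set t : R | t0 <= t <= t1] Lam.
Hypothesis Sf_sym : forall t, (Sf t)^T = Sf t.
Hypothesis Sf_chart : forall t, t0 <= t <= t1 -> in_chart (Sf t) (Lam t).

(** The displacement is made in a chart attached to the time t alone, so that intervals on both
    sides of a division point use the same family of nudges. *)
Definition nudge (t c : R) : set W :=
  row_span (shear_frame (Sf t) (lcoord (Sf t) (Lam t) + c *: 1%:M)).

Let lc_sym t : t0 <= t <= t1 -> (lcoord (Sf t) (Lam t))^T = lcoord (Sf t) (Lam t).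
Proof. by move=> tt; case: (lcoordP (Sf_sym t) (Sf_chart tt)). Qed.

Let nudge_sym t c : t0 <= t <= t1 ->
  (lcoord (Sf t) (Lam t) + c *: 1%:M)^T = lcoord (Sf t) (Lam t) + c *: 1%:M.
Proof. by move=> tt; rewrite linearD linearZ /= lc_sym // trmx1. Qed.

Lemma nudge0 t : t0 <= t <= t1 -> nudge t 0 = Lam t.
Proof. by move=> tt; rewrite /nudge scale0r addr0; case: (lcoordP (Sf_sym t) (Sf_chart tt)). Qed.

Lemma nudge_lcvg t c : t0 <= t <= t1 -> lcvg (nbhs c) (nudge t) (nudge t c).
Proof.
move=> tt; apply: lcvg_shear => //; first exact: nudge_sym.
  by apply: nearW => y; exact: nudge_sym.
apply: mcvgD; first exact: mcvg_cst.
by apply: mcvgZ; [exact: cvg_id|exact: mcvg_cst].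
Qed.

Lemma nudge_generic t e : t0 <= t <= t1 -> 0 < e ->
  exists2 c, `|c| < e & ~ train (@vertical R m) (nudge t c).
Proof.
move=> tt e0; have [c ce cu] := exists_unit_shift (lc_sym tt) e0.
by exists c => //; apply/not_train_unit => //; exact: nudge_sym.
Qed.

(* The end points may be moved by arbitrary small nudges off the train; this
   freedom at the division points makes the property additive. *)
Definition generic_homotopy (a b : R) := exists2 e : R, 0 < e & forall ca cb,
  `|ca| < e -> `|cb| < e -> ~ train (@vertical R m) (nudge a ca) ->
  ~ train (@vertical R m) (nudge b cb) ->
  exists (H : R * R -> set W) (Gam : R -> set W),
  [/\ lag_continuous (rect 0 1 a b) H,
      forall t, a <= t <= b -> H (0, t) = Lam t /\ H (1, t) = Gam t,
      forall s, 0 <= s <= 1 -> H (s, a) = nudge a (s * ca),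
      forall s, 0 <= s <= 1 -> H (s, b) = nudge b (s * cb) &
      generic_curve a b Gam].

Let zero01 : 0 <= (0 : R) <= 1. Proof. by rewrite lexx ler01. Qed.
Let one01 : 0 <= (1 : R) <= 1. Proof. by rewrite lexx ler01. Qed.

Lemma generic_homotopy_glue a b c : t0 <= a -> a < b -> b < c -> c <= t1 ->
  generic_homotopy a b -> generic_homotopy b c -> generic_homotopy a c.
Proof.
move=> ta ab bc ct [e1 e10 h1] [e2 e20 h2].
have tb : t0 <= b <= t1 by rewrite (ltW (le_lt_trans ta ab)) (ltW (lt_le_trans bc ct)).
have e0 : 0 < Num.min e1 e2 by rewrite lt_min e10.
exists (Num.min e1 e2) => // ca cc; rewrite !lt_min => /andP[a1 _] /andP[_ c2] na nc.
(* A common displacement of the division point, off the train and small enough for both sides. *)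
have [cb] := nudge_generic tb e0; rewrite lt_min => /andP[b1 b2] nb.
have [H1 [G1 [L1 HG1 Ha1 Hb1 gen1]]] := h1 ca cb a1 b1 na nb.
have [H2 [G2 [L2 HG2 Hb2 Hc2 gen2]]] := h2 cb cc b2 c2 nb nc.
have agree x : rect 0 1 a b x -> rect 0 1 b c x -> H1 x = H2 x.
  case: x => s t [/= s1 /andP[_ tb1]] [/= _ /andP[bt _]].
  have -> : t = b by apply/eqP; rewrite eq_le tb1.
  by rewrite Hb1 // Hb2.
have U : rect 0 1 a b `|` rect 0 1 b c = rect 0 1 a c.
  rewrite /rect -(segU (ltW ab) (ltW bc)); apply/seteqP; split=> -[s t] /=.
    by move=> [[s1 t1']|[s1 t1']]; split=> //; [left|right].
  by move=> [s1 [t1'|t1']]; [left|right].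
have Lc := lag_continuous_glue (@closed_rect _ _ _ _ _) (@closed_rect _ _ _ _ _) L1 L2 agree.
rewrite U in Lc; set H := (X in lag_continuous _ X) in Lc.
have HE1 x : rect 0 1 a b x -> H x = H1 x by move=> h; rewrite /H asboolT.
have HE2 x : rect 0 1 b c x -> H x = H2 x.
  by move=> h; rewrite /H; case: asboolP => // h'; rewrite agree.
have aab : a <= a <= b by rewrite lexx ltW.
have bab : a <= b <= b by rewrite lexx ltW.
have bbc : b <= b <= c by rewrite lexx ltW.
have cbc : b <= c <= c by rewrite lexx ltW.
exists H, (fun t => if t <= b then G1 t else G2 t); split=> //.
- move=> t /andP[at_ tc]; case: (lerP t b) => tb1.
    have tab : a <= t <= b by rewrite at_.
    by have [<- <-] := HG1 t tab; rewrite !HE1.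
  have tbc : b <= t <= c by rewrite tc ltW.
  by have [<- <-] := HG2 t tbc; rewrite !HE2.
- by move=> s s1; rewrite HE1 // Ha1.
- by move=> s s1; rewrite HE2 // Hc2.
apply: generic_glue => //.
by have [_ <-] := HG1 b bab; have [_ <-] := HG2 b bbc; rewrite Hb1 // Hb2.
Qed.

Let scalar_itv (s c e : R) : 0 <= s <= 1 -> `|c| < e -> `|s * c| < e.
Proof.
move=> /andP[s0 s1] ce; rewrite normrM (ger0_norm s0); apply: le_lt_trans ce.
by rewrite ler_piMl.
Qed.

(** Nudges are made in the charts of the end points, while the homotopy lives in the chart S of the
    whole interval; for small nudges their coordinates r in S exist and are continuous. *)
Lemma generic_homotopy_chart (S : 'M[R]_m) a b : S^T = S -> t0 <= a -> a < b -> b <= t1 ->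
  (forall t, a <= t <= b -> in_chart S (Lam t)) -> generic_homotopy a b.
Proof.
move=> Ss ta ab bt inS.
have sub t : a <= t <= b -> t0 <= t <= t1.
  by move=> /andP[h1 h2]; rewrite (le_trans ta h1) (le_trans h2).
have aab : a <= a <= b by rewrite lexx ltW.
have bab : a <= b <= b by rewrite lexx ltW.
pose T t := lcoord S (Lam t).
have TP t : a <= t <= b -> (T t)^T = T t /\ Lam t = row_span (shear_frame S (T t)).
  by move=> tab; apply: lcoordP => //; exact: inS.
have Tc t : a <= t <= b -> mcvg (within [set t | a <= t <= b] (nbhs t)) T (T t).
  move=> tab; have [_ /(_ S Ss (inS t tab))[_ h]] := (lag_continuousP _ _).1 Lam_cont t (sub t tab).
  exact: mcvg_within_sub sub h.
have chart_near x : a <= x <= b -> exists2 e : R, 0 < e &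
    forall c, `|c| < e -> in_chart S (nudge x c).
  move=> xab; have := @nudge_lcvg x 0 (sub x xab); rewrite nudge0 ?sub //.
  move=> /(_ S Ss (inS x xab))[/nbhs_ballP[e /= e0 he] _]; exists e => // c ce.
  by apply: he; rewrite /ball /= sub0r normrN.
have [ea ea0 hea] := chart_near a aab; have [eb eb0 heb] := chart_near b bab.
pose r x c := lcoord S (nudge x c).
have rP x c : in_chart S (nudge x c) ->
    (r x c)^T = r x c /\ nudge x c = row_span (shear_frame S (r x c)).
  by move=> h; exact: lcoordP.
have rc x c : a <= x <= b -> in_chart S (nudge x c) -> mcvg (nbhs c) (r x) (r x c).
  by move=> xab h; have [_ ?] := @nudge_lcvg x c (sub x xab) S Ss h.
have r0 x : a <= x <= b -> r x 0 = T x by move=> xab; rewrite /r nudge0 // sub.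
exists (Num.min ea eb) => [|ca cb]; first by rewrite lt_min ea0.
rewrite !lt_min => /andP[caa _] /andP[_ cbb] na nb.
have [rsa Ea] := rP a ca (hea _ caa); have [rsb Eb] := rP b cb (heb _ cbb).
have ua : r a ca \in unitmx by apply/(not_train_unit Ss rsa); rewrite -Ea.
have ub : r b cb \in unitmx by apply/(not_train_unit Ss rsb); rewrite -Eb.
have [T' [T's T'a T'b T'c gen]] := exists_chart_path Ss rsa rsb ua ub ab.
pose l (t : R) := (t - a) / (b - a).
(* The straight homotopy from T to T', plus corrections that vanish at s = 0 and s = 1. They are
   distributed along the interval by l and force the sides t = a and t = b to follow the nudges by s
   ca and s cb, as needed for gluing with the neighbouring intervals. *)
pose TS (x : R * R) : 'M[R]_m := T x.2 + x.1 *: (T' x.2 - T x.2)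
  + ((1 - l x.2) *: (r a (x.1 * ca) - T a - x.1 *: (r a ca - T a))
     + l x.2 *: (r b (x.1 * cb) - T b - x.1 *: (r b cb - T b))).
have la : l a = 0 by rewrite /l subrr mul0r.
have lb : l b = 1 by rewrite /l divff // subr_eq0 gt_eqF.
have TS0 t : TS (0, t) = T t.
  by rewrite /TS /= !mul0r !r0 // !scale0r !subrr ?subr0 !scaler0 !addr0.
have TS1 t : TS (1, t) = T' t.
  rewrite /TS /= !mul1r !scale1r !subrr !scaler0 !addr0 addrC subrK //.
have TSa s : TS (s, a) = r a (s * ca).
  rewrite /TS /= la T'a subr0 scale0r addr0 scale1r; move: (r a _) (r a _) (T a) => A B C.
  by apply/matrixP => i j; rewrite !mxE; ring.
have TSb s : TS (s, b) = r b (s * cb).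
  rewrite /TS /= lb T'b subrr scale0r add0r scale1r; move: (r b _) (r b _) (T b) => A B C.
  by apply/matrixP => i j; rewrite !mxE; ring.
have TSs x : rect 0 1 a b x -> (TS x)^T = TS x.
  case: x => s t [/= s1 tab].
  have [Ts _] := TP t tab; have [Tas _] := TP a aab; have [Tbs _] := TP b bab.
  have [ras _] := rP a _ (hea _ (scalar_itv s1 caa)).
  have [rbs _] := rP b _ (heb _ (scalar_itv s1 cbb)).
  have symD (A B : 'M[R]_m) : A^T = A -> B^T = B -> (A + B)^T = A + B.
    by move=> As Bs; rewrite linearD /= As Bs.
  have symN (A : 'M[R]_m) : A^T = A -> (- A)^T = - A by move=> As; rewrite linearN /= As.
  have symZ (c : R) (A : 'M[R]_m) : A^T = A -> (c *: A)^T = c *: A by move=> As; rewrite linearZ /= As.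
  have T'ts := T's t.
  have symB (A B : 'M[R]_m) : A^T = A -> B^T = B -> (A - B)^T = A - B.
    by move=> As Bs; apply: (symD) => //; exact: symN.
  have side (c : R) (A B C : 'M[R]_m) : A^T = A -> B^T = B -> C^T = C ->
      (c *: (A - B - s *: (C - B)))^T = c *: (A - B - s *: (C - B)).
    by move=> As Bs Cs; apply: (symZ); apply: (symB); [exact: symB|apply: (symZ); exact: symB].
  apply: (symD); last by apply: (symD); exact: side.
  by apply: (symD) => //; apply: (symZ); exact: symB.
have TSc x : rect 0 1 a b x -> mcvg (within (rect 0 1 a b) (nbhs x)) TS (TS x).
  move=> rx; have [s1 tab] := rx.
  have FF : Filter (within (rect 0 1 a b) (nbhs x)) by exact: within_filter.
  have c1 : y.1 @[y --> within (rect 0 1 a b) (nbhs x)] --> (x.1 : R^o).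
    have cf : (fun y : R * R => y.1) @ nbhs x --> (x.1 : R^o) by exact: cvg_fst.
    by apply: cvg_trans cf; apply: cvg_app; exact: cvg_within.
  have c2 : y.2 @[y --> within (rect 0 1 a b) (nbhs x)] --> (x.2 : R^o).
    have cf : (fun y : R * R => y.2) @ nbhs x --> (x.2 : R^o) by exact: cvg_snd.
    by apply: cvg_trans cf; apply: cvg_app; exact: cvg_within.
  have c2' : y.2 @[y --> within (rect 0 1 a b) (nbhs x)] --> within [set t | a <= t <= b] (nbhs x.2).
    apply: cvg_within_comp; last by move=> z [].
    exact: cvg_snd.
  have lc : l y.2 @[y --> within (rect 0 1 a b) (nbhs x)] --> (l x.2 : R^o).
    apply: cvgM; last exact: cvg_cst.
    by apply: cvgB => //; exact: cvg_cst.
  have Tx := mcvg_comp c2' (Tc _ tab); have T'x := mcvg_comp c2' (T'c _ tab).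
  have side z c : a <= z <= b -> in_chart S (nudge z (x.1 * c)) ->
      mcvg (within (rect 0 1 a b) (nbhs x))
        (fun y => r z (y.1 * c) - T z - y.1 *: (r z c - T z))
        (r z (x.1 * c) - T z - x.1 *: (r z c - T z)).
    move=> zab inz; apply: mcvgB; last by apply: mcvgZ => //; exact: mcvg_cst.
    apply: mcvgB; last exact: mcvg_cst.
    apply: (mcvg_comp (f := fun y => y.1 * c) _ (rc z _ zab inz)).
    by apply: cvgM => //; exact: cvg_cst.
  apply: mcvgD; first by apply: mcvgD => //; apply: mcvgZ => //; exact: mcvgB.
  apply: mcvgD; apply: mcvgZ => //.
  - by apply: cvgB => //; exact: cvg_cst.
  - by apply: side => //; apply: hea; exact: scalar_itv.
  - by apply: side => //; apply: heb; exact: scalar_itv.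
exists (fun x => row_span (shear_frame S (TS x))), (fun t => row_span (shear_frame S (T' t))).
split=> //.
- exact: lag_continuous_shear.
- by move=> t tab; rewrite TS0 TS1; have [_ <-] := TP t tab.
- by move=> s s1; rewrite TSa; have [_ <-] := rP a _ (hea _ (scalar_itv s1 caa)).
- by move=> s s1; rewrite TSb; have [_ <-] := rP b _ (heb _ (scalar_itv s1 cbb)).
Qed.
End GenericHomotopy.

Lemma exists_generic_curve (t0 t1 : R) (Lam : R -> set W) : t0 < t1 ->
  lag_continuous [set t : R | t0 <= t <= t1] Lam ->
  ~ train (@vertical R m) (Lam t0) -> ~ train (@vertical R m) (Lam t1) ->
  exists2 Gam, lag_homotopic t0 t1 Lam Gam & generic_curve t0 t1 Gam.
Proof.
move=> t01 Lc n0 n1.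
have /choice[Sf SfP] : forall t, exists S : 'M[R]_m, S^T = S /\ (t0 <= t <= t1 -> in_chart S (Lam t)).
  move=> t; case: (pselect (t0 <= t <= t1)) => tt; last by exists 0; rewrite trmx0.
  have [/is_lag_chart[S Ss inS] _] := (lag_continuousP _ _).1 Lc t tt.
  by exists S.
have Sfs t := (SfP t).1; have Sfc t := (SfP t).2.
have [e e0 he] : generic_homotopy Lam Sf t0 t1.
  apply: (@cousin _ t0 t1 (generic_homotopy Lam Sf) t01) => [x xt|a b c ta ab bc ct].
    have [_ /(_ _ (Sfs x) (Sfc x xt))[/near_withinP/nbhs_ballP[e /= e0 he] _]] :=
      (lag_continuousP _ _).1 Lc x xt.
    exists e => // a b ta ab bt xa ax xb bx.
    apply: (generic_homotopy_chart Lc Sfs Sfc (Sfs x)) => // t /andP[h1 h2].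
    apply: he; last by rewrite /= (le_trans ta h1) (le_trans h2).
    by rewrite /ball /= ltr_distlC; apply/andP; split; lra.
  exact: (generic_homotopy_glue Sfs Sfc ta ab bc ct).
have t00 : t0 <= t0 <= t1 by rewrite lexx ltW.
have t11 : t0 <= t1 <= t1 by rewrite lexx ltW.
have z : `|0 : R| < e by rewrite normr0.
have n0' : ~ train (@vertical R m) (nudge Lam Sf t0 0) by rewrite (nudge0 Sfs Sfc).
have n1' : ~ train (@vertical R m) (nudge Lam Sf t1 0) by rewrite (nudge0 Sfs Sfc).
(* The ends of the whole interval are already off the train, so zero nudges keep them fixed. *)
have [H [Gam [HL HG Ha Hb gen]]] := he 0 0 z z n0' n1'.
exists Gam => //; exists H; split=> //.
- by move=> t /HG[].
- by move=> t /HG[].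
- by move=> s /Ha ->; rewrite mulr0 (nudge0 Sfs Sfc).
- by move=> s /Hb ->; rewrite mulr0 (nudge0 Sfs Sfc).
Qed.
End Glue.

Lemma lagrangian_vertical (R : realType) m : lagrangian (@vertical R m).
Proof.
have -> : @vertical R m = row_span (row_mx 1%:M 0).
  apply/seteqP; split=> z; rewrite /vertical /=; last first.
    by move=> [x _ <-]; rewrite mul_mx_row row_mxKr mulmx0.
  by move=> z0; exists (lsubmx z) => //; rewrite mul_mx_row mulmx1 mulmx0 -{2}[z]hsubmxK z0.
apply/lagframeP; split; last by rewrite row_frameJ trmx0 mulmx0 mul0mx subrr.
by apply/row_freeP; exists (col_mx 1%:M 0); rewrite mul_row_col mulmx1 mulmx0 addr0.
Qed.

Lemma sympl_nondegenerate (R : realType) m (z : 'rV[R]_(m + m)) :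
  (forall w, sympl z w = 0) -> z = 0.
Proof.
move=> h; apply: (can_inj (mulmxK (Jmx_unit R m))); rewrite mul0mx; apply/rowP => j.
by have := h (delta_mx 0 j); rewrite symplE trmx_delta -colE mxE => ->; rewrite mxE.
Qed.

Lemma sympl_vertical (R : realType) m (v w : 'rV[R]_(m + m)) :
  vertical v -> vertical w -> sympl v w = 0.
Proof. by rewrite /vertical /sympl /= => -> ->; rewrite trmx0 !mulmx0 subrr mxE. Qed.

(** * Existence of a value of the cocycle *)

Section Existence.
Variables (R : realType) (n m : nat) (U : manifold R n) (M : manifold R m).
Variables (phi : U -> R) (Phi : U -> M).
Hypothesis phi_smooth : smooth_fun phi.
Hypothesis Phi_submersion : submersion Phi.
Hypothesis phi_Phi_morse : morse_problem phi Phi.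
Variables (t0 t1 : R) (u : R -> U) (lam : R -> cotangent M).
Hypothesis t01 : t0 < t1.
Hypothesis u_cont : {within `[t0, t1], continuous u}.
Hypothesis lam_cont : ct_continuous `[t0, t1] lam.
Hypothesis in_L : forall t, t0 <= t <= t1 -> lagrange_points phi Phi (u t, lam t).

(** A vertical tangent vector is skew-orthogonal to the vertical subspace and to the tangent space.
    By transversality these span everything, so it vanishes by nondegeneracy. *)
Lemma transversal_not_train A t : sympl_trivialization t0 t1 lam (@vertical R m) A ->
  t0 <= t <= t1 -> lagrangian (trivialized_tangent phi Phi A (fun t => (u t, lam t)) t) ->
  transversal_to_vertical phi Phi (u t, lam t) ->
  ~ train (@vertical R m) (trivialized_tangent phi Phi A (fun t => (u t, lam t)) t).
Proof.
move=> triv tt LL tr [_ [[d [z [dx zL ->]]] zv] z0].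
have [sA vA _] := triv.2 t d tt dx.
have du : charts_at (Phi (u t)) d by have := dx; rewrite /= (base_lam in_L tt).
have Au := symplectic_unit (triv_symplectic in_L triv tt du).
have zvert : vertical z.
  move: zv; rewrite -{1}vA => -[z' z'v E].
  by rewrite -(can_inj (mulmxK Au) E).
case/eqP: z0; suff -> : z = 0 by rewrite mul0mx.
apply: sympl_nondegenerate => w; have [z1 [z2 [z1L z2v ->]]] := tr d dx w.
have addr : sympl z (z1 + z2) = sympl z z1 + sympl z z2.
  by rewrite !symplE [(z1 + z2)^T]linearD mulmxDr mxDE.
rewrite addr (sympl_vertical zvert z2v) addr0 -sA.
have z1C : trivialized_tangent phi Phi A (fun t => (u t, lam t)) t (z1 *m A d t) by exists d, z1.
have zC : trivialized_tangent phi Phi A (fun t => (u t, lam t)) t (z *m A d t) by exists d, z.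
rewrite LL in z1C; exact: z1C zC.
Qed.

Lemma maslov_cocycle_exists :
  transversal_to_vertical phi Phi (u t0, lam t0) ->
  transversal_to_vertical phi Phi (u t1, lam t1) ->
  exists mu, maslov_cocycle phi Phi t0 t1 (fun t => (u t, lam t)) mu.
Proof.
move=> tr0 tr1.
have [A triv] := trivialization_exists Phi_submersion t01 u_cont lam_cont in_L.
pose C := trivialized_tangent phi Phi A (fun t => (u t, lam t)).
(* The constructed trivialization already has the vertical subspace as its reference subspace, so
   the identity plays the part of B. *)
have J1 : (1%:M : 'M[R]_(m + m)) *m Jmx R m *m 1%:M^T = Jmx R m.
  by rewrite mul1mx trmx1 mulmx1.
have v1 (v : 'rV[R]_(m + m)) : vertical v <-> vertical (v *m 1%:M) by rewrite mulmx1.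
have Cc : lag_continuous [set t | t0 <= t <= t1] C.
  have := trivialized_lag_continuous phi_smooth Phi_submersion phi_Phi_morse u_cont lam_cont in_L triv J1 v1.
  apply: lag_continuous_ext => t _; apply/seteqP; split=> w.
    by move=> [v vC <-]; rewrite mulmx1.
  by move=> wC; exists w => //; rewrite mulmx1.
have t00 : t0 <= t0 <= t1 by rewrite lexx ltW.
have t11 : t0 <= t1 <= t1 by rewrite lexx ltW.
have n0 := transversal_not_train triv t00 (Cc _ t00).1 tr0.
have n1 := transversal_not_train triv t11 (Cc _ t11).1 tr1.
have [Gam hom [Gs _ _ _ [cr fin]]] := exists_generic_curve t01 Cc n0 n1.
eexists; exists (@vertical R m), A; split=> //; first exact: lagrangian_vertical.
split=> //; exists Gam; split=> // t tt.
have [Gl [N [F [oN Fs GF]]]] := Gs t I; split=> //.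
by exists N, F; split=> // s Ns _; exact: GF.
Qed.
End Existence.

Theorem theorem2p1 (R : realType) (n m : nat)
    (U : manifold R n) (M : manifold R m) (phi : U -> R) (Phi : U -> M)
    (phi_smooth : smooth_fun phi) (Phi_submersion : submersion Phi)
    (phi_Phi_morse : morse_problem phi Phi)
    (t0 t1 : R) (t0_lt_t1 : t0 < t1)
    (u : R -> U) (lam : R -> cotangent M)
    (u_cont : {within `[t0, t1], continuous u})
    (lam_cont : ct_continuous `[t0, t1] lam)
    (in_L : forall t, t0 <= t <= t1 -> lagrange_points phi Phi (u t, lam t))
    (transv0 : transversal_to_vertical phi Phi (u t0, lam t0))
    (transv1 : transversal_to_vertical phi Phi (u t1, lam t1)) :
  (exists mu : int,
     maslov_cocycle phi Phi t0 t1 (fun t => (u t, lam t)) mu) /\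
  forall mu : int,
    maslov_cocycle phi Phi t0 t1 (fun t => (u t, lam t)) mu ->
  forall c0 d0 c1 d1,
    charts_at (u t0) c0 -> charts_at (Phi (u t0)) d0 ->
    charts_at (u t1) c1 -> charts_at (Phi (u t1)) d1 ->
    - 2 * mu = sgn_hess phi Phi c1 d1 (u t1, lam t1)
             - sgn_hess phi Phi c0 d0 (u t0, lam t0).
Proof.
split=> [|mu h c0 d0 c1 d1]; first exact: maslov_cocycle_exists.
exact: maslov_sgn_hess h c0 d0 c1 d1.
Qed.
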